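(* There exists a minimizer of the phase space uncertainty $\mathcal{L}_{\rm P}$ in $\mathcal{D}_{\rm P}$: there is $f_0\in\mathcal{D}_{\rm P}$ with $\mathcal{L}_{\rm P}(f_0)\le\mathcal{L}_{\rm P}(f)$ for every $f\in\mathcal{D}_{\rm P}$.
   Context: $\mathbb{R}^+$ denotes the positive reals. $\mathcal{S}=L^2(\mathbb{R}^+)$ is the space of (complex-valued) $f\in L^2(\mathbb{R})$ supported in $\mathbb{R}^+$, with its usual inner product $\langle\cdot,\cdot\rangle_{\mathcal S}$ and norm. $\mathcal{W}=L^2(\mathbb{R}^+,\frac{1}{\omega}d\omega)$ with $\langle f_1,f_2\rangle_{\mathcal W}=\int_0^\infty f_1(\omega)\overline{f_2(\omega)}\frac{d\omega}{\omega}$. Observables: $T_xf=if'$ and $T_\sigma f(\omega)=-\ln(\omega)f(\omega)$. For an operator $T$ in $\mathcal H\in\{\mathcal S,\mathcal W\}$ and a unit vector $g\in\mathcal H$ in its domain, $e^{\mathcal H}_g(T)=\langle Tg,g\rangle_{\mathcal H}$ and $v^{\mathcal H}_g(T)=\|(T-e^{\mathcal H}_g(T))g\|^2_{\mathcal H}$. $\mathcal{D}_{\rm P}$ is the set of $f\in L^2(\mathbb{R}^+)$ (viewed as functions on $\mathbb{R}$ vanishing on $(-\infty,0)$) that are absolutely continuous on every compact interval, satisfy $\|f\|_{\mathcal S}=1$, $e_f^{\mathcal S}(T_x)=e_f^{\mathcal S}(T_\sigma)=0$, and for which the functions $\omega\mapsto f'(\omega)$, $\omega\mapsto\sqrt{\omega}f'(\omega)$,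 $\omega\mapsto f(\omega)/\omega$, $\omega\mapsto\ln(\omega)f(\omega)$ are square integrable. For $f\in\mathcal{D}_{\rm P}$ the phase space uncertainty is given by $$\mathcal{L}_{\rm P}(f)=\|T_xf\|_{\mathcal S}^2+\|T_\sigma f\|_{\mathcal S}^2+v^{\mathcal W}_{f/\|f\|_{\mathcal W}}\Big(i\omega\tfrac{\partial}{\partial\omega}\Big)\,\Big\|\frac{f}{\omega}\Big\|_{\mathcal S}^2+v^{\mathcal W}_{f/\|f\|_{\mathcal W}}(-\ln(\omega)),$$ where $i\omega\frac{\partial}{\partial\omega}$ is the operator $g\mapsto i\omega g'(\omega)$ and $-\ln(\omega)$ denotes multiplication by $-\ln(\omega)$. (This functional arises as the sum of the variances, in the scale variable $\alpha$ and the time variable $\beta$, of the $L^2(\mathbb{R}^2,e^{-\alpha}d\alpha d\beta)$-normalized ambiguity function $K_f(\alpha,\beta)=\langle f,\pi(\alpha,\beta)f\rangle_{\mathcal S}$, where $\pi$ is the wavelet representation by dilations and translations in the frequency domain; the displayed formula is to be taken as the definition of $\mathcal{L}_{\rm P}$ on $\mathcal{D}_{\rm P}$.) *)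

(* Defs.v *)
From HB Require Import structures.
From mathcomp Require Import all_boot all_order all_algebra.
From mathcomp Require Import complex.
From mathcomp Require Import all_classical all_reals all_analysis.

Set Implicit Arguments.
Unset Strict Implicit.
Unset Printing Implicit Defensive.

Import Order.TTheory GRing.Theory Num.Theory.
Import numFieldNormedType.Exports.

Local Open Scope classical_set_scope.
Local Open Scope complex_scope.
Local Open Scope ring_scope.

Local Notation ReC := (@complex.Re _).
Local Notation ImC := (@complex.Im _).

Section PhaseSpaceUncertainty.
Context {R : realType}.
Implicit Types (f g : R -> R[i]) (w : R -> R).

Definition Rpos : set R := `]0, +oo[.

(* Complex-valued integrals and derivatives are taken componentwise, R[i]
   carrying neither a sigma-algebra nor a normed R-module structure. *)
Definition Cintegral (D : set R) g : R[i] :=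
  (\int[lebesgue_measure]_(x in D) ReC (g x))
  +i* (\int[lebesgue_measure]_(x in D) ImC (g x)).

(* Pointwise derivative; for absolutely continuous g it takes a default value
   on the null set where g is not differentiable. *)
Definition Cderive g : R -> R[i] :=
  fun x => ((ReC \o g)^`()%classic x) +i* ((ImC \o g)^`()%classic x).

Definition square_integrable g : Prop :=
  [/\ measurable_fun Rpos (ReC \o g),
      measurable_fun Rpos (ImC \o g) &
      (\int[lebesgue_measure]_(x in Rpos) (ReC (`|g x| ^+ 2))%:E
        < +oo)%E].

Definition absolutely_continuous (a b : R) g : Prop :=
  forall e : R, 0 < e -> exists2 d : R, 0 < d &
    forall (n : nat) (u v : 'I_n -> R),
      (forall k, [/\ a <= u k, u k <= v k & v k <= b]) ->
      trivIset [set: 'I_n] (fun k => [set` `]u k, v k[]) ->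
      \sum_(k < n) (v k - u k) < d ->
      \sum_(k < n) `|g (v k) - g (u k)| < e%:C.

(* The inner product, norm, expected value and variance of
   L^2(R^+, w(x) dx), T being an operator on functions. *)
Definition inner w g1 g2 : R[i] :=
  Cintegral Rpos (fun x => g1 x * (g2 x)^*%C * (w x)%:C).

Definition norm2 w g : R := Num.sqrt (ReC (inner w g g)).

Definition op_mean w (T : (R -> R[i]) -> (R -> R[i])) g : R[i] :=
  inner w (T g) g.

Definition op_variance w (T : (R -> R[i]) -> (R -> R[i])) g : R :=
  norm2 w (fun x => T g x - op_mean w T g * g x) ^+ 2.

Definition wS : R -> R := fun=> 1.

Definition wW : R -> R := fun x => x^-1.

Definition Tx g : R -> R[i] := fun x => 'i%C * Cderive g x.

Definition Tsigma g : R -> R[i] := fun x => (- ln x)%:C * g x.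

Definition Tomega g : R -> R[i] := fun x => 'i%C * x%:C * Cderive g x.

Definition DP : set (R -> R[i]) := [set f |
  [/\ (forall x, x < 0 -> f x = 0),
      square_integrable f &
      forall a b, a <= b -> absolutely_continuous a b f] /\
  [/\ norm2 wS f = 1, op_mean wS Tx f = 0 & op_mean wS Tsigma f = 0] /\
  [/\ square_integrable (Cderive f),
      square_integrable (fun x => (Num.sqrt x)%:C * Cderive f x),
      square_integrable (fun x => f x / x%:C) &
      square_integrable (fun x => (ln x)%:C * f x)]].

Definition normalizeW f : R -> R[i] := fun x => f x / (norm2 wW f)%:C.

Definition LP f : R :=
  norm2 wS (Tx f) ^+ 2 + norm2 wS (Tsigma f) ^+ 2
  + op_variance wW Tomega (normalizeW f) * norm2 wS (fun x => f x / x%:C) ^+ 2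
  + op_variance wW Tsigma (normalizeW f).

End PhaseSpaceUncertainty.

(* Main.v *)
Require Import Defs.
From HB Require Import structures.
From mathcomp Require Import all_boot all_order all_algebra.
From mathcomp Require Import complex.
From mathcomp Require Import all_classical all_reals all_analysis.
From mathcomp Require Import measurable_realfun.
From mathcomp Require Import ring lra.

(** The minimizer is found by the direct method.  For f in DP put
    rho = |f|^2, let A and C be the integrals of |f'|^2 and of x |f'|^2 over
    the half-line, and let B, N, D, M1, M2 be the moments of rho against
    ln^2, 1/x, 1/x^2, ln/x and ln^2/x.  As the mean of T_x vanishes on DP, so
    does that of T_omega, and the functional becomes
      A + B + (C / N) * D + (M2 / N - (M1 / N)^2)          (lemma LPE),
    a sum of four nonnegative terms.

    Take a minimizing sequence f_n and put u_n = |f_n|.  The modulus has the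
    same moments as f_n, and it no longer feels the phase: a real absolutely
    continuous function has T_x-mean zero because u u' is the derivative of
    u^2 / 2 (Rintegral_mul_derive1).  So the limit may be looked for among the
    real functions, and the one constraint that involves derivatives, hence
    would be hard to pass to the limit, takes care of itself.  The energies
    enter only through
      (u_n(b) - u_n(a))^2 <= (b - a) * (integral of |f_n'|^2 over ]a, b[),
    which is modulus_cauchy_schwarz.  It makes the u_n uniformly 1/2-Hoelder,
    so that a subsequence converges pointwise (equicontinuous_extraction), and
    makes the limit u absolutely continuous (line_ac_limit).

    The bound on B prevents mass from escaping to 0 or to infinity, so that the
    normalization and the mean of ln pass to the limit (limit_mass,
    limit_ln_mean).  A and C are lower semicontinuous (energy_lsc): derivatives
    are replaced by difference quotients, which pass to the limit by Fatou's
    lemma and which Tonelli's theorem bounds by the energies.  It remains to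
    exclude that D explodes while C tends to 0.  The limit has C > 0
    (wkinetic_gt0), so by semicontinuity C >= c > 0 along the sequence; since
    N <= (s + D / s) / 2 for all s > 0, the inequality C D <= K N then bounds D
    (singular_moment_bound).  Once D is bounded, the moments N and M1 converge,
    while B, D and M2 are lower semicontinuous by Fatou's lemma; hence u is in
    DP and its uncertainty is at most the infimum (minimizing_limit).

    Two further facts are needed.  One is the fundamental theorem of calculus
    for absolutely continuous functions (loc_ac_ftc): the total variation of
    such a function is absolutely continuous, so the function is a difference
    of monotone ones whose Stieltjes measures are dominated by Lebesgue
    measure; the Radon-Nikodym theorem provides a density, and Lebesgue's
    differentiation theorem identifies it with the pointwise derivative.  The
    other is that DP is not empty (DP_nonempty): superpose two bumps supported
    on either side of 1, weighted so that the mean of ln is zero. *)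

Set Implicit Arguments.
Unset Strict Implicit.
Unset Printing Implicit Defensive.

Import Order.TTheory GRing.Theory Num.Theory.
Import numFieldNormedType.Exports.
Local Open Scope classical_set_scope.
Local Open Scope complex_scope.
Local Open Scope ring_scope.

(** * Absolute continuity, Stieltjes measures and total variation *)

Section ac.
Context {R : realType}.
Implicit Types (I J : R * R) (s t : seq (R * R)) (p F : R -> R).
Local Notation mu := (@lebesgue_measure R).

Definition nonoverlapping I J := (I.2 <= J.1) || (J.2 <= I.1).

(** The families of disjoint intervals of the epsilon-delta definition, as
    finite sequences of pairs of end points: sequences concatenate, which the
    induction on total variations below relies on, and degenerate intervals
    are allowed. *)
Definition itv_family s :=
  all (fun I => I.1 <= I.2) s && pairwise nonoverlapping s.

Definition total_length s := \sum_(I <- s) (I.2 - I.1).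

Definition oscillation p s := \sum_(I <- s) `|p I.2 - p I.1|.

Definition unif_ac p := forall e, 0 < e -> exists2 d, 0 < d &
  forall s, itv_family s -> total_length s < d -> oscillation p s <= e.

Lemma unif_ac_continuous p : unif_ac p -> continuous p.
Proof.
move=> pac x; apply/cvgrPdist_le => e e0.
have [d d0 pd] := pac e e0.
apply/nbhs_ballP; exists d => //= y; rewrite /ball/= => xyd.
have [xy|yx] := lerP x y.
- have := pd [:: (x, y)].
  rewrite /itv_family/= xy/= => /(_ isT).
  rewrite /total_length /oscillation !big_seq1/= [in X in _ -> X]distrC; apply.
  by rewrite (le_lt_trans _ xyd)// distrC ler_norm.
- have := pd [:: (y, x)].
  rewrite /itv_family/= (ltW yx)/= => /(_ isT).
  rewrite /total_length /oscillation !big_seq1/=; apply.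
  by rewrite (le_lt_trans _ xyd)// ler_norm.
Qed.

(** Components of an open set carry neither end points nor a boundedness
    proof. The lemma provides end points with the right length, so that a
    Stieltjes measure can be evaluated. *)
Lemma open_interval_hull (I : set R) : open I -> is_interval I -> I !=set0 ->
  (mu I < +oo)%E -> exists a b : R, [/\ a < b, mu I = (b - a)%:E,
    I `<=` `]a, b] & `]a, b[ `<=` I].
Proof.
move=> oI /is_intervalP; set i := Rhull I => eI [z Iz].
have lt_i x : I x -> (exists2 y, I y & y < x) /\ (exists2 y, I y & x < y).
  move=> /oI /nbhs_ballP[r /= r0 rI].
  split; [exists (x - r / 2)|exists (x + r / 2)].
  - apply: rI; rewrite /ball/= opprB addrCA subrr addr0 gtr0_norm; lra.
  - lra.
  - apply: rI; rewrite /ball/= opprD addNKr normrN gtr0_norm; lra.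
  - lra.
rewrite eI lebesgue_measure_itv.
case: i eI => [[la a|[]] [rb b|[]]] eI; rewrite ?ltxx ?ltNyr ?ltry//=; do ?by
  move: Iz; rewrite eI /= in_itv/= ?andbF.
have Iab x : I x -> a <= x <= b.
  by rewrite eI /= in_itv/= => /andP[/lteifW -> /lteifW ->].
have ab : a < b.
  have [[y Iy yz] [t It zt]] := lt_i _ Iz.
  have /andP[ay _] := Iab _ Iy; have /andP[_ tb] := Iab _ It.
  by rewrite (le_lt_trans ay)// (lt_trans yz)// (lt_le_trans zt).
rewrite lte_fin ab => _; exists a, b; split => //.
- rewrite -eI => x Ix; rewrite /= in_itv/=.
  have /andP[_ ->] := Iab _ Ix; rewrite andbT.
  have [[y Iy yx] _] := lt_i _ Ix.
  by have /andP[ay _] := Iab _ Iy; exact: le_lt_trans yx.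
- apply: subset_itv; rewrite bnd_simp//.
Qed.

Lemma lebesgue_stieltjes_itv (F : cumulative R R) (a b : R) : a <= b ->
  lebesgue_stieltjes_measure F `]a, b] = (F b - F a)%:E.
Proof.
move=> ab; rewrite /lebesgue_stieltjes_measure/= /measure_extension.
rewrite measurable_mu_extE/=; last exact: is_ocitv.
by rewrite wlength_itv_bnd.
Qed.

(** A null set lies in an open set of small Lebesgue measure. Finitely many
    components of that set form an interval family of small length, over
    which F increases little; the Stieltjes measure is the supremum of these
    increases. *)
Lemma unif_ac_stieltjes_dominated (F : cumulative R R) : unif_ac F ->
  lebesgue_stieltjes_measure F `<< mu.
Proof.
move=> acF; set nu := lebesgue_stieltjes_measure F.
apply/null_content_dominatesP => A mA A0.
apply/eqP; rewrite eq_le measure_ge0 andbT; apply/lee_addgt0Pr => e e0.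
rewrite add0e.
have [d d0 Fd] := acF e e0.
(* An open set U containing A with mu U < d, and its components I q. *)
have [U [oU AU UAd]] : exists U : set R, [/\ open U, A `<=` U & (mu (U `\` A) < d%:E)%E].
  by apply: lebesgue_regularity_outer => //; rewrite [X in (X < _)%E]A0.
have mU : measurable U by exact: open_measurable.
have Ud : (mu U < d%:E)%E.
  rewrite -(setDUK AU) (le_lt_trans (measureU2 _ _ _))//.
    exact: measurableD.
  by rewrite A0 add0e.
have [I [/all_and2[oI iI] tI UE]] : exists I : nat -> set R,
    [/\ forall q, open (I q) /\ is_interval (I q), trivIset setT I & U = \bigcup_q I q].
  exists (open_disjoint_itv oU); split.
  - by move=> q; split; [exact: open_disjoint_itv_open|exact: open_disjoint_itv_is_interval].
  - exact: open_disjoint_itv_trivIset.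
  - exact: open_disjoint_itv_bigcup.
have mI q : measurable (I q) by exact: open_measurable.
have sumI n : (\sum_(i < n) mu (I i) < d%:E)%E.
  rewrite -measure_bigsetU//.
  apply: le_lt_trans Ud; apply: le_measure; rewrite ?inE//.
    by apply: bigsetU_measurable => i _; exact: mI.
  by rewrite UE; exact: bigsetU_bigcup.
have muIoo q : (mu (I q) < +oo)%E.
  by apply: le_lt_trans (lt_trans Ud (ltry d)); apply: le_measure; [rewrite inE; exact: mI|rewrite inE; exact: mU|rewrite UE; exact: bigcup_sup].
have hull q : exists J : R * R, I q !=set0 ->
    [/\ J.1 < J.2, mu (I q) = (J.2 - J.1)%:E, I q `<=` `]J.1, J.2] & `]J.1, J.2[ `<=` I q].
  have [I0|] := pselect (I q !=set0); last by exists (0, 0).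
  by have [a [b abI]] := open_interval_hull (oI q) (iI q) I0 (muIoo q); exists (a, b).
have [J JP] := choice hull.
apply: (@le_trans _ _ (nu U)); first by rewrite le_measure ?inE.
rewrite UE; have nuU : semi_sigma_additive nu by exact: measure_semi_sigma_additive.
have mUI : measurable (\bigcup_q I q) by exact: bigcup_measurable.
have := nuU _ mI tI mUI.
move=> /cvg_lim <-//; apply: lime_le.
  by apply: is_cvg_nneseries => *; exact: measure_ge0.
apply: nearW => n.
(* Empty components have no end points and are dropped. *)
pose s := [seq J i | i <- iota 0 n & `[< I i !=set0 >]].
have sumE (m : {measure set (measurableTypeR R) -> \bar R}) :
    (\sum_(0 <= i < n) m (I i) = \sum_(i <- iota 0 n | `[< I i !=set0 >]) m (I i))%E.
  rewrite [LHS](bigID (fun i => `[< I i !=set0 >]))/= [X in (_ + X)%E]big1 ?adde0.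
    by rewrite /index_iota subn0.
  by move=> i /asboolPn/nonemptyPn ->; rewrite measure0.
have fs : itv_family s.
  apply/andP; split.
    apply/allP => K /mapP[q]; rewrite mem_filter => /andP[/asboolP Ii0 _] ->.
    by have [/ltW] := JP _ Ii0.
  rewrite /s pairwise_map.
  apply: (@sub_in_pairwise _ (fun i => `[< I i !=set0 >]) (fun i j => i != j)); last 2 first.
  - by apply/allP => i; rewrite mem_filter => /andP[].
  - by rewrite -uniq_pairwise filter_uniq// iota_uniq.
  move=> i j /asboolP/JP[i1 _ _ iI'] /asboolP/JP[j1 _ _ jI'] ij.
  rewrite /relpre/= /nonoverlapping; apply: contraT; rewrite negb_or -!ltNge => /andP[h1 h2].
  set x := Num.max (J i).1 (J j).1; set y := Num.min (J i).2 (J j).2.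
  have xy : x < y by rewrite /x /y gt_max !lt_min i1 j1 h1 h2.
  move/trivIsetP : tI => /(_ i j Logic.I Logic.I ij)/seteqP[/(_ ((x + y) / 2)) h _]; suff: False by []; apply: h.
  have /andP[xm my] : x < (x + y) / 2 < y by apply/andP; split; lra.
  by split; [apply: iI'|apply: jI'] => /=; rewrite in_itv/=;
    move: xm my; rewrite gt_max lt_min => /andP[a1 a2] /andP[b1 b2]; apply/andP; split => //; exact: ltW.
have sE (m : {measure set (measurableTypeR R) -> \bar R}) (G : R -> R) :
    (forall i, I i !=set0 -> m (I i) <= (G (J i).2 - G (J i).1)%:E)%E ->
    (\sum_(0 <= i < n) m (I i) <= (\sum_(K <- s) (G K.2 - G K.1))%:E)%E.
  move=> mG; rewrite big_map big_filter -sumEFin sumE; apply: lee_sum => i.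
  by move=> /asboolP; exact: mG.
have len_s : total_length s < d.
  rewrite -lte_fin (le_lt_trans _ (sumI n))// /total_length big_map big_filter -sumEFin.
  rewrite -(big_mkord xpredT (fun i => mu (I i))) (sumE mu); apply: lee_sum => i /asboolP/JP.
  by case=> _ E _ _; rewrite [X in (_ <= X)%E]E.
apply: (le_trans (sE nu F _)).
  move=> i /JP[Ji _ IJ _]; rewrite -(@lebesgue_stieltjes_itv F) ?(ltW Ji)//.
  apply: le_measure; [rewrite inE; exact: mI|rewrite inE; exact: measurable_itv|exact: IJ].
rewrite lee_fin (le_trans _ (Fd _ fs len_s))// /oscillation ler_sum// => K _.
exact: ler_norm.
Qed.

Definition partition_itvs (u : R) (P : seq R) := zip (u :: P) P.

(** Turns the partitions in the definition of total variation into interval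
    families, to which the epsilon-delta condition applies. *)
Lemma partition_itvsP (u v : R) P : itv_partition u v P ->
  [/\ itv_family (partition_itvs u P),
      all (fun I => (u <= I.1) && (I.2 <= v)) (partition_itvs u P),
      total_length (partition_itvs u P) = v - u &
      forall p, oscillation p (partition_itvs u P) = variation u v p P].
Proof.
move=> uvP.
have osc p : oscillation p (partition_itvs u P) = variation u v p P.
  rewrite (variation_zip _ uvP) /oscillation /partition_itvs.
  elim: P {uvP} u => [|x P IH] u /=; first by rewrite !big_nil.
  by rewrite !big_cons /= IH.
suff [F1 F2 F3] : [/\ itv_family (partition_itvs u P),
      all (fun I => (u <= I.1) && (I.2 <= v)) (partition_itvs u P) &
      total_length (partition_itvs u P) = v - u] by [].
rewrite /itv_family /total_length /partition_itvs.
elim: P u uvP {osc} => [|x P IH] u uvP /=.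
  by rewrite big_nil (itv_partition_nil uvP) subrr.
have := IH _ (itv_partition_cons uvP).
have xv : x <= v by apply: itv_partition_le (itv_partition_cons uvP).
have ux : u < x by case: uvP => /= /andP[].
move=> [/andP[F1 F2] F3 F4]; split.
- rewrite F1 F2 (ltW ux) !andbT/=; apply/allP => I IP.
  by move/allP : F3 => /(_ I IP)/andP[xI _]; rewrite /nonoverlapping/= xI.
- rewrite lexx xv/=; apply/allP => I IP; move/allP : F3 => /(_ I IP)/andP[xI ->].
  by rewrite andbT (le_trans _ xI)// ltW.
- by rewrite big_cons F4/= addrC subrKA.
Qed.

(** The same delta serves the total variation function. The intervals of s
    are replaced by arbitrary partitions one at a time, taking a supremum
    after each replacement; t collects the pieces already chosen. *)
Lemma unif_ac_total_variation p e d :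
  (forall s, itv_family s -> total_length s < d -> oscillation p s <= e) ->
  forall s t, itv_family (s ++ t) -> total_length (s ++ t) < d ->
  (\sum_(I <- s) total_variation I.1 I.2 p + (oscillation p t)%:E <= e%:E)%E.
Proof.
move=> H; elim => [|I s IH] t fst lst.
  by rewrite big_nil add0e lee_fin; exact: H.
rewrite big_cons.
have I12 : I.1 <= I.2 by move/andP: fst => [] /= /andP[].
have sTV0 : (0 <= \sum_(J <- s) total_variation J.1 J.2 p)%E.
  rewrite big_seq sume_ge0// => J Js; apply: total_variation_ge0.
  by move/andP: fst => [+ _] => /allP/(_ J); apply; rewrite inE mem_cat Js orbT.
have key P : itv_partition I.1 I.2 P ->
    ((variation I.1 I.2 p P)%:E + (\sum_(J <- s) total_variation J.1 J.2 p +
    (oscillation p t)%:E) <= e%:E)%E.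
  move=> IP; have [P1 P2 P3 P4] := partition_itvsP IP.
  have := IH (partition_itvs I.1 P ++ t).
  rewrite /oscillation big_cat/= -!/(oscillation _ _) P4 EFinD addeCA; apply.
    move: fst P1; rewrite /itv_family /= !all_cat !pairwise_cat /=.
    rewrite allrel_catr.
    move=> /and5P[/and3P[_ -> ->] /andP[Is It] -> -> ->].
    move=> /andP[-> ->]/=; rewrite !andbT.
    have sub J : nonoverlapping I J -> forall K, K \in partition_itvs I.1 P -> nonoverlapping K J /\ nonoverlapping J K.
      move=> IJ K /(allP P2)/andP[k1 k2]; move: IJ; rewrite /nonoverlapping => /orP[h|h].
        by rewrite (le_trans k2 h)/= orbT.
      by rewrite (le_trans h k1)/= orbT.
    apply/andP; split.
      by apply/allrelP => J K Js Kp; have [] := sub _ (allP Is _ Js) _ Kp.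
    by apply/allrelP => K J Kp Jt; have [] := sub _ (allP It _ Jt) _ Kp.
  move: lst P3; rewrite /total_length/= !big_cons !big_cat/= => lst ->; lra.
(* Subtracting below requires a finite term; any partition of the first
   interval shows it. *)
have Xfin : (\sum_(J <- s) total_variation J.1 J.2 p + (oscillation p t)%:E)%E \is a fin_num.
  have [P IP] : exists P, itv_partition I.1 I.2 P.
    move: I12; rewrite le_eqVlt => /orP[/eqP ->|I12].
      by exists [::]; split => /=.
    by exists [:: I.2]; exact: itv_partition1.
  have osc0 : (0 <= (oscillation p t)%:E)%E by rewrite lee_fin sumr_ge0.
  rewrite ge0_fin_numE ?adde_ge0//.
  apply: (le_lt_trans _ (ltry e)); apply: le_trans (key _ IP).
  by rewrite leeDr// lee_fin sumr_ge0.
rewrite -addeA -leeBrDr//; apply: ge_ereal_sup => _ [_ [P IP <-] <-].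
by rewrite leeBrDr//; exact: key.
Qed.

(** With d the delta for epsilon = 1, the variation over an interval shorter
    than d is at most 1, and finitely many steps of length d / 2 cover [u,
    v]. *)
Lemma unif_ac_bounded_variation p u v : unif_ac p -> u <= v ->
  bounded_variation u v p.
Proof.
move=> acp uv; apply/bounded_variationP => //.
have [d d0 pd] := acp 1 ltr01.
have small x y : x <= y -> y - x < d -> total_variation x y p \is a fin_num.
  move=> xy xyd; rewrite ge0_fin_numE ?total_variation_ge0//.
  have := @unif_ac_total_variation p 1 d pd [:: (x, y)] [::].
  rewrite /itv_family /total_length/= !big_seq1 xy /oscillation/= big_nil adde0.
  by move=> /(_ isT xyd)/le_lt_trans; apply; rewrite ltry.
pose N := Num.truncn ((v - u) / (d / 2)).
suff H n : forall x, u <= x -> x - u < n.+1%:R * (d / 2) -> total_variation u x p \is a fin_num.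
  apply: (H N) => //; rewrite -ltr_pdivrMr; last lra.
  exact: truncnS_gt.
elim: n => [|n IH] x ux; first by rewrite mul1r => xu; apply: small => //; lra.
move=> xd; have [xsmall|xlarge] := ltP (x - u) d; first exact: small.
rewrite (@total_variationD _ u x (x - d / 2)); [|lra..].
rewrite fin_numD IH ?small//; [lra|lra|lra|].
by move: xd; rewrite -natr1 mulrDl; lra.
Qed.
End ac.

(** * Densities of absolutely continuous functions *)

Section density.
Context {R : realType}.
Implicit Types (I J : R * R) (s t : seq (R * R)) (p F : R -> R).
Local Notation mu := (@lebesgue_measure R).

Lemma unif_acB p q : unif_ac p -> unif_ac q -> unif_ac (p \- q).
Proof.
move=> acp acq e e0; have e20 : 0 < e / 2 by lra.
have [d d0 pd] := acp _ e20; have [d' d'0 qd] := acq _ e20.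
exists (Num.min d d'); first by rewrite lt_min d0.
move=> s fs; rewrite lt_min => /andP[/(pd _ fs) h1 /(qd _ fs) h2].
have : oscillation (p \- q) s <= oscillation p s + oscillation q s.
  rewrite /oscillation -big_split/= ler_sum// => I _.
  by rewrite opprD addrACA -opprD (le_trans (ler_normB _ _)).
move=> /le_trans; apply; lra.
Qed.

(** Radon-Nikodym for the Stieltjes measure of F, restricted to ]a, b] to
    make it finite. *)
Lemma unif_ac_monotone_density F a b : nondecreasing F -> unif_ac F ->
  exists2 g : R -> R, mu.-integrable setT (EFin \o g) &
    forall x, a <= x <= b -> F x - F a = \int[mu]_(t in `]a, x]) g t.
Proof.
move=> ndF acF.
have rcF : right_continuous F.
  by apply: right_continuousW; exact: unif_ac_continuous.
pose G : cumulative R R := HB.pack F (isCumulative.Build _ _ _ F ndF rcF).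
pose nu := lebesgue_stieltjes_measure G.
have mab : measurable (`]a, b] : set (measurableTypeR R)) by exact: measurable_itv.
have nuab : (nu `]a, b]%classic < +oo)%E.
  have [ab|ba] := leP a b.
    by rewrite /nu lebesgue_stieltjes_itv// ltry.
  by rewrite set_itv_ge; [rewrite /nu measure0 ltry|rewrite -leNgt bnd_simp ltW].
pose nuab' : {finite_measure set (measurableTypeR R) -> \bar R} := mfrestr mab nuab.
have dom : nuab' `<< mu.
  apply/null_content_dominatesP => A mA A0.
  have /null_content_dominatesP/(_ A mA A0) nuA0 := unif_ac_stieltjes_dominated (F := G) acF.
  apply/eqP; rewrite eq_le measure_ge0 andbT -nuA0.
  rewrite /nuab' /= /mfrestr/= /mrestr.
  by apply: le_measure; [rewrite inE; exact: measurableI|rewrite inE; exact: mA|exact: subIsetl].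
have [f [f0 ffin fint nuf]] := radon_nikodym_sigma_finite dom.
have fE : EFin \o (fine \o f) = f by apply/funext => x /=; rewrite fineK.
exists (fine \o f); first by rewrite fE.
move=> x /andP[ax xb].
have := nuf `]a, x]%classic (measurable_itv _).
rewrite /nuab'/= /mfrestr/= /mrestr setIidl; last first.
  by apply: subset_itvl; rewrite bnd_simp.
rewrite lebesgue_stieltjes_itv// => nufx.
rewrite /Rintegral -[LHS]/(fine (F x - F a)%:E) nufx; congr fine.
by apply: eq_integral => t _ /=; rewrite fineK.
Qed.

(** Retraction onto [a, b]: composing with it turns absolute continuity on
    [a, b] into absolute continuity on the whole line. *)
Definition clamp a b (x : R) := Num.max a (Num.min b x).

Lemma clamp_id a b x : a <= x <= b -> clamp a b x = x.
Proof. by move=> /andP[ax xb]; rewrite /clamp (min_idPr _)// (max_idPr _). Qed.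

Lemma clamp_itv a b x : a <= b -> a <= clamp a b x <= b.
Proof. by move=> ab; rewrite /clamp le_max lexx ge_max ab ge_min lexx. Qed.

Lemma le_clamp a b : nondecreasing (clamp a b).
Proof. by move=> x y xy; rewrite /clamp; apply: le_max2 => //; apply: le_min2. Qed.

Lemma clamp_lip a b x y : a <= b -> x <= y -> clamp a b y - clamp a b x <= y - x.
Proof.
move=> ab xy; rewrite /clamp /Num.max /Num.min.
by repeat case: ifPn; rewrite -?leNgt; lra.
Qed.

Definition clamp_itvs a b s := [seq (clamp a b J.1, clamp a b J.2) | J <- s].

Lemma clamp_itvs_family a b s : a <= b -> itv_family s ->
  itv_family (clamp_itvs a b s).
Proof.
move=> ab /andP[/allP s1 s2]; apply/andP; split.
  by apply/allP => _ /mapP[I Is ->]/=; apply: le_clamp; exact: s1.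
rewrite pairwise_map; apply: sub_pairwise s2 => I J /orP[h|h]; apply/orP; [left|right];
  exact: le_clamp.
Qed.

Lemma clamp_itvs_length a b s : a <= b -> itv_family s ->
  total_length (clamp_itvs a b s) <= total_length s.
Proof.
move=> ab /andP[/allP s1 s2]; rewrite /total_length big_map/=.
rewrite big_seq [leRHS]big_seq ler_sum// => I Is; apply: clamp_lip => //; exact: s1.
Qed.

Lemma unif_ac_clamp p a b : a <= b -> unif_ac p -> unif_ac (p \o clamp a b).
Proof.
move=> ab acp e e0; have [d d0 pd] := acp _ e0.
exists d => // s fs ds.
have := pd _ (clamp_itvs_family ab fs) (le_lt_trans (clamp_itvs_length ab fs) ds).
by rewrite /oscillation big_map.
Qed.

(** Constant outside [a, b], so that it is nondecreasing and absolutely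
    continuous on the whole line. *)
Definition clamped_variation p a b x := fine (total_variation a (clamp a b x) p).

Lemma clamped_variationB p a b x y : unif_ac p -> a <= b -> x <= y ->
  (clamped_variation p a b y - clamped_variation p a b x)%:E =
  total_variation (clamp a b x) (clamp a b y) p.
Proof.
move=> acp ab xy; have /andP[ax xb] := clamp_itv x ab.
have cxy := le_clamp a b xy.
have fin u v : u <= v -> total_variation u v p \is a fin_num.
  by move=> uv; apply/bounded_variationP => //; exact: unif_ac_bounded_variation.
rewrite /clamped_variation (total_variationD p ax cxy) EFinB !fineK ?fin ?fin_numD ?fin//.
by rewrite addeAC subee ?add0e// fin.
Qed.

Lemma unif_ac_clamped_variation p a b : a <= b -> unif_ac p ->
  unif_ac (clamped_variation p a b).
Proof.
move=> ab acp e e0; have [d d0 pd] := acp _ e0; exists d => // s fs ds.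
have := @unif_ac_total_variation _ p e d pd (clamp_itvs a b s) [::].
rewrite cats0 => /(_ (clamp_itvs_family ab fs)).
move=> /(_ (le_lt_trans (clamp_itvs_length ab fs) ds)).
rewrite /oscillation big_nil adde0 big_map -lee_fin -sumEFin; apply: le_trans.
rewrite big_seq [leRHS]big_seq lee_sum// => I Is.
have I12 : I.1 <= I.2 by move/andP: fs => [/allP/(_ _ Is)].
rewrite /= ger0_norm ?clamped_variationB//.
by rewrite -lee_fin clamped_variationB// total_variation_ge0// le_clamp.
Qed.

(** Jordan decomposition p = V - (V - p), V being the variation function:
    both parts are nondecreasing and absolutely continuous. *)
Lemma unif_ac_density p a b : unif_ac p -> a < b ->
  exists2 g : R -> R, mu.-integrable setT (EFin \o g) &
    forall x, a <= x <= b -> p x - p a = \int[mu]_(t in `]a, x]) g t.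
Proof.
move=> acp ab; have leab := ltW ab.
pose V := clamped_variation p a b; pose P := p \o clamp a b.
have acV : unif_ac V by exact: unif_ac_clamped_variation.
have acVP : unif_ac (V \- P) by apply: unif_acB => //; exact: unif_ac_clamp.
have ndV : nondecreasing V.
  move=> x y xy; rewrite -subr_ge0 -lee_fin clamped_variationB//.
  by rewrite total_variation_ge0// le_clamp.
have ndVP : nondecreasing (V \- P).
  move=> x y xy; rewrite /= lerBrDr -addrA [- P x + _]addrC -lerBrDl.
  rewrite -lee_fin clamped_variationB//; apply: le_trans (total_variation_ge _ _); last first.
    exact: le_clamp.
  by rewrite lee_fin ler_norm.
have [g1 ig1 Vg1] := unif_ac_monotone_density a b ndV acV.
have [g2 ig2 VPg2] := unif_ac_monotone_density a b ndVP acVP.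
exists (g1 \- g2).
  by have := integrableB measurableT ig1 ig2; apply: eq_integrable.
move=> x axb; rewrite RintegralB//; [|by apply: integrableS ig1|by apply: integrableS ig2].
rewrite -Vg1// -VPg2// /P /= !clamp_id ?lexx//. ring.
Qed.

End density.

(** * Measurability of the pointwise derivative *)

Section measurable_derivative.
Context {R : realType}.
Implicit Types (p : R -> R).

Definition diff_quotient p (h x : R) := h^-1 * (p (x + h) - p x).

Lemma diff_quotientE p x :
  (fun h : R => h^-1 *: ((p \o shift x) (h *: 1) - p x)) = diff_quotient p ^~ x.
Proof.
by apply/funext => h; rewrite /diff_quotient /= [h *: 1]mulr1 [h + x]addrC.
Qed.

(** Cauchy criterion for the difference quotients. It has the form of a
    countable intersection of countable unions of closed conditions on x,
    which is what makes the set of points of derivability Borel. *)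
Lemma derivable_diff_quotientP p x :
  derivable p x 1 <-> forall k : nat, exists m : nat, forall h h',
    0 < `|h| < m.+1%:R^-1 -> 0 < `|h'| < m.+1%:R^-1 ->
    `|diff_quotient p h x - diff_quotient p h' x| <= k.+1%:R^-1.
Proof.
rewrite /derivable diff_quotientE; split.
  move=> /cvg_ex[/= l /cvgrPdist_le ql] k.
  have k0 : 0 < k.+1%:R^-1 / 2 :> R by rewrite divr_gt0.
  have [r /= r0 rq] := ql _ k0.
  have [m mr] := ltr_add_invr r0; rewrite add0r in mr.
  exists m => h h' /andP[h0 hm] /andP[h'0 h'm].
  have lq z : 0 < `|z| -> `|z| < m.+1%:R^-1 -> `|l - diff_quotient p z x| <= k.+1%:R^-1 / 2.
    move=> z0 zm; apply: rq; last by rewrite -normr_gt0.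
    by rewrite /= sub0r normrN (lt_trans zm).
  rewrite (le_trans (ler_distD l _ _))// [leRHS]splitr lerD//; last exact: lq.
  by rewrite distrC; exact: lq.
move=> H; apply/cauchy_cvgP/cauchy_exP => e e0.
have [k ke] := ltr_add_invr e0; rewrite add0r in ke.
have [m mP] := H k.
exists (diff_quotient p m.+2%:R^-1 x).
exists m.+1%:R^-1; first by rewrite /= invr_gt0.
move=> h /=; rewrite sub0r normrN => hm h0; rewrite /ball/=.
apply: le_lt_trans ke; apply: mP; last by rewrite normr_gt0 h0.
by rewrite gtr0_norm ?invr_gt0 ?ltr0Sn//= ltf_pV2 ?posrE ?ltr0Sn// ltr_nat.
Qed.

Lemma derivable_cvg_diff_quotient p x : derivable p x 1 ->
  diff_quotient p n.+1%:R^-1 x @[n --> \oo] --> p^`()%classic x.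
Proof.
move=> xp; have {}xp : diff_quotient p h x @[h --> 0^'] --> p^`()%classic x.
  by move: xp; rewrite derive1E /derive /derivable diff_quotientE.
apply: (cvg_comp _ (diff_quotient p ^~ x) _ xp) => A [r /= r0 rA].
have /cvgrPdist_lt/(_ _ r0)[N _ NP] := @cvg_harmonic R.
exists N => // n Nn; apply: rA; last by rewrite invr_eq0.
exact: NP.
Qed.

(** The derivative is the pointwise limit of continuous difference quotients
    on a Borel set, and takes its default value 0 outside that set. *)
Lemma measurable_derive1 p : continuous p -> measurable_fun setT (p^`()%classic).
Proof.
move=> cp.
have cd h : continuous (diff_quotient p h).
  move=> x; apply: cvgM; first exact: cvg_cst.
  apply: cvgB; last exact: cp.
  apply: continuous_comp; last exact: cp.
  by apply: cvgD; [exact: cvg_id|exact: cvg_cst].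
pose E k m : set R := \bigcap_(h in [set h : R * R | 0 < `|h.1| < m.+1%:R^-1 /\ 0 < `|h.2| < m.+1%:R^-1])
  [set x | `|diff_quotient p h.1 x - diff_quotient p h.2 x| <= k.+1%:R^-1].
have DE : [set x | derivable p x 1] = \bigcap_k \bigcup_m E k m.
  apply/seteqP; split => x /=.
    move=> /derivable_diff_quotientP xp k _; have [m xm] := xp k.
    by exists m => // -[h h'] [/= hm h'm]; exact: xm.
  move=> xE; apply/derivable_diff_quotientP => k.
  by have [m _ xm] := xE k I; exists m => h h' hm h'm; exact: (xm (h, h')).
have mD : measurable [set x | derivable p x 1].
  rewrite DE; apply: bigcap_measurable => // k _; apply: bigcup_measurable => m _.
  apply: closed_measurable; apply: closed_bigI => -[h h'] _.
  apply: (@closed_comp _ _ (fun x => `|diff_quotient p h x - diff_quotient p h' x|) [set y | y <= k.+1%:R^-1]).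
    by move=> x _; apply: cvg_norm; apply: cvgB; exact: cd.
  exact: closed_le.
rewrite -(setUv [set x | derivable p x 1]); apply/measurable_funU => //.
  exact: measurableC.
split.
- apply: (@measurable_fun_cvg _ _ _ _ (fun n x => diff_quotient p n.+1%:R^-1 x)) => //.
    move=> n; apply: measurable_funTS; exact: continuous_measurable_fun.
  by move=> x; exact: derivable_cvg_diff_quotient.
  apply: (@eq_measurable_fun _ _ _ _ _ (cst (0 : R))); last exact: measurable_cst.
  by move=> x; rewrite inE /= derive1E /derive => /dvgP->.
Qed.

End measurable_derivative.

(** * The fundamental theorem of calculus and the Cauchy-Schwarz inequality *)

Section ftc.
Context {R : realType}.
Implicit Types (p : R -> R) (a b x : R).
Local Notation mu := (@lebesgue_measure R).

(** Absolute continuity on every compact interval, phrased with clamp in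
    order to quantify over interval families of the whole line. *)
Definition loc_ac p := forall a b, a < b -> unif_ac (p \o clamp a b).

Lemma near_clamp p a b x : a < x < b -> \forall y \near x, (p \o clamp a b) y = p y.
Proof.
move=> /andP[ax xb]; near=> y; rewrite /= clamp_id//; apply/andP; split; apply: ltW.
  by near: y; exact: lt_nbhsr.
by near: y; exact: lt_nbhsl.
Unshelve. all: by end_near. Qed.

Lemma loc_ac_continuous p : loc_ac p -> continuous p.
Proof.
move=> pac x; have xx : x - 1 < x + 1 by lra.
have cP := unif_ac_continuous (pac _ _ xx).
have xin : x - 1 < x < x + 1 by lra.
have nx := near_clamp p xin.
rewrite /continuous_at -(nbhs_singleton nx).
by apply: cvg_trans (cP x); apply: near_eq_cvg.
Qed.

Lemma ae_mono (P Q : R -> Prop) : (forall x, P x -> Q x) ->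
  {ae mu, forall x, P x} -> {ae mu, forall x, Q x}.
Proof. by move=> PQ; apply: filterS; first exact: (ae_filter_ringOfSetsType mu). Qed.

(** The density given by Radon-Nikodym agrees almost everywhere with the
    pointwise derivative, by the differentiation theorem of Lebesgue. *)
Lemma loc_ac_ftc p a b : loc_ac p -> a < b ->
  [/\ {ae mu, forall x, a < x < b -> derivable p x 1},
    mu.-integrable `]a, b[ (EFin \o p^`()%classic) &
    p b - p a = \int[mu]_(x in `]a, b[) p^`()%classic x].
Proof.
move=> pac ab; have [g ig pg] := unif_ac_density (pac _ _ ab) ab.
have lg : locally_integrable setT g.
  by apply: open_integrable_locally => //; exact: openT.
have igS A : measurable A -> mu.-integrable A (EFin \o g).
  by move=> mA; apply: integrableS ig.
have dg : {ae mu, forall x, a < x < b -> derivable p x 1 /\ p^`()%classic x = g x}.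
  have := @FTC1 R g (BRight a) (fun y => igS _ (measurable_itv _)) lg.
  apply: ae_mono => x /= h /andP[ax xb]; have [/=|dG G'] := h; first by rewrite ?lte_fin ?bnd_simp.
  have pG : \forall y \near x, p a + \int[mu]_(t in `]a, y]) g t = p y.
    have axb : a < x < b by rewrite ax.
    have := near_clamp p axb; apply: filter_app.
    near=> y => <-; rewrite /= -pg; last first.
      apply/andP; split; apply: ltW.
        by near: y; exact: lt_nbhsr.
      by near: y; exact: lt_nbhsl.
    by rewrite /= [clamp a b a]clamp_id ?lexx ?(ltW ab)// addrC subrK.
  split.
    by apply: (near_eq_derivable pG); exact: derivableD.
  rewrite derive1E -(@near_eq_derive _ _ _ _ _ _ (1:R) pG) deriveD//.
  by rewrite derive_cst add0r -derive1E.
have mp' : measurable_fun setT (p^`()%classic).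
  by apply: measurable_derive1; exact: loc_ac_continuous.
have aeg : ae_eq mu `]a, b[%classic (EFin \o p^`()%classic) (EFin \o g).
  by apply: ae_mono dg => x h /=; rewrite in_itv/= => /h[_ ->].
have mg : measurable_fun setT g by move/integrableP : ig => [/measurable_EFinP].
split.
- by apply: ae_mono dg => x h /h[].
- apply/integrableP; split; first exact/measurable_EFinP/measurable_funTS.
  have /integrableP[_] := igS `]a, b[%classic (measurable_itv _).
  suff -> : (\int[mu]_(x in `]a, b[) `|(EFin \o g) x| =
             \int[mu]_(x in `]a, b[) `|(EFin \o p^`()%classic) x|)%E by [].
  apply: ge0_ae_eq_integral => //.
  - by apply/measurableT_comp => //; exact/measurable_EFinP/measurable_funTS.
  - by apply/measurableT_comp => //; exact/measurable_EFinP/measurable_funTS.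
  - by apply: ae_mono aeg => x h /h ->.
- have := pg b; rewrite lexx (ltW ab) => /(_ isT); rewrite /= !clamp_id ?lexx ?(ltW ab)// => ->.
  rewrite -Rintegral_itv_bndo_bndc; last exact: igS.
  rewrite /Rintegral; congr fine; apply: ae_eq_integral => //.
  - exact/measurable_EFinP/measurable_funTS.
  - exact/measurable_EFinP/measurable_funTS.
  - by apply: ae_mono aeg => x h /h /= [->].
Unshelve. all: by end_near. Qed.

Lemma integrable_cst_itv a b (c : R) : mu.-integrable `]a, b[ (EFin \o cst c).
Proof.
apply/integrableP; split; first exact/measurable_EFinP.
rewrite /= integral_cst//= lebesgue_measure_itv/=.
by case: ifPn => _; rewrite -?EFinD -?EFinM ?mule0 ltry.
Qed.

(** Expand the nonnegative integral of (g - c)^2, where c is the mean of g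
    over the interval. An infinite right-hand side is allowed. *)
Lemma sqr_Rintegral_le (g : R -> R) a b : a < b -> mu.-integrable `]a, b[ (EFin \o g) ->
  (((\int[mu]_(x in `]a, b[) g x) ^+ 2)%:E <=
   (b - a)%:E * \int[mu]_(x in `]a, b[) (g x ^+ 2)%:E)%E.
Proof.
move=> ab ig; set m := \int[mu]_(x in _) _.
have mg : measurable_fun `]a, b[ g by move/integrableP : ig => [/measurable_EFinP].
have mg2 : measurable_fun `]a, b[ (fun x => g x ^+ 2) by exact: measurable_funX.
have [fi|] := boolP (\int[mu]_(x in `]a, b[) (g x ^+ 2)%:E < +oo)%E; last first.
  rewrite -leNgt leye_eq => /eqP ->.
  by rewrite gt0_muley ?leey// lte_fin subr_gt0.
have ig2 : mu.-integrable `]a, b[ (EFin \o (fun x => g x ^+ 2)).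
  apply/integrableP; split; first exact/measurable_EFinP.
  by under eq_integral do rewrite /= ger0_norm ?sqr_ge0//.
pose c := m / (b - a).
have iab : mu.-integrable `]a, b[ (EFin \o cst (c ^+ 2)).
  exact: integrable_cst_itv.
have icg : mu.-integrable `]a, b[ (EFin \o (fun x => (2 * c) * g x)).
  exact: (@integrableZl _ _ _ mu _ _ (2 * c) (EFin \o g)).
have : \int[mu]_(x in `]a, b[) ((2 * c) * g x - c ^+ 2) <= \int[mu]_(x in `]a, b[) (g x ^+ 2).
  apply: le_Rintegral => //.
    exact: (@integrableB _ _ _ mu _ _ _ _ icg iab).
  by move=> x _; rewrite -subr_ge0 opprB addrA [_ + c ^+ 2]addrC; have := sqr_ge0 (g x - c); lra.
rewrite RintegralB//= RintegralZl// Rintegral_cst//= lebesgue_measure_itv/= lte_fin ab/=.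
rewrite -/m => h.
have -> : (\int[mu]_(x in `]a, b[) (g x ^+ 2)%:E = (\int[mu]_(x in `]a, b[) (g x ^+ 2))%:E)%E.
  rewrite fineK// ge0_fin_numE//; apply: integral_ge0 => x _; rewrite lee_fin sqr_ge0 //.
rewrite -EFinM lee_fin mulrC -ler_pdivrMr ?subr_gt0//.
apply: le_trans h; rewrite /c le_eqVlt; apply/orP; left; apply/eqP.
by field; rewrite subr_eq0 gt_eqF.
Qed.
End ftc.

(** * Energies and difference quotients *)

Section energies.
Context {R : realType}.
Implicit Types (p u : R -> R) (a b x : R).
Local Notation mu := (@lebesgue_measure R).

Lemma loc_ac_cauchy_schwarz p a b : loc_ac p -> a < b ->
  (((p b - p a) ^+ 2)%:E <=
   (b - a)%:E * \int[mu]_(x in `]a, b[) (p^`()%classic x ^+ 2)%:E)%E.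
Proof.
move=> pac ab; have [_ ip ->] := loc_ac_ftc pac ab.
exact: sqr_Rintegral_le.
Qed.

Lemma limn_einf_gt (v : (\bar R)^nat) (t : \bar R) : (t < limn_einf v)%E ->
  \forall n \near \oo, (t < v n)%E.
Proof.
rewrite limn_einf_lim (cvg_lim _ (ereal_nondecreasing_cvgn _))//; last first.
  exact: nondecreasing_einfs.
move=> /ereal_sup_gt[_ [N _ <-]] tN.
exists N => // n Nn; apply: (lt_le_trans tN).
by apply: ereal_inf_lbound; exists n.
Qed.

(** Fatou in the form in which lower semicontinuity is used throughout. Where
    no limit is known it is enough that g vanishes; this covers the points at
    which a derivative takes its default value. *)
Lemma fatou_eventually (D : set R) (g_ : nat -> R -> R) (g : R -> R) (t : R) :
  measurable D -> (forall n, measurable_fun D (g_ n)) -> measurable_fun D g ->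
  (forall n x, D x -> 0 <= g_ n x) ->
  (forall x, D x -> g x = 0 \/ g_ n x @[n --> \oo] --> g x) ->
  (t%:E < \int[mu]_(x in D) (g x)%:E)%E ->
  \forall n \near \oo, (t%:E < \int[mu]_(x in D) (g_ n x)%:E)%E.
Proof.
move=> mD mg_ mg g_0 gP tg; apply: limn_einf_gt; apply: (lt_le_trans tg).
apply: le_trans (fatou mu mD _ _); last 2 first.
- by move=> n; apply/measurable_EFinP; exact: mg_.
- by move=> n x Dx; rewrite lee_fin g_0.
have gle x : D x -> ((g x)%:E <= limn_einf (fun n => (g_ n x)%:E))%E.
  move=> Dx; have [->|gx] := gP _ Dx.
    rewrite limn_einf_lim; apply: lime_ge; first exact: is_cvg_einfs.
    by apply: nearW => n; apply: le_ereal_inf_tmp => _ [m _ <-]; rewrite lee_fin g_0.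
  have [|-> _] := cvg_limn_einf_sup (u := fun n => (g_ n x)%:E) (l := (g x)%:E).
    by apply/cvg_EFin; [exact: nearW|exact: gx].
  by [].
apply: ge0_le_integral => //.
- move=> x Dx; have [->//|gx] := gP _ Dx.
  by rewrite lee_fin; rewrite -(cvg_lim _ gx)//; apply: limr_ge; [apply: cvgP gx|apply: nearW => n; exact: g_0].
- exact/measurable_EFinP.
- rewrite /limn_einf; apply: measurableT_comp => //.
  apply: measurable_fun_limn_esup => n.
  by apply: measurableT_comp => //; apply/measurable_EFinP; exact: mg_.
Qed.

Lemma measurable_Rpos : measurable (@Rpos R).
Proof. exact: measurable_itv. Qed.
#[local] Hint Extern 0 (measurable Rpos) => solve [apply: measurable_Rpos] : core.

Lemma RposE x : Rpos x = is_true (0 < x).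
Proof. by apply: propext; rewrite /Rpos /= in_itv/= andbT. Qed.

(** By hypothesis the squared quotient at x is at most the mean of s over ]x,
    x + h[. Integrating in x and exchanging the integrals, each y receives
    the mean of the weight over ]y - h, y[, and this is at most w y since w
    is nondecreasing. *)
Lemma diff_quotient_energy (u s w : R -> R) (h : R) : 0 < h ->
  continuous u ->
  measurable_fun (@Rpos R) s -> (forall x, 0 < x -> 0 <= s x) ->
  measurable_fun setT w -> (forall x, 0 < x -> 0 <= w x) ->
  (forall x y, 0 < x -> x <= y -> w x <= w y) ->
  (forall x, 0 < x -> (((u (x + h)%R - u x) ^+ 2)%:E <=
     h%:E * \int[mu]_(t in `]x, (x + h)%R[) (s t)%:E)%E) ->
  (\int[mu]_(x in Rpos) (w x * diff_quotient u h x ^+ 2)%:E <=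
   \int[mu]_(x in Rpos) (w x * s x)%:E)%E.
Proof.
move=> h0 cu ms s0 mw w0 wnd us.
pose s' := s \_ (@Rpos R); pose w' := w \_ (@Rpos R).
have ms' : measurable_fun setT s' by exact: (measurable_restrictT s measurable_Rpos).1.
have mw' : measurable_fun setT w'.
  by apply: (measurable_restrictT w measurable_Rpos).1; exact: measurable_funTS.
have s'0 x : 0 <= s' x.
  by rewrite /s' patchE; case: ifPn => //; rewrite inE RposE => /s0.
have w'0 x : 0 <= w' x.
  by rewrite /w' patchE; case: ifPn => //; rewrite inE RposE => /w0.
have s'E x : 0 < x -> s' x = s x by move=> x0; rewrite /s' patchE mem_set// RposE.
have w'E x : 0 < x -> w' x = w x by move=> x0; rewrite /w' patchE mem_set// RposE.
pose S : set (R * R) := [set z | (z.1 < z.2) && (z.2 < z.1 + h)].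
have mS : measurable S.
  have mb : measurable_fun setT (fun z : R * R => (z.1 < z.2) && (z.2 < z.1 + h)).
    apply: measurable_and; apply: measurable_fun_ltr => //.
    by apply: measurable_funD => //; exact: measurable_fst.
  by have := mb measurableT [set true] I; rewrite setTI.
(* With the indicator of x < y < x + h the double integral runs over the
   whole plane, where the order of integration can be exchanged. *)
pose F (z : R * R) := (w' z.1 / h * s' z.2 * \1_S z)%:E.
have mF : measurable_fun setT F.
  apply/measurable_EFinP; apply: measurable_funM; last exact: measurable_indic.
  apply: measurable_funM; last exact: measurableT_comp ms' measurable_snd.
  apply: measurable_funM => //; exact: measurableT_comp mw' measurable_fst.
have F0 z : (0 <= F z)%E.
  by rewrite lee_fin !mulr_ge0// invr_ge0 ltW.
have mdq : measurable_fun setT (fun x => w x * diff_quotient u h x ^+ 2).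
  apply: measurable_funM => //; apply: measurable_funX.
  apply: measurable_funM => //; apply: measurable_funB; last exact: continuous_measurable_fun.
  apply: measurableT_comp; first exact: continuous_measurable_fun.
  by apply: measurable_funD.
apply: (@le_trans _ _ (\int[mu]_x \int[mu]_y F (x, y))%E).
  rewrite integral_mkcond; apply: ge0_le_integral => //.
  - move=> x _; rewrite patchE; case: ifPn => //; rewrite inE RposE => x0.
    by rewrite lee_fin mulr_ge0 ?sqr_ge0// w0.
  - apply: (measurable_restrictT _ measurable_Rpos).1; apply/measurable_EFinP.
    exact: measurable_funTS.
  - exact: (@measurable_fun_fubini_tonelli_F _ _ _ _ R mu F).
  - move=> x _; rewrite patchE; case: ifPn => [|_]; last exact: integral_ge0.
    rewrite inE RposE => x0.
    have -> : (\int[mu]_y F (x, y) = (w x / h)%:E * \int[mu]_(t in `]x, (x + h)%R[) (s t)%:E)%E.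
      rewrite -ge0_integralZl//=.
      + rewrite [RHS]integral_mkcond; apply: eq_integral => y _.
        rewrite patchE /F /= w'E// indicE; case: (boolP (y \in _)) => [|yS].
          rewrite inE/= in_itv/= => /andP[xy yh].
          by rewrite mem_set ?mulr1 ?EFinM ?s'E//= ?(lt_trans x0)// /S/= xy.
        rewrite memNset ?mulr0//= => Sy; move: yS; rewrite notin_setE; apply.
        by rewrite /= in_itv.
      + apply/measurable_EFinP; apply: measurable_funS ms => //.
        by move=> y /=; rewrite in_itv/= RposE => /andP[xy _]; exact: lt_trans xy.
      + by move=> y; rewrite /= in_itv/= => /andP[xy _]; rewrite lee_fin s0// (lt_trans x0).
      + by rewrite lee_fin divr_ge0 ?w0// ltW.
    have -> : (w x * diff_quotient u h x ^+ 2)%:E = ((w x / h ^+ 2)%:E * ((u (x + h)%R - u x) ^+ 2)%:E)%E.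
      by rewrite -EFinM /diff_quotient exprMn exprVn; congr EFin; ring.
    apply: le_trans (lee_wpmul2l _ (us _ x0)) _.
      by rewrite lee_fin divr_ge0 ?w0// sqr_ge0.
    rewrite muleA -EFinM (_ : w x / h ^+ 2 * h = w x / h)//.
    by field; rewrite gt_eqF.
rewrite (@fubini_tonelli _ _ _ _ R mu mu F mF F0) [leRHS]integral_mkcond; apply: ge0_le_integral => //.
- by move=> y _; exact: integral_ge0.
- exact: (@measurable_fun_fubini_tonelli_G _ _ _ _ R mu F).
- apply: (measurable_restrictT _ measurable_Rpos).1; apply/measurable_EFinP.
  apply: measurable_funM => //.
  exact: measurable_funTS.
- move=> y _; rewrite patchE; case: ifPn => [|/negP yn]; last first.
    rewrite integral0_eq// => x _; rewrite /F/= /s' patchE ifF ?mulr0 ?mul0r//.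
    by apply/negP.
  rewrite inE RposE => y0.
  apply: (@le_trans _ _ (\int[mu]_(x in `](y - h)%R, y[) cst (w y / h * s y)%:E x)%E).
    rewrite [leRHS]integral_mkcond; apply: ge0_le_integral => //.
    + rewrite /F/=; apply/measurable_EFinP; apply: measurable_funM.
        apply: measurable_funM; last exact: measurable_cst.
        by apply: measurable_funM; [exact: mw'|exact: measurable_cst].
      have m1S : measurable_fun setT (\1_S : R * R -> R) by exact: measurable_indic.
      apply: (measurableT_comp m1S (g := fun x => (x, y))).
      by apply: measurable_fun_pair.
    + apply: (measurable_restrictT _ (measurable_itv _)).1; exact: measurable_cst.
    + move=> x _; rewrite /F/= s'E// patchE indicE.
      case: (boolP (_ \in S)) => [|]; last first.
        rewrite mulr0 => _; case: ifPn => // _.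
        by rewrite lee_fin mulr_ge0 ?s0// divr_ge0 ?w0 // ltW.
      rewrite inE /S/= => /andP[xy yxh]; rewrite mulr1 mem_set; last first.
        by rewrite /= in_itv/= xy andbT; lra.
      rewrite lee_fin ler_wpM2r ?s0// ler_wpM2r ?invr_ge0 ?(ltW h0)//.
      rewrite /w' patchE; case: ifPn; last by rewrite w0.
      by rewrite inE RposE => x0; apply: wnd => //; exact: ltW.
  rewrite integral_cst//= lebesgue_measure_itv/= lte_fin ifT; last lra.
  rewrite -EFinB -EFinM lee_fin opprB addrCA subrr addr0 mulrAC divfK// gt_eqF//.
Qed.

End energies.

#[local] Hint Extern 0 (measurable Rpos) => solve [apply: measurable_Rpos] : core.

(** * Absolute continuity of complex-valued functions *)

Section complex_ac.
Context {R : realType}.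
Implicit Types (f : R -> R[i]) (u : R -> R) (a b x : R).
Local Notation mu := (@lebesgue_measure R).
Local Notation ReC := (@complex.Re R).
Local Notation ImC := (@complex.Im R).

Lemma ReB (z w : R[i]) : ReC (z - w) = ReC z - ReC w.
Proof. by case: z w => [a b] [c d]. Qed.
Lemma ImB (z w : R[i]) : ImC (z - w) = ImC z - ImC w.
Proof. by case: z w => [a b] [c d]. Qed.

Lemma norm_Re_le (z : R[i]) : (`|ReC z|)%:C <= `|z|.
Proof.
rewrite normc_def lecR -(sqrtr_sqr (ReC z)) ler_wsqrtr// lerDl sqr_ge0//.
Qed.
Lemma norm_Im_le (z : R[i]) : (`|ImC z|)%:C <= `|z|.
Proof. by rewrite normc_def lecR -(sqrtr_sqr (ImC z)) ler_wsqrtr// lerDr sqr_ge0. Qed.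

Lemma sum_realc (I : Type) (r : seq I) (F : I -> R) :
  (\sum_(i <- r) F i)%:C = \sum_(i <- r) (F i)%:C.
Proof. exact: (rmorph_sum (real_complex R)). Qed.

(** P stands for the real or the imaginary part. *)
Lemma absolutely_continuous_loc_ac f (P : R[i] -> R) :
  (forall z w, P (z - w) = P z - P w) -> (forall z, (`|P z|)%:C <= `|z|) ->
  (forall a b, a <= b -> absolutely_continuous a b f) -> loc_ac (P \o f).
Proof.
move=> PB Ple fac a b ab e e0; have leab := ltW ab.
have [d d0 fd] := fac _ _ leab e e0.
exists d => // s fs sd.
have cs := clamp_itvs_family leab fs.
have cd := le_lt_trans (clamp_itvs_length leab fs) sd.
have sub I : I \in clamp_itvs a b s -> a <= I.1 /\ I.2 <= b.
  by move=> /mapP[J _ ->]/=; have /andP[-> _] := clamp_itv J.1 leab; have /andP[_ ->] := clamp_itv J.2 leab.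
suff : oscillation (P \o f) (clamp_itvs a b s) <= e.
  by rewrite /oscillation big_map.
move: (clamp_itvs a b s) cs cd sub => {fs sd}t /andP[/allP t1 t2] td tab.
pose J (k : 'I_(size t)) := nth (0, 0) t k.
have Jt k : J k \in t by exact: mem_nth.
have := fd _ (fun k => (J k).1) (fun k => (J k).2).
have -> : \sum_(k < size t) ((J k).2 - (J k).1) = total_length t.
  by rewrite /total_length (big_nth (0, 0)) big_mkord.
move=> H; apply: ltW; rewrite -ltcR.
apply: le_lt_trans (H _ _ td).
- rewrite /oscillation sum_realc (big_nth (0, 0)) big_mkord ler_sum// => k _.
  by rewrite /= -PB.
- by move=> k; have [? ?] := tab _ (Jt k); split => //; exact: t1.
- apply/trivIsetP => i j _ _ ij.
  wlog lij : i j ij / (i < j)%N.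
    move=> wl; have [lij|lji|/ord_inj eij] := ltngtP i j; first exact: wl.
      by rewrite setIC; apply: wl => //; rewrite eq_sym.
    by rewrite eij eqxx in ij.
  have /pairwiseP := t2; move=> /(_ (0, 0)) /(_ _ _ (ltn_ord i) (ltn_ord j) lij).
  rewrite -!/(J _) => /orP[] h; apply/seteqP; split => // x /=; rewrite !in_itv/=; lra.
Qed.

Lemma absolutely_continuous_real u a b :
  (forall e, 0 < e -> exists2 d, 0 < d & forall (n : nat) (l r : 'I_n -> R),
    (forall k, l k <= r k) -> trivIset setT (fun k => [set` `]l k, r k[]) ->
    \sum_(k < n) (r k - l k) < d -> \sum_(k < n) `|u (r k) - u (l k)| < e) ->
  absolutely_continuous a b (fun x => (u x)%:C).
Proof.
move=> uac e e0; have [d d0 ud] := uac e e0; exists d => // n l r lr tlr lrd.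
rewrite (eq_bigr (fun k => `|u (r k) - u (l k)|%:C)).
  by rewrite -sum_realc ltcR ud// => k; have [] := lr k.
by move=> k _; rewrite -rmorphB/= normc_def/= expr0n addr0 sqrtr_sqr.
Qed.

End complex_ac.

(** * Squared moduli of a function and of its derivative *)

Section densities.
Context {R : realType}.
Implicit Types (f g : R -> R[i]) (u w : R -> R) (a b x : R) (z : R[i]).
Local Notation mu := (@lebesgue_measure R).
Local Notation ReC := (@complex.Re R).
Local Notation ImC := (@complex.Im R).

Definition sqnorm z : R := ReC z ^+ 2 + ImC z ^+ 2.

Lemma sqnorm_ge0 z : 0 <= sqnorm z.
Proof. by rewrite addr_ge0 ?sqr_ge0. Qed.

Lemma sqnormM z z' : sqnorm (z * z') = sqnorm z * sqnorm z'.
Proof. case: z z' => [a b] [c d]; rewrite /sqnorm /=; ring. Qed.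

Lemma sqnorm_real x : sqnorm x%:C = x ^+ 2.
Proof. by rewrite /sqnorm /= expr0n addr0. Qed.

Lemma sqnorm_i : sqnorm 'i%C = 1.
Proof. by rewrite /sqnorm /= expr0n expr1n add0r. Qed.

Lemma realcV x : (x%:C)^-1 = (x^-1)%:C :> R[i].
Proof. by rewrite fmorphV. Qed.

Lemma Re_mulJ z : ReC (z * z^*%C) = sqnorm z.
Proof. case: z => [a b]; rewrite /sqnorm /=; ring. Qed.

Lemma Im_mulJ z : ImC (z * z^*%C) = 0.
Proof. case: z => [a b]; rewrite /=; ring. Qed.

Lemma Re_mulr z x : ReC (z * x%:C) = ReC z * x.
Proof. case: z => [a b]; rewrite /=; ring. Qed.

Lemma Im_mulr z x : ImC (z * x%:C) = ImC z * x.
Proof. case: z => [a b]; rewrite /=; ring. Qed.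

Lemma Re_norm2 z : ReC (`|z| ^+ 2) = sqnorm z.
Proof. by rewrite -add_Re2_Im2. Qed.

Lemma norm2_sqr w g : (forall x, 0 < x -> 0 <= w x) ->
  norm2 w g ^+ 2 = \int[mu]_(x in Rpos) (w x * sqnorm (g x)).
Proof.
move=> w0; rewrite /norm2 /inner /Cintegral /=.
have -> : \int[mu]_(x in Rpos) ReC (g x * (g x)^*%C * (w x)%:C) =
    \int[mu]_(x in Rpos) (w x * sqnorm (g x)).
  by apply: eq_Rintegral => x _; rewrite Re_mulr Re_mulJ mulrC.
rewrite sqr_sqrtr//; apply: Rintegral_ge0 => x; rewrite RposE => x0.
by rewrite mulr_ge0 ?w0 ?sqnorm_ge0.
Qed.

Lemma square_integrableE g : square_integrable g ->
  mu.-integrable Rpos (EFin \o (sqnorm \o g)).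
Proof.
move=> [mRe mIm gi]; apply/integrableP; split.
  by apply/measurable_EFinP; apply: measurable_funD; apply: measurable_funX.
apply: le_lt_trans gi; rewrite le_eqVlt; apply/orP; left; apply/eqP.
apply: eq_integral => x _.
by rewrite Re_norm2 /= ger0_norm// sqnorm_ge0.
Qed.

(** True at every point, derivable or not: where u has no derivative neither
    has c u when c is nonzero, and both take the default value 0. *)
Lemma derive1_scale (c : R) u x : (fun y => u y * c)^`()%classic x = u^`()%classic x * c.
Proof.
have [->|c0] := eqVneq c 0.
  by under eq_fun do rewrite mulr0; rewrite derive1_cst mulr0.
have [du|ndu] := pselect (derivable u x 1).
  rewrite !derive1E; under eq_fun do rewrite mulrC.
  by rewrite deriveZ//= [c *: _]mulrC.
rewrite !derive1E /derive (dvgP ndu) mul0r.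
have nducK : ~ derivable (fun y => u y * c) x 1.
  move=> duc; apply: ndu.
  have <- : c^-1 \*: (fun y => u y * c) = u.
    by apply/funext => y /=; rewrite /GRing.scale/= mulrC mulfK.
  exact: derivableZ.
by rewrite (dvgP nducK).
Qed.

Lemma integrable_Rpos_le (u v : R -> R) : measurable_fun (@Rpos R) u ->
  (forall x, 0 < x -> `|u x| <= v x) -> mu.-integrable Rpos (EFin \o v) ->
  mu.-integrable Rpos (EFin \o u).
Proof.
move=> mu_ uv iv; apply: le_integrable iv => //; first exact/measurable_EFinP.
move=> x; rewrite RposE => x0; rewrite lee_fin/= (le_trans (uv _ x0))//.
exact: ler_norm.
Qed.

Lemma integrable_RposD (u v : R -> R) : mu.-integrable Rpos (EFin \o u) ->
  mu.-integrable Rpos (EFin \o v) -> mu.-integrable Rpos (EFin \o (fun x => u x + v x)).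
Proof. by move=> iu iv; exact: (@integrableD _ _ _ mu _ _ _ _ iu iv). Qed.

Lemma integrable_RposZ (c : R) (u : R -> R) : mu.-integrable Rpos (EFin \o u) ->
  mu.-integrable Rpos (EFin \o (fun x => c * u x)).
Proof. by move=> iu; exact: (@integrableZl _ _ _ mu _ _ c (EFin \o u)). Qed.

Definition dens f x := sqnorm (f x).
Definition speed f x := sqnorm (Cderive f x).

Lemma measurable_ln_Rpos : measurable_fun (@Rpos R) (@ln R).
Proof. by apply: measurable_funTS; exact: measurable_ln. Qed.

Lemma measurable_Vr : measurable_fun (@Rpos R) (fun x : R => x^-1).
Proof.
apply: open_continuous_measurable_fun; first exact: interval_open.
by move=> x; rewrite inE RposE => x0; apply: inv_continuous; rewrite gt_eqF.
Qed.

Lemma DP_loc_ac f : DP f -> loc_ac (ReC \o f) /\ loc_ac (ImC \o f).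
Proof.
move=> [[_ _ fac] _]; split; apply: absolutely_continuous_loc_ac fac.
- exact: ReB.
- exact: norm_Re_le.
- exact: ImB.
- exact: norm_Im_le.
Qed.

(** At 0 itself the value is forced by continuity. *)
Lemma DP_vanish f x : DP f -> x <= 0 -> f x = 0.
Proof.
move=> fDP; rewrite le_eqVlt => /predU1P[->|]; last by case: fDP => -[+ _ _] _; apply.
have [[f0 _ _] _] := fDP; have [cRe cIm] := DP_loc_ac fDP.
have lim0 (u : R -> R) : continuous u -> (forall y, y < 0 -> u y = 0) -> u 0 = 0.
  move=> cu u0; have := cvg_at_left_filter (cu 0).
  have : u y @[y --> 0^'-] --> (0 : R).
    apply: cvg_near_cst; near=> y; apply: u0; near: y; exact: nbhs_left_lt.
  by move=> h1 h2; exact: (cvg_unique _ h2 h1).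
have r0 : ReC (f 0) = 0.
  by apply: (lim0 (ReC \o f)); [exact: loc_ac_continuous|move=> y /f0 /= ->].
have i0 : ImC (f 0) = 0.
  by apply: (lim0 (ImC \o f)); [exact: loc_ac_continuous|move=> y /f0 /= ->].
by move: r0 i0; case: (f 0) => a b /= -> ->.
Unshelve. all: by end_near. Qed.

Lemma DP_continuous f : DP f -> continuous (ReC \o f) /\ continuous (ImC \o f).
Proof. by move=> /DP_loc_ac[? ?]; split; exact: loc_ac_continuous. Qed.

Lemma measurable_dens f : DP f -> measurable_fun setT (dens f).
Proof.
move=> /DP_continuous[? ?]; apply: measurable_funD; apply: measurable_funX;
  exact: continuous_measurable_fun.
Qed.

Lemma measurable_speed f : DP f -> measurable_fun setT (speed f).
Proof.
move=> /DP_continuous[? ?]; apply: measurable_funD; apply: measurable_funX;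
  exact: measurable_derive1.
Qed.

Lemma speed_neg f x : DP f -> x < 0 -> speed f x = 0.
Proof.
move=> fDP x0; rewrite /speed /sqnorm /Cderive /=.
have near0 (u : R -> R) : (forall y, y < 0 -> u y = 0) -> u^`()%classic x = 0.
  move=> u0; rewrite derive1E (@near_eq_derive _ _ _ _ (cst 0) _ (1 : R)) ?derive_cst//.
  by near=> y; apply: u0; near: y; exact: lt_nbhsl.
rewrite !near0 ?expr0n ?addr0// => y y0 /=; by rewrite (DP_vanish fDP (ltW y0)).
Unshelve. all: by end_near. Qed.

Lemma DP_integrable f : DP f ->
  [/\ mu.-integrable Rpos (EFin \o speed f),
      mu.-integrable Rpos (EFin \o (fun x => x * speed f x)),
      mu.-integrable Rpos (EFin \o dens f),
      mu.-integrable Rpos (EFin \o (fun x => x ^- 2 * dens f x)) &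
      mu.-integrable Rpos (EFin \o (fun x => ln x ^+ 2 * dens f x))].
Proof.
move=> fDP; have [[_ fi _] [_ [i1 i2 i3 i4]]] := fDP; split.
- exact: square_integrableE i1.
- apply: eq_integrable (square_integrableE i2) => // x.
  rewrite inE RposE => x0 /=; rewrite sqnormM sqnorm_real sqr_sqrtr//; exact: ltW.
- exact: square_integrableE fi.
- apply: eq_integrable (square_integrableE i3) => // x _ /=.
  by rewrite sqnormM realcV sqnorm_real mulrC exprVn.
- apply: eq_integrable (square_integrableE i4) => // x _ /=.
  by rewrite sqnormM sqnorm_real.
Qed.

End densities.

(** * Moments *)

Section moments.
Context {R : realType}.
Implicit Types (f g : R -> R[i]) (u w : R -> R) (a b x : R) (z : R[i]).
Local Notation mu := (@lebesgue_measure R).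
Local Notation ReC := (@complex.Re R).
Local Notation ImC := (@complex.Im R).

Definition moment (phi rho : R -> R) := \int[mu]_(x in Rpos) (phi x * rho x).

(** Apply ln y < y to y = 1 / sqrt x. *)
Lemma ln_sqrt_le x : 0 < x < 1 -> ln x ^+ 2 <= 4 / x.
Proof.
move=> /andP[x0 x1]; pose s := Num.sqrt x.
have s0 : 0 < s by rewrite sqrtr_gt0.
have sx : s ^+ 2 = x by rewrite sqr_sqrtr// ltW.
have s1 : s <= 1 by rewrite -sqrtr1 ler_wsqrtr// ltW.
have lns : ln x = 2 * ln s by rewrite -sx lnXn// mulr_natl.
have lns0 : ln s <= 0 by apply: ln_le0.
have : - ln s < s^-1 by rewrite -lnV ?posrE// ln_sublinear// invr_gt0.
move=> h; rewrite lns -sx -exprVn exprMn (_ : 2 ^+ 2 = 4 :> R); last ring.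
by rewrite ler_wpM2l// -sqrrN lerXn2r ?nnegrE ?oppr_ge0 ?invr_ge0 ?(ltW s0) ?(ltW h).
Qed.

(** The three weights against which the square of the modulus is integrable
    by definition of the domain. *)
Definition weight x : R := 1 + ln x ^+ 2 + x ^- 2.

Lemma weight_bound x : 0 < x ->
  [/\ `|ln x| <= weight x, `|x^-1| <= weight x, `|ln x / x| <= weight x &
     `|ln x ^+ 2 / x| <= 4 * weight x].
Proof.
move=> x0; rewrite /weight -exprVn.
have l2 : 0 <= ln x ^+ 2 by exact: sqr_ge0.
have v2 : 0 <= x^-1 ^+ 2 by exact: sqr_ge0.
have xV0 : 0 < x^-1 by rewrite invr_gt0.
have nl : `|ln x| ^+ 2 = ln x ^+ 2 by rewrite real_normK// num_real.
split.
- rewrite -nl; have := normr_ge0 (ln x); nra.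
- rewrite gtr0_norm//; nra.
- rewrite normrM (gtr0_norm xV0) -nl; have := normr_ge0 (ln x); nra.
- rewrite ger0_norm; last by rewrite mulr_ge0// ltW.
  have [x1|x1] := ltP x 1.
    have : ln x ^+ 2 <= 4 * x^-1 by apply: ln_sqrt_le; rewrite x0.
    nra.
  have : x^-1 <= 1 by rewrite invf_le1.
  nra.
Qed.

Lemma integrable_moment f (phi : R -> R) (c : R) : DP f ->
  measurable_fun (@Rpos R) phi -> (forall x, 0 < x -> `|phi x| <= c * weight x) ->
  mu.-integrable Rpos (EFin \o (fun x => phi x * dens f x)).
Proof.
move=> fDP mphi phic; have [_ _ i1 i2 i3] := DP_integrable fDP.
apply: (@integrable_Rpos_le _ _ (fun x => c * ((dens f x + ln x ^+ 2 * dens f x) + x ^- 2 * dens f x))).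
- apply: measurable_funM => //; apply: measurable_funTS; exact: measurable_dens.
- move=> x x0; rewrite normrM [X in _ * X]ger0_norm ?sqnorm_ge0//.
  apply: (@le_trans _ _ (c * weight x * dens f x)).
    by rewrite ler_wpM2r ?sqnorm_ge0 ?phic.
  by rewrite /weight le_eqVlt; apply/orP; left; apply/eqP; ring.
- by apply: integrable_RposZ; apply: integrable_RposD => //; apply: integrable_RposD.
Qed.

Lemma DP_moments f : DP f ->
  [/\ mu.-integrable Rpos (EFin \o (fun x => ln x * dens f x)),
   mu.-integrable Rpos (EFin \o (fun x => x^-1 * dens f x)),
   mu.-integrable Rpos (EFin \o (fun x => ln x / x * dens f x)) &
   mu.-integrable Rpos (EFin \o (fun x => ln x ^+ 2 / x * dens f x))].
Proof.
have mln := @measurable_ln_Rpos R; have mV := @measurable_Vr R.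
move=> fDP; split.
- apply: (@integrable_moment _ _ 1) => // x x0; rewrite mul1r; by have [] := weight_bound x0.
- apply: (@integrable_moment _ _ 1) => // x x0; rewrite mul1r; by have [] := weight_bound x0.
- apply: (@integrable_moment _ _ 1) => //; first exact: measurable_funM.
  by move=> x x0; rewrite mul1r; have [] := weight_bound x0.
- apply: (@integrable_moment _ _ 4) => //.
    by apply: measurable_funM => //; exact: measurable_funX.
  by move=> x x0; have [] := weight_bound x0.
Qed.

Lemma Cintegral_scale (h h' : R -> R[i]) (r : R) :
  (forall x, 0 < x -> h' x = h x * r%:C) ->
  mu.-integrable Rpos (EFin \o (ReC \o h)) -> mu.-integrable Rpos (EFin \o (ImC \o h)) ->
  Cintegral Rpos h' = Cintegral Rpos h * r%:C.
Proof.
move=> hh' iRe iIm; rewrite /Cintegral.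
have -> : \int[mu]_(x in Rpos) ReC (h' x) = r * \int[mu]_(x in Rpos) ReC (h x).
  rewrite -RintegralZl//; apply: eq_Rintegral => x; rewrite inE RposE => x0.
  by rewrite hh'// Re_mulr mulrC.
have -> : \int[mu]_(x in Rpos) ImC (h' x) = r * \int[mu]_(x in Rpos) ImC (h x).
  rewrite -RintegralZl//; apply: eq_Rintegral => x; rewrite inE RposE => x0.
  by rewrite hh'// Im_mulr mulrC.
by apply/eqP; rewrite eq_complex /= !mulr0 subr0 add0r mulrC [X in _ && (X == _)]mulrC !eqxx.
Qed.

(** Both parts of f' conj(f) are at most |f'|^2 + |f|^2. Integrability is
    what allows the vanishing mean of T_x to be rescaled to the normalized
    function. *)
Lemma Tx_mean_integrable f (h := fun x => Tx f x * (f x)^*%C * (wS x)%:C) : DP f ->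
  mu.-integrable Rpos (EFin \o (ReC \o h)) /\ mu.-integrable Rpos (EFin \o (ImC \o h)).
Proof.
move=> fDP; have [i1 _ i2 _ _] := DP_integrable fDP.
have [cRe cIm] := DP_continuous fDP.
have mp := measurable_funTS (continuous_measurable_fun cRe) : measurable_fun (@Rpos R) _.
have mq := measurable_funTS (continuous_measurable_fun cIm) : measurable_fun (@Rpos R) _.
have mp' := measurable_funTS (measurable_derive1 cRe) : measurable_fun (@Rpos R) _.
have mq' := measurable_funTS (measurable_derive1 cIm) : measurable_fun (@Rpos R) _.
split; apply: (@integrable_Rpos_le _ _ (fun x => speed f x + dens f x)); try exact: integrable_RposD.
- rewrite (_ : _ \o _ = fun x => (ReC \o f)^`()%classic x * (ImC \o f) x - (ImC \o f)^`()%classic x * (ReC \o f) x).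
    by apply: measurable_funB; apply: measurable_funM.
  apply/funext => x; rewrite /h /= /Tx /Cderive /wS; case: (f x) => a b /=; ring.
- move=> x _; rewrite /h /= /speed /dens /Tx /Cderive /sqnorm /wS; case: (f x) => a b /=.
  move: (_^`()%classic x) (_^`()%classic x) => P Q.
  have [[[? ?] ?] ?] := (sqr_ge0 (P + b), sqr_ge0 (P - b), sqr_ge0 (Q + a), sqr_ge0 (Q - a)).
  have [[[? ?] ?] ?] := (sqr_ge0 (P + a), sqr_ge0 (P - a), sqr_ge0 (Q + b), sqr_ge0 (Q - b)).
  have := (sqr_ge0 a, sqr_ge0 b, sqr_ge0 P, sqr_ge0 Q) => -[[[? ?] ?] ?].
  rewrite ler_norml; apply/andP; split; lra.
- rewrite (_ : _ \o _ = fun x => (ReC \o f)^`()%classic x * (ReC \o f) x + (ImC \o f)^`()%classic x * (ImC \o f) x).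
    by apply: measurable_funD; apply: measurable_funM.
  apply/funext => x; rewrite /h /= /Tx /Cderive /wS; case: (f x) => a b /=; ring.
- move=> x _; rewrite /h /= /speed /dens /Tx /Cderive /sqnorm /wS; case: (f x) => a b /=.
  move: (_^`()%classic x) (_^`()%classic x) => P Q.
  have [[[? ?] ?] ?] := (sqr_ge0 (P + b), sqr_ge0 (P - b), sqr_ge0 (Q + a), sqr_ge0 (Q - a)).
  have [[[? ?] ?] ?] := (sqr_ge0 (P + a), sqr_ge0 (P - a), sqr_ge0 (Q + b), sqr_ge0 (Q - b)).
  have := (sqr_ge0 a, sqr_ge0 b, sqr_ge0 P, sqr_ge0 Q) => -[[[? ?] ?] ?].
  rewrite ler_norml; apply/andP; split; lra.
Qed.

End moments.

(** * The functional in terms of energies and moments *)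

Section functional.
Context {R : realType}.
Implicit Types (f g : R -> R[i]) (u w : R -> R) (a b x : R) (z : R[i]).
Local Notation mu := (@lebesgue_measure R).
Local Notation ReC := (@complex.Re R).
Local Notation ImC := (@complex.Im R).

Lemma conjc_scale z x : (z * x%:C)^*%C = z^*%C * x%:C.
Proof. by rewrite -[x%:C in RHS]conjc_real; exact: (rmorphM (@conjc R)). Qed.

Lemma DP_mass f : DP f -> \int[mu]_(x in Rpos) dens f x = 1.
Proof.
move=> -[_ [[f1 _ _] _]].
have := norm2_sqr f (w := @wS R) (fun x _ => ler01 : 0 <= wS x).
rewrite f1 expr1n => ->; apply: eq_Rintegral => x _; by rewrite mul1r.
Qed.

Lemma DP_ln_mean f : DP f -> moment (@ln R) (dens f) = 0.
Proof.
move=> fDP; have [_ [[_ _ ts] _]] := fDP; have [i1 _ _ _] := DP_moments fDP.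
have := congr1 ReC ts; rewrite /op_mean /inner /Cintegral /= /moment => h.
apply/eqP; rewrite -oppr_eq0 -mulN1r -RintegralZl//; apply/eqP.
rewrite -[RHS]h; apply: eq_Rintegral => x _.
rewrite /wS Re_mulr mulr1 /Tsigma /dens -Re_mulJ -mulrA.
case: (f x) => a b /=; ring.
Qed.

Lemma moment_gt0 (phi rho : R -> R) : measurable_fun (@Rpos R) rho ->
  (forall x, 0 < x -> 0 <= rho x) -> (forall x, 0 < x -> 0 < phi x) ->
  mu.-integrable Rpos (EFin \o (fun x => phi x * rho x)) ->
  \int[mu]_(x in Rpos) rho x != 0 -> 0 < moment phi rho.
Proof.
move=> mrho rho0 phi0 /[dup] iphi /integrableP[mphi _] rho1.
rewrite lt_neqAle Rintegral_ge0 ?andbT; last first.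
  by move=> x; rewrite RposE => x0; rewrite mulr_ge0 ?rho0 ?(ltW (phi0 _ x0)).
apply: contra rho1; rewrite eq_sym => /eqP m0.
have : (\int[mu]_(x in Rpos) `|(EFin \o (fun x => phi x * rho x)%R) x| = 0)%E.
  rewrite -[RHS]/((0 : R)%:E) -m0 /moment /Rintegral fineK; last exact: integrable_fin_num.
  apply: eq_integral => x; rewrite inE RposE => x0.
  by rewrite gee0_abs// lee_fin mulr_ge0 ?rho0 ?(ltW (phi0 _ x0)).
move=> /(ae_eq_integral_abs mu measurable_Rpos mphi) ae0.
apply/eqP; rewrite /Rintegral (ae_eq_integral (cst 0%E)) ?integral0//.
- exact/measurable_EFinP.
- apply: ae_mono ae0 => x h Rx; have := h Rx => /= -[/eqP].
  rewrite mulf_eq0 gt_eqF/=; last by apply: phi0; rewrite RposE in Rx.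
  by move=> /eqP ->.
Qed.

Lemma DP_W_gt0 f : DP f -> 0 < moment (fun x => x^-1) (dens f).
Proof.
move=> fDP; have [_ i1 _ _] := DP_moments fDP; apply: moment_gt0 => //.
- by apply: measurable_funTS; exact: measurable_dens.
- by move=> x _; exact: sqnorm_ge0.
- by move=> x; rewrite invr_gt0.
- by rewrite DP_mass// oner_neq0.
Qed.

(** The factor x in T_omega cancels the weight 1/x of the inner product, so
    the mean of T_omega vanishes together with that of T_x; the two variances
    are then expanded. *)
Lemma LPE f (rho := dens f) : DP f ->
  LP f = \int[mu]_(x in Rpos) speed f x + moment (fun x => ln x ^+ 2) rho
   + \int[mu]_(x in Rpos) (x * speed f x) / moment (fun x => x^-1) rho
     * moment (fun x => x ^- 2) rho
   + (moment (fun x => ln x ^+ 2 / x) rho / moment (fun x => x^-1) rho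
      - (moment (fun x => ln x / x) rho / moment (fun x => x^-1) rho) ^+ 2).
Proof.
move=> fDP; have [iA iC irho iD iB] := DP_integrable fDP.
have [i1 iN iM1 iM2] := DP_moments fDP.
have N0 := DP_W_gt0 fDP; set N := moment (fun x => x^-1) _ in N0 *.
pose c := (norm2 wW f)^-1.
have wW0 x : 0 < x -> 0 <= wW x by move=> x0; rewrite invr_ge0 ltW.
have c2 : c ^+ 2 = N^-1 by rewrite exprVn norm2_sqr.
have gE x : normalizeW f x = f x * c%:C by rewrite /normalizeW realcV.
have g'E x : Cderive (normalizeW f) x = Cderive f x * c%:C.
  rewrite /Cderive.
  rewrite (_ : ReC \o normalizeW f = fun y => (ReC \o f) y * c); last first.
    by apply/funext => y; rewrite /= gE Re_mulr.
  rewrite (_ : ImC \o normalizeW f = fun y => (ImC \o f) y * c); last first.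
    by apply/funext => y; rewrite /= gE Im_mulr.
  rewrite !derive1_scale; apply/eqP; rewrite eq_complex Re_mulr Im_mulr /=.
  by rewrite !eqxx.
have wS0 x : 0 < x -> 0 <= wS x :> R by move=> _; exact: ler01.
rewrite /LP !norm2_sqr//.
congr (_ + _ + _ * _ + _).
- apply: eq_Rintegral => x _; by rewrite mul1r /Tx sqnormM sqnorm_i mul1r.
- apply: eq_Rintegral => x _; by rewrite mul1r /Tsigma sqnormM sqnorm_real sqrrN.
- rewrite /op_variance norm2_sqr//.
  have -> : op_mean wW Tomega (normalizeW f) = 0.
    have [h1 h2] := Tx_mean_integrable fDP.
    rewrite /op_mean /inner (Cintegral_scale (r := c ^+ 2) _ h1 h2); last first.
      move=> x x0; rewrite /Tomega g'E gE /Tx /wW /wS.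
      rewrite conjc_scale -(realcV x) rmorphXn /= mulr1.
      by field; rewrite fmorph_eq0 gt_eqF.
    have [_ [[_ + _] _]] := fDP; rewrite /op_mean /inner => ->; by rewrite mul0r.
  rewrite mulrC -c2 -RintegralZl//; apply: eq_Rintegral => x; rewrite inE RposE => x0.
  rewrite mul0r subr0 /Tomega g'E !sqnormM sqnorm_i !sqnorm_real /wW /speed.
  by field; rewrite gt_eqF.
- apply: eq_Rintegral => x _; by rewrite mul1r sqnormM realcV sqnorm_real exprVn mulrC.
- rewrite /op_variance norm2_sqr//; set M1 := moment (fun x => ln x / x) _.
  set M2 := moment (fun x => ln x ^+ 2 / x) _.
  have -> : op_mean wW Tsigma (normalizeW f) = (- N^-1 * M1)%:C.
    rewrite /op_mean /inner /Cintegral; congr (_ +i* _).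
      rewrite /M1 /moment -RintegralZl//; apply: eq_Rintegral => x _.
      rewrite Re_mulr /Tsigma -mulrA [_%:C * _]mulrC Re_mulr Re_mulJ gE sqnormM sqnorm_real c2.
      rewrite /wW /rho /dens; ring.
    rewrite (_ : \int[mu]_(x in Rpos) _ = \int[mu]_(x in @Rpos R) 0); last first.
      apply: eq_Rintegral => x _.
      by rewrite Im_mulr /Tsigma -mulrA [_%:C * _]mulrC Im_mulr Im_mulJ !mul0r.
    by rewrite Rintegral_cst// mul0r.
  pose m := M1 / N.
  rewrite (_ : \int[mu]_(x in Rpos) _ =
      \int[mu]_(x in Rpos) (N^-1 * (ln x ^+ 2 / x * rho x) +
        ((- 2 * m / N) * (ln x / x * rho x) + (m ^+ 2 / N) * (x^-1 * rho x)))); last first.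
    apply: eq_Rintegral => x _.
    rewrite /Tsigma gE -mulrBl sqnormM -rmorphB sqnorm_real sqnormM sqnorm_real c2.
    rewrite /wW /m /rho /dens; ring.
  rewrite RintegralD//; last first.
  - by apply: integrable_RposD; apply: integrable_RposZ.
  - exact: integrable_RposZ.
  rewrite RintegralD//; [|exact: integrable_RposZ|exact: integrable_RposZ].
  rewrite !RintegralZl//.
  rewrite -/(moment (fun x => ln x ^+ 2 / x) rho) -/(moment (fun x => ln x / x) rho).
  rewrite -/(moment (fun x => x^-1) rho) -/M1 -/M2 -/N /m.
  by field; rewrite gt_eqF.
Qed.
End functional.

(** * Extraction of a pointwise convergent subsequence *)

Section extraction.
Context {R : realType}.
Implicit Types (a b x y : R).

(** A bounded real family converges along every ultrafilter, closed intervals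
    being compact. *)
Lemma ultra_bounded_cvg (T : Type) (U : set_system T) (v : T -> R) (b : R) :
  UltraFilter U -> (forall t, `|v t| <= b) -> exists l : R, v t @[t --> U] --> l.
Proof.
move=> UU vb; have PU : ProperFilter U by exact: ultra_proper.
have cpt := @segment_compact R (- b) b.
have [|l [_ lU]] := cpt (v t @[t --> U]) _.
  by apply: (@filterE _ U) => t; rewrite /= in_itv/= -ler_norml; exact: vb.
exists l => A lA; have [//|UA] := in_ultra_setVsetC (v @^-1` A) UU.
have [|y []] := lU (~` A) A _ lA; last by [].
exact: UA.
Qed.

(** An ultrafilter finer than the neighbourhoods of infinity provides the
    limit at all points at once. The indices are then chosen to be 1 / (k +
    1)-close to it at the first k rationals, and the uniform Hoelder bound
    extends the convergence to every real. *)
Lemma equicontinuous_extraction (u_ : nat -> R -> R) (b : R -> R) (K : R) :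
  0 <= K -> (forall n x, `|u_ n x| <= b x) ->
  (forall n x y, (u_ n x - u_ n y) ^+ 2 <= K * `|x - y|) ->
  exists (phi : nat -> nat) (u : R -> R), (forall k, (k <= phi k)%N) /\
    (forall x, u_ (phi k) x @[k --> \oo] --> u x).
Proof.
move=> K0 ub uK; have [U [UU Uoo]] := @ultraFilterLemma nat \oo _.
have PU : ProperFilter U by exact: ultra_proper.
have /choice[u uU] x : exists l : R, u_ n x @[n --> U] --> l.
  by apply: ultra_bounded_cvg => n; exact: ub.
pose q (j : nat) : R := ratr (odflt 0 (unpickle j)).
(* Both the constraint k <= n and closeness at the first k rationals hold on
   a set of the ultrafilter. *)
have near k : exists n, (k <= n)%N /\ forall j, (j < k)%N -> `|u (q j) - u_ n (q j)| < k.+1%:R^-1.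
  have Uk : U [set n | (k <= n)%N] by apply: Uoo; exists k.
  have Uj m : U [set n | forall j, (j < m)%N -> `|u (q j) - u_ n (q j)| < k.+1%:R^-1].
    elim: m => [|m IH]; first by apply: filterE => n j.
    have /cvgrPdist_lt := uU (q m) => /(_ k.+1%:R^-1); rewrite invr_gt0 ltr0Sn => /(_ isT) h.
    apply: filterS (filterI IH h) => n [h1 h2] j; rewrite ltnS leq_eqVlt => /orP[/eqP ->//|].
    exact: h1.
  by have [n [kn nj]] := filter_ex (filterI Uk (Uj k)); exists n.
have [phi phiP] := choice near.
exists phi, u; split; first by move=> k; have [] := phiP k.
have uKl x y : (u x - u y) ^+ 2 <= K * `|x - y|.
  have h : (u_ n x - u_ n y) ^+ 2 @[n --> U] --> (u x - u y) ^+ 2.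
    by apply: cvgM; apply: cvgB; exact: uU.
  rewrite -(cvg_lim _ h)//; apply: limr_le; first by apply: cvgP h.
  exact: nearW.
move=> x; apply/cvgrPdist_lt => e e0.
pose d := (e / 3) ^+ 2 / (K + 1).
have d0 : 0 < d by rewrite divr_gt0 ?exprn_gt0 ?divr_gt0//; lra.
have small (s t y : R) : (s - t) ^+ 2 <= K * y -> y < d -> `|s - t| <= e / 3.
  move=> sty yd; rewrite -ler_sqr ?nnegrE//; last lra.
  rewrite -normrX ger0_norm ?sqr_ge0// (le_trans sty)//.
  apply: (@le_trans _ _ (K * d)); first by rewrite ler_wpM2l// ltW.
  rewrite /d mulrCA ler_piMr ?sqr_ge0// ler_pdivrMr; lra.
have [r rx] : exists r : rat, `|x - ratr r| < d.
  have /rat_in_itvoo[r] : x - d < x + d by lra.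
  rewrite in_itv/= => /andP[h1 h2]; exists r; rewrite ltr_distlC; lra.
have [m me] : exists m, m.+1%:R^-1 < e / 3.
  have /ltr_add_invr[m] : 0 < e / 3 by lra.
  by rewrite add0r; exists m.
exists (maxn (pickle r).+1 m) => // k /=; rewrite geq_max => /andP[rk mk].
have [_ /(_ _ rk)] := phiP k; rewrite /q pickleK /= => h.
have h1 : `|u x - u (ratr r)| <= e / 3 by exact: small (uKl _ _) _.
have h2 : `|u_ (phi k) (ratr r) - u_ (phi k) x| <= e / 3.
  by apply: small (uK _ _ _) _; rewrite distrC.
have h3 : k.+1%:R^-1 <= m.+1%:R^-1 :> R by rewrite lef_pV2 ?posrE// ler_nat.
have {}h := lt_trans (lt_le_trans h h3) me.
have := ler_distD (u (ratr r)) (u x) (u_ (phi k) x).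
have := ler_distD (u_ (phi k) (ratr r)) (u (ratr r)) (u_ (phi k) x).
move: h h1 h2; clear; lra.
Qed.

End extraction.

(** * Tightness and convergence of moments *)

Section tightness.
Context {R : realType}.
Implicit Types (u w : R -> R) (a b x : R).
Local Notation mu := (@lebesgue_measure R).

Lemma integrable_Rpos_indic a b : mu.-integrable Rpos (EFin \o (\1_(`[a, b]%classic) : R -> R)).
Proof.
apply: (integrableS measurableT) => //; exact: (@integrable_indic_itv R a b true false).
Qed.

Lemma fatou_le (rho_ : nat -> R -> R) (rho : R -> R) (M : R) :
  (forall n, measurable_fun (@Rpos R) (rho_ n)) -> measurable_fun (@Rpos R) rho ->
  (forall n x, 0 < x -> 0 <= rho_ n x) ->
  (forall x, 0 < x -> rho_ n x @[n --> \oo] --> rho x) ->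
  (forall n, (\int[mu]_(x in Rpos) (rho_ n x)%:E <= M%:E)%E) ->
  (\int[mu]_(x in Rpos) (rho x)%:E <= M%:E)%E.
Proof.
move=> mr_ mr r0 rcvg rM; rewrite leNgt; apply/negP => Mr.
have [||N _ /(_ N (leqnn N))] := fatou_eventually measurable_Rpos mr_ mr _ _ Mr => //.
- by move=> n x; rewrite RposE; exact: r0.
- by move=> x; rewrite RposE => /rcvg; right.
- by rewrite ltNge rM.
Qed.

Lemma integrable_ge0_bounded (h : R -> R) (M : R) : measurable_fun (@Rpos R) h ->
  (forall x, 0 < x -> 0 <= h x) -> (\int[mu]_(x in Rpos) (h x)%:E <= M%:E)%E ->
  mu.-integrable Rpos (EFin \o h) /\ \int[mu]_(x in Rpos) h x <= M.
Proof.
move=> mh h0 hM.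
have ih : mu.-integrable Rpos (EFin \o h).
  apply/integrableP; split; first exact/measurable_EFinP.
  apply: le_lt_trans (ltry M); apply: le_trans hM; rewrite le_eqVlt; apply/orP; left.
  apply/eqP; apply: eq_integral => x; rewrite inE RposE => x0.
  by rewrite /= ger0_norm// h0.
split => //; rewrite -lee_fin /Rintegral fineK//; exact: integrable_fin_num.
Qed.

(** Negligibility of phi with respect to w away from a compact subset of the
    open half-line; the triple holds the two ends of the interval and a bound
    for phi on it. *)
Definition cut_weight (phi w : R -> R) := forall e, 0 < e ->
  exists abc : R * R * R, [/\ 0 < abc.1.1, 0 <= abc.2 & forall x, 0 < x ->
     if abc.1.1 <= x <= abc.1.2 then `|phi x| <= abc.2 else `|phi x| <= e * w x].

(** On the compact interval dominated convergence applies, with dominating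
    constant K b; outside it the two moments are at most e times the bounded
    moments against w. *)
Lemma tight_moment_cvg (rho_ : nat -> R -> R) (rho phi w : R -> R) (K M : R) :
  (forall n, measurable_fun (@Rpos R) (rho_ n)) -> measurable_fun (@Rpos R) rho ->
  measurable_fun (@Rpos R) phi -> measurable_fun (@Rpos R) w ->
  0 <= K -> (forall n x, 0 < x -> 0 <= rho_ n x <= K * x) ->
  (forall x, 0 < x -> rho_ n x @[n --> \oo] --> rho x) ->
  (forall x, 0 < x -> 0 <= w x) ->
  (forall n, (\int[mu]_(x in Rpos) (w x * rho_ n x)%:E <= M%:E)%E) ->
  cut_weight phi w ->
  [/\ forall n, mu.-integrable Rpos (EFin \o (fun x => phi x * rho_ n x)),
    mu.-integrable Rpos (EFin \o (fun x => phi x * rho x)) &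
    moment phi (rho_ n) @[n --> \oo] --> moment phi rho].
Proof.
move=> mr_ mr mphi mw K0 r_b rcvg w0 wM tight.
have rb x : 0 < x -> 0 <= rho x <= K * x.
  move=> x0; rewrite -(cvg_lim _ (rcvg _ x0))//; apply/andP; split.
    by apply: limr_ge; [apply: cvgP (rcvg _ x0)|apply: nearW => n; case/andP: (r_b n _ x0)].
  by apply: limr_le; [apply: cvgP (rcvg _ x0)|apply: nearW => n; case/andP: (r_b n _ x0)].
have wrM : (\int[mu]_(x in Rpos) (w x * rho x)%:E <= M%:E)%E.
  apply: (@fatou_le (fun n x => w x * rho_ n x)) => //.
  - by move=> n; apply: measurable_funM => //; exact: mr_.
  - exact: measurable_funM.
  - by move=> n x x0; rewrite mulr_ge0 ?w0//; case/andP: (r_b n _ x0).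
  - by move=> x x0; apply: cvgM; [exact: cvg_cst|exact: rcvg].
have iw (h : R -> R) : measurable_fun (@Rpos R) h -> (forall x, 0 < x -> 0 <= h x <= K * x) ->
    (\int[mu]_(x in Rpos) (w x * h x)%:E <= M%:E)%E ->
    mu.-integrable Rpos (EFin \o (fun x => w x * h x)) /\
    \int[mu]_(x in Rpos) (w x * h x) <= M.
  move=> mh hK hM; apply: integrable_ge0_bounded => //; first exact: measurable_funM.
  by move=> x x0; rewrite mulr_ge0 ?w0//; case/andP: (hK _ x0).
have int (h : R -> R) : measurable_fun (@Rpos R) h -> (forall x, 0 < x -> 0 <= h x <= K * x) ->
    (\int[mu]_(x in Rpos) (w x * h x)%:E <= M%:E)%E ->
    mu.-integrable Rpos (EFin \o (fun x => phi x * h x)).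
  move=> mh hK hM; have [iwh _] := iw _ mh hK hM.
  have [[[a b] c] /= [a0 c0 abc]] := tight _ ltr01.
  apply: (@integrable_Rpos_le _ _ (fun x => c * (K * b) * (\1_(`[a, b]%classic) : R -> R) x + w x * h x)).
  - exact: measurable_funM.
  - move=> x x0; have /andP[h0 hKx] := hK _ x0; rewrite normrM (ger0_norm h0).
    have := abc x x0; rewrite indicE; case: ifPn => [xab|nxab] phx.
      rewrite (_ : (x \in `[a, b]%classic) = true) ?mulr1; last first.
        by apply: mem_set; rewrite /= in_itv.
      have wh : 0 <= w x * h x by rewrite mulr_ge0 ?w0.
      have Kb : K * x <= K * b by rewrite ler_wpM2l//; case/andP: xab.
      have := ler_pM (normr_ge0 _) h0 phx (le_trans hKx Kb); lra.
    rewrite (_ : (x \in `[a, b]%classic) = false) ?mulr0 ?add0r; last first.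
      by apply: memNset => /=; rewrite in_itv/=; exact/negP.
    by rewrite ler_wpM2r//; move: phx; rewrite mul1r.
  - by apply: integrable_RposD => //; apply: integrable_RposZ; exact: integrable_Rpos_indic.
have i_ n : mu.-integrable Rpos (EFin \o (fun x => phi x * rho_ n x)).
  exact: (int _ (mr_ n) (r_b n) (wM n)).
have i : mu.-integrable Rpos (EFin \o (fun x => phi x * rho x)).
  exact: (int _ mr rb wrM).
have M0 : 0 <= M.
  rewrite -lee_fin; apply: le_trans (wM 0%N); apply: integral_ge0 => x; rewrite RposE => x0.
  by rewrite lee_fin mulr_ge0 ?w0//; case/andP: (r_b 0%N _ x0).
split => //; apply/cvgrPdist_le => e e0.
pose eta := e / (4 * (M + 1)).
have eta0 : 0 < eta by rewrite divr_gt0//; lra.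
have etaM : eta * (M + M) <= e / 2.
  by rewrite /eta mulrAC ler_pdivrMr; [nra|lra].
have [[[a b] c] /= [a0 c0 abc]] := tight _ eta0.
pose ab : R -> R := \1_(`[a, b]%classic).
have mab : measurable_fun (@Rpos R) ab by exact: measurable_indic.
have ab1 x : a <= x <= b -> ab x = 1 by move=> xab; rewrite /ab indicE (_ : (x \in _) = true)//; apply: mem_set; rewrite /= in_itv.
have ab0 x : ~~ (a <= x <= b) -> ab x = 0.
  by move=> /negP xab; rewrite /ab indicE memNset// /= in_itv.
have Kab x : 0 < x -> K * x * ab x <= K * b * ab x.
  move=> x0; have [xab|/ab0 ->] := boolP (a <= x <= b); last by rewrite !mulr0.
  by rewrite ab1// !mulr1 ler_wpM2l//; case/andP: xab.
have ab_ge0 x : 0 <= ab x by rewrite /ab indicE.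
have [] := @dominated_convergence _ _ _ mu (@Rpos R) measurable_Rpos
  (fun n x => (ab x * rho_ n x)%:E) (fun x => (ab x * rho x)%:E) (fun x => (K * b * ab x)%:E).
- by move=> n; apply/measurable_EFinP; apply: measurable_funM; [exact: mab|exact: mr_].
- by apply/measurable_EFinP; exact: measurable_funM.
- apply: aeW => x; rewrite RposE => x0; apply/cvg_EFin; first exact: nearW.
  by apply: cvgM; [exact: cvg_cst|exact: rcvg].
- by apply: integrable_RposZ; exact: integrable_Rpos_indic.
- apply: aeW => x n; rewrite RposE => x0; have /andP[r0 rK] := r_b n _ x0.
  rewrite lee_fin ger0_norm ?mulr_ge0//; apply: le_trans (Kab _ x0).
  by rewrite mulrC ler_wpM2r.
move=> _ J0 _.
pose J n := \int[mu]_(x in Rpos) (ab x * `|rho_ n x - rho x|).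
have {}J0 : J n @[n --> \oo] --> 0.
  apply: cvg_trans (fine_cvg J0); apply: near_eq_cvg; apply: nearW => n.
  rewrite /J /Rintegral /=; congr fine; apply: eq_integral => x _.
  by rewrite -mulrBr normrM (ger0_norm (ab_ge0 x)).
have iJ n : mu.-integrable Rpos (EFin \o (fun x => ab x * `|rho_ n x - rho x|)).
  apply: (@integrable_Rpos_le _ _ (fun x => K * b * ab x)).
  - apply: measurable_funM => //; apply: measurableT_comp => //; exact: measurable_funB.
  - move=> x x0; rewrite normrM (ger0_norm (ab_ge0 x)) normr_id.
    apply: le_trans (Kab _ x0); rewrite mulrC ler_wpM2r//.
    have /andP[r0 rK] := r_b n _ x0; have /andP[s0 sK] := rb _ x0.
    by rewrite ler_norml; apply/andP; split; lra.
  - by apply: integrable_RposZ; exact: integrable_Rpos_indic.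
have cJ : c * J n @[n --> \oo] --> 0.
  by rewrite -(mulr0 c); apply: cvgM => //; exact: cvg_cst.
have e20 : 0 < e / 2 by lra.
have /cvgrPdist_le/(_ _ e20) := cJ.
apply: filterS => n; rewrite sub0r normrN => cJe.
have iB : mu.-integrable Rpos (EFin \o (fun x => phi x * rho x - phi x * rho_ n x)).
  exact: (@integrableB _ _ _ mu _ measurable_Rpos _ _ i (i_ n)).
rewrite (_ : _ - _ = \int[mu]_(x in Rpos) (phi x * rho x - phi x * rho_ n x)); last first.
  by rewrite RintegralB.
have lB := @le_normr_Rintegral _ _ _ mu (@Rpos R) _ measurable_Rpos iB.
apply: (le_trans lB).
have [iwr wr] := iw _ mr rb wrM.
have [iwrn wrn] := iw _ (mr_ n) (r_b n) (wM n).
apply: (@le_trans _ _ (\int[mu]_(x in Rpos) (c * (ab x * `|rho_ n x - rho x|) + eta * (w x * rho x + w x * rho_ n x)))).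
  apply: le_Rintegral => //.
  - exact: integrable_norm iB.
  - by apply: integrable_RposD; apply: integrable_RposZ => //; exact: integrable_RposD.
  move=> x; rewrite RposE => x0; rewrite -mulrBr normrM distrC.
  have /andP[r0 rK] := r_b n _ x0; have /andP[s0 sK] := rb _ x0.
  have wx0 := w0 _ x0.
  have := abc _ x0; case: ifPn => [/ab1 ->|/ab0 ->] phx.
    rewrite mul1r; apply: le_trans (ler_wpM2r (normr_ge0 _) phx) _.
    by rewrite lerDl mulr_ge0 ?(ltW eta0)// addr_ge0// mulr_ge0.
  rewrite mul0r mulr0 add0r -mulrDr mulrA ler_pM//.
  by rewrite ler_norml; apply/andP; split; lra.
rewrite RintegralD//; [|exact: integrable_RposZ|by apply: integrable_RposZ; exact: integrable_RposD].
rewrite !RintegralZl//; last exact: integrable_RposD.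
rewrite RintegralD// (splitr e) lerD//; first by apply: le_trans cJe; exact: ler_norm.
by apply: le_trans etaM; rewrite ler_wpM2l ?(ltW eta0)// lerD.
Qed.

End tightness.

(** * Integration by parts on the half-line *)

Section integration_by_parts.
Context {R : realType}.
Implicit Types (u w : R -> R) (a b x : R).
Local Notation mu := (@lebesgue_measure R).

(** Factor the difference of squares; the sum of two values is bounded on a
    compact interval. *)
Lemma loc_ac_sqr u : loc_ac u -> loc_ac (fun x => u x ^+ 2).
Proof.
move=> uac a b ab e e0; have cu := loc_ac_continuous uac.
have [c _ cmax] : exists2 c, c \in `[a, b] & forall t, t \in `[a, b] -> `|u t| <= `|u c|.
  apply: (@EVT_max _ (fun t => `|u t|)); first exact: ltW.
  by apply: continuous_subspaceT => x; apply: continuous_comp; [exact: cu|exact: norm_continuous].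
pose B := 2 * `|u c| + 1.
have B0 : 0 < B by rewrite /B; have := normr_ge0 (u c); lra.
have [d d0 ud] := uac _ _ ab _ (divr_gt0 e0 B0).
exists d => // s fs sd; have := ud s fs sd.
rewrite ler_pdivlMr// => /(le_trans _); apply.
rewrite /oscillation mulr_suml ler_sum// => I _ /=.
rewrite subr_sqr normrM ler_wpM2l//.
have h x : `|u (clamp a b x)| <= `|u c|.
  by apply: cmax; rewrite in_itv/=; apply: clamp_itv; exact: ltW.
apply: le_trans (ler_normD _ _) _; have := h I.1; have := h I.2; rewrite /B; lra.
Qed.

(** Otherwise u^2 >= c near infinity, against integrability. *)
Lemma exists_small_value u (n : nat) (c : R) : continuous u -> 0 < c ->
  mu.-integrable Rpos (EFin \o (fun x => u x ^+ 2)) ->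
  exists M, n%:R <= M /\ u M ^+ 2 <= c.
Proof.
move=> cu c0 iu; apply: contrapT => noM.
have big x : n%:R <= x -> c <= u x ^+ 2.
  by move=> nx; rewrite leNgt; apply/negP => /ltW h; apply: noM; exists x.
have /integrableP[_] := iu; apply/negP; rewrite -leNgt.
apply: (@le_trans _ _ (\int[mu]_(x in `]n%:R, +oo[) (cst c%:E x))%E).
  by rewrite integral_cst//= lebesgue_measure_itv/= ltry gt0_muley// lte_fin.
apply: (@le_trans _ _ (\int[mu]_(x in `]n%:R, +oo[) `|(EFin \o (fun x => (u x ^+ 2)%R)) x|)%E).
  apply: ge0_le_integral => //=.
  - by move=> x _; rewrite lee_fin ltW.
  - apply/measurable_EFinP; apply: measurableT_comp => //; apply: measurable_funX.
    by apply: measurable_funTS; exact: continuous_measurable_fun.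
  - move=> x; rewrite /= in_itv/= andbT => nx; rewrite lee_fin ger0_norm ?sqr_ge0//.
    by apply: big; exact: ltW.
apply: ge0_subset_integral => //=.
- apply/measurable_EFinP; apply: measurableT_comp => //; apply: measurable_funX.
  by apply: measurable_funTS; exact: continuous_measurable_fun.
- move=> x; rewrite /= in_itv/= andbT RposE => nx; apply: le_lt_trans nx; exact: ler0n.
Qed.

(** The integral over ]0, M[ is u(M)^2 / 2, and M can tend to infinity along
    points where u is small. *)
Lemma Rintegral_mul_derive1 u : loc_ac u -> u 0 = 0 ->
  mu.-integrable Rpos (EFin \o (fun x => u x ^+ 2)) ->
  mu.-integrable Rpos (EFin \o (fun x => u^`()%classic x ^+ 2)) ->
  \int[mu]_(x in Rpos) (u^`()%classic x * u x) = 0.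
Proof.
move=> uac u0 iu iu'; have cu := loc_ac_continuous uac.
have mu' := measurable_derive1 cu; have mu_ := continuous_measurable_fun cu.
pose v x := u^`()%classic x * u x.
have mv : measurable_fun setT v by apply: measurable_funM; [exact: mu'|exact: mu_].
have iv : mu.-integrable Rpos (EFin \o v).
  apply: (@integrable_Rpos_le _ _ (fun x => u^`()%classic x ^+ 2 + u x ^+ 2)).
  - exact: measurable_funTS.
  - move=> x _; rewrite /v; move: (_^`()%classic x) (u x) => s t.
    rewrite ler_norml; apply/andP.
    have := (sqr_ge0 (s + t), sqr_ge0 (s - t), sqr_ge0 s, sqr_ge0 t) => -[[[? ?] ?] ?]; split; lra.
  - exact: integrable_RposD.
have half M : 0 < M -> \int[mu]_(x in `]0, M[) v x = u M ^+ 2 / 2.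
  move=> M0; have [_ i2 E] := loc_ac_ftc (loc_ac_sqr uac) M0.
  have [ae1 _ _] := loc_ac_ftc uac M0.
  have ivM : mu.-integrable `]0, M[ (EFin \o v).
    apply: (@integrableS _ _ _ mu (@Rpos R) _ _ measurable_Rpos (measurable_itv _) _ iv).
    by move=> x; rewrite /= in_itv/= RposE => /andP[].
  have -> : u M ^+ 2 = \int[mu]_(x in `]0, M[) (2 * v x).
    rewrite -[LHS](subr0) -[X in _ - X](expr0n _ 2) -[X in _ - X ^+ _]u0 E.
    rewrite /Rintegral; congr fine; apply: ae_eq_integral => //.
    - by move/integrableP : i2 => [].
    - by apply/measurable_EFinP; apply: measurable_funM => //; exact: measurable_funTS.
    - apply: ae_mono ae1 => x h /=; rewrite in_itv/= => /h du; congr EFin.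
      rewrite derive1E (_ : (fun y => u y ^+ 2) = (u * u)%R) // deriveM// /v derive1E.
      by rewrite /GRing.scale/=; ring.
  by rewrite RintegralZl//; lra.
(* Along these points the boundary term is at most 1 / (2 (n + 1)). *)
have /choice[M MP] n : exists M, n.+1%:R <= M /\ u M ^+ 2 <= n.+1%:R^-1.
  by apply: exists_small_value => //; rewrite invr_gt0.
have [] := @dominated_convergence _ _ _ mu (@Rpos R) measurable_Rpos
  (fun n x => (\1_(`]0, M n[%classic) x * v x)%:E) (fun x => (v x)%:E) (fun x => `|v x|%:E).
- move=> n; apply/measurable_EFinP; apply: measurable_funM; last exact: measurable_funTS.
  exact: measurable_indic.
- by apply/measurable_EFinP; exact: measurable_funTS.
- apply: aeW => x; rewrite RposE => x0; apply: cvg_near_cst; near=> n.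
  rewrite indicE mem_set ?mul1r//= in_itv/= x0/=.
  have [nM _] := MP n; apply: lt_le_trans nM; apply: (@lt_le_trans _ _ n%:R).
    by near: n; exact: nbhs_infty_gtr.
  by rewrite ler_nat.
- exact: integrable_norm.
- apply: aeW => x n _; rewrite lee_fin normrM ler_piMl// indicE.
  by case: (_ \in _); rewrite ?normr1// normr0.
move=> _ _ cvM.
have {}cvM : u (M n) ^+ 2 / 2 @[n --> \oo] --> \int[mu]_(x in Rpos) v x.
  have fin : (\int[mu]_(x in Rpos) (v x)%:E)%E = (\int[mu]_(x in Rpos) v x)%:E.
    by rewrite /Rintegral fineK//; exact: integrable_fin_num.
  rewrite fin in cvM; apply: cvg_trans (fine_cvg cvM); apply: near_eq_cvg; apply: nearW => n.
  have M0 : 0 < M n by have [nM _] := MP n; apply: lt_le_trans nM.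
  rewrite -half// /Rintegral/=; congr fine.
  have -> : `]0, M n[%classic = @Rpos R `&` `]0, M n[%classic.
    apply/esym/setIidr => x; rewrite /= in_itv/= RposE; by case/andP.
  rewrite integral_mkcondr; apply: eq_integral => x; rewrite inE RposE => x0.
  rewrite patchE indicE; have -> : (x \in @Rpos R `&` `]0, M n[%classic) = (x \in `]0, M n[%classic).
    by rewrite in_setI mem_set ?RposE.
  by case: ifPn => _; rewrite ?mul1r ?mul0r.
apply: (cvg_unique _ cvM); first exact: Rhausdorff.
apply: (squeeze_cvgr (f := cst 0) (h := @harmonic R)).
- apply: nearW => n; have [_ h] := MP n; rewrite /harmonic/=; have := sqr_ge0 (u (M n)).
  move: h; move: (n.+1%:R^-1) => t h ?; apply/andP; split; lra.
- exact: cvg_cst.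
- exact: cvg_harmonic.
Unshelve. all: by end_near. Qed.
End integration_by_parts.

(** * Real functions in the domain *)

Section real_functions.
Context {R : realType}.
Implicit Types (u w : R -> R) (a b x : R).
Local Notation mu := (@lebesgue_measure R).
Local Notation ReC := (@complex.Re R).
Local Notation ImC := (@complex.Im R).

(** Absolute continuity with one delta for all intervals of the line, for the
    interval families of absolutely_continuous. Functions whose derivative is
    square integrable over the line have it. *)
Definition line_ac u := forall e, 0 < e -> exists2 d, 0 < d &
  forall (n : nat) (l r : 'I_n -> R), (forall k, l k <= r k) ->
    trivIset setT (fun k => [set` `]l k, r k[]) ->
    \sum_(k < n) (r k - l k) < d -> \sum_(k < n) `|u (r k) - u (l k)| < e.

Lemma line_ac_loc_ac u : line_ac u -> loc_ac u.
Proof.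
move=> uac; have := @absolutely_continuous_loc_ac R (fun x => (u x)%:C) ReC
  (@ReB R) (@norm_Re_le R); apply => a b _; exact: absolutely_continuous_real.
Qed.

Lemma dens_real u : dens (fun x => (u x)%:C) = fun x => u x ^+ 2.
Proof. by apply/funext => x; rewrite /dens sqnorm_real. Qed.

Lemma Cderive_real u x : Cderive (fun x => (u x)%:C) x = (u^`()%classic x)%:C.
Proof.
rewrite /Cderive (_ : ImC \o _ = cst 0); last exact/funext.
by rewrite derive1_cst (_ : ReC \o _ = u).
Qed.

Lemma speed_real u : speed (fun x => (u x)%:C) = fun x => u^`()%classic x ^+ 2.
Proof. by apply/funext => x; rewrite /speed Cderive_real sqnorm_real. Qed.

Lemma square_integrable_real (u : R -> R) (g : R -> R[i]) : (forall x, 0 < x -> g x = (u x)%:C) ->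
  measurable_fun (@Rpos R) u ->
  (\int[mu]_(x in Rpos) (u x ^+ 2)%:E < +oo)%E -> square_integrable g.
Proof.
move=> gu mu_ iu; split.
- by apply: (@eq_measurable_fun _ _ _ _ _ u) => // x; rewrite inE RposE => x0; rewrite /= gu.
- apply: (@eq_measurable_fun _ _ _ _ _ (cst (0 : R))); last exact: measurable_cst.
  by move=> x; rewrite inE RposE => x0; rewrite /= gu.
- apply: le_lt_trans iu; rewrite le_eqVlt; apply/orP; left; apply/eqP.
  apply: eq_integral => x; rewrite inE RposE => x0.
  by rewrite Re_norm2 gu// sqnorm_real.
Qed.

(** Being real replaces the condition on the mean of T_x: the inner product
    of i u' and u is i times the integral of u u', which vanishes. *)
Lemma DP_real u : (forall x, x <= 0 -> u x = 0) -> line_ac u ->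
  \int[mu]_(x in Rpos) (u x ^+ 2) = 1 -> moment (@ln R) (fun x => u x ^+ 2) = 0 ->
  (\int[mu]_(x in Rpos) (u^`()%classic x ^+ 2)%:E < +oo)%E ->
  (\int[mu]_(x in Rpos) (x * u^`()%classic x ^+ 2)%:E < +oo)%E ->
  (\int[mu]_(x in Rpos) (u x ^+ 2)%:E < +oo)%E ->
  (\int[mu]_(x in Rpos) (x ^- 2 * u x ^+ 2)%:E < +oo)%E ->
  (\int[mu]_(x in Rpos) (ln x ^+ 2 * u x ^+ 2)%:E < +oo)%E ->
  DP (fun x => (u x)%:C).
Proof.
move=> u0 uac u1 lnu iA iC i1 iD iB.
have lac := line_ac_loc_ac uac; have cu := loc_ac_continuous lac.
have mu_ : measurable_fun (@Rpos R) u.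
  by apply: measurable_funTS; exact: continuous_measurable_fun.
have mu' : measurable_fun (@Rpos R) u^`()%classic.
  by apply: measurable_funTS; exact: measurable_derive1.
have int_lty (h : R -> R) : measurable_fun (@Rpos R) h -> (forall x, 0 < x -> 0 <= h x) ->
    (\int[mu]_(x in Rpos) (h x)%:E < +oo)%E -> mu.-integrable Rpos (EFin \o h).
  move=> mh h0 hoo; apply/integrableP; split; first exact/measurable_EFinP.
  apply: le_lt_trans hoo; rewrite le_eqVlt; apply/orP; left; apply/eqP.
  apply: eq_integral => x; rewrite inE RposE => x0; by rewrite /= ger0_norm// h0.
have uu' : \int[mu]_(x in Rpos) (u^`()%classic x * u x) = 0.
  apply: Rintegral_mul_derive1 => //; first exact: u0.
  - by apply: int_lty => //; [exact: measurable_funX|move=> x _; exact: sqr_ge0].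
  - by apply: int_lty => //; [exact: measurable_funX|move=> x _; exact: sqr_ge0].
split; last split; split.
- by move=> x /ltW /u0 ->.
- exact: (@square_integrable_real u).
- by move=> a b _; exact: absolutely_continuous_real.
- have : norm2 (@wS R) (fun x => (u x)%:C) ^+ 2 = 1.
    rewrite norm2_sqr; last by move=> x _; exact: ler01.
    by rewrite -u1; apply: eq_Rintegral => x _; rewrite mul1r sqnorm_real.
  move=> /eqP; rewrite sqrf_eq1 => /orP[/eqP//|/eqP h].
  by have := sqrtr_ge0 (ReC (inner (@wS R) (fun x => (u x)%:C) (fun x => (u x)%:C))); rewrite -/(norm2 _ _) h ler0N1.
- rewrite /op_mean /inner /Cintegral.
  rewrite (_ : \int[mu]_(x in _) ReC _ = \int[mu]_(x in @Rpos R) 0); last first.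
    by apply: eq_Rintegral => x _; rewrite /Tx Cderive_real /wS /=; ring.
  rewrite (_ : \int[mu]_(x in _) ImC _ = \int[mu]_(x in Rpos) (u^`()%classic x * u x)); last first.
    by apply: eq_Rintegral => x _; rewrite /Tx Cderive_real /wS /=; ring.
  by rewrite uu' Rintegral_cst// mul0r.
- rewrite /op_mean /inner /Cintegral.
  rewrite (_ : \int[mu]_(x in _) ImC _ = \int[mu]_(x in @Rpos R) 0); last first.
    by apply: eq_Rintegral => x _; rewrite /Tsigma /wS /=; ring.
  rewrite (_ : \int[mu]_(x in _) ReC _ = \int[mu]_(x in Rpos) (-1 * (ln x * u x ^+ 2))); last first.
    by apply: eq_Rintegral => x _; rewrite /Tsigma /wS /=; ring.
  rewrite RintegralZl//.
    by move: lnu; rewrite /moment => ->; rewrite mulr0 Rintegral_cst// mul0r.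
  apply: (@integrable_Rpos_le _ _ (fun x => u x ^+ 2 + ln x ^+ 2 * u x ^+ 2)).
  + by apply: measurable_funM; [exact: measurable_ln_Rpos|exact: measurable_funX].
  + move=> x x0; rewrite normrM (ger0_norm (sqr_ge0 (u x))) -[X in X + _]mul1r -mulrDl.
    rewrite ler_wpM2r ?sqr_ge0// ler_norml; apply/andP.
    have := (sqr_ge0 (ln x - 1), sqr_ge0 (ln x + 1), sqr_ge0 (ln x)) => -[[? ?] ?]; split; lra.
  + apply: integrable_RposD; apply: int_lty => //.
    * exact: measurable_funX.
    * by move=> x _; exact: sqr_ge0.
    * by apply: measurable_funM; apply: measurable_funX => //; exact: measurable_ln_Rpos.
    * by move=> x _; rewrite mulr_ge0 ?sqr_ge0.
- apply: (@square_integrable_real u^`()%classic) => // x _; exact: Cderive_real.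
- apply: (@square_integrable_real (fun x => Num.sqrt x * u^`()%classic x)).
  + by move=> x _; rewrite Cderive_real rmorphM.
  + apply: measurable_funM => //; apply: measurable_funTS; apply: continuous_measurable_fun; exact: sqrt_continuous.
  + apply: le_lt_trans iC; rewrite le_eqVlt; apply/orP; left; apply/eqP.
    apply: eq_integral => x; rewrite inE RposE => x0; by rewrite exprMn sqr_sqrtr// ltW.
- apply: (@square_integrable_real (fun x => u x * x^-1)).
  + by move=> x _; rewrite realcV rmorphM.
  + by apply: measurable_funM => //; exact: measurable_Vr.
  + apply: le_lt_trans iD; rewrite le_eqVlt; apply/orP; left; apply/eqP.
    by apply: eq_integral => x _; rewrite exprMn exprVn mulrC.
- apply: (@square_integrable_real (fun x => ln x * u x)).
  + by move=> x _; rewrite rmorphM.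
  + by apply: measurable_funM => //; exact: measurable_ln_Rpos.
  + apply: le_lt_trans iB; rewrite le_eqVlt; apply/orP; left; apply/eqP.
    by apply: eq_integral => x _; rewrite exprMn.
Qed.

End real_functions.

(** * The modulus and limits of moduli *)

Section modulus.
Context {R : realType}.
Implicit Types (f : R -> R[i]) (u w s : R -> R) (a b x : R).
Local Notation mu := (@lebesgue_measure R).
Local Notation ReC := (@complex.Re R).
Local Notation ImC := (@complex.Im R).

Definition modulus f x := Num.sqrt (dens f x).

Lemma modulus_sqr f x : modulus f x ^+ 2 = dens f x.
Proof. by rewrite sqr_sqrtr// sqnorm_ge0. Qed.

Lemma modulus_ge0 f x : 0 <= modulus f x. Proof. exact: sqrtr_ge0. Qed.

Lemma modulus_continuous f : DP f -> continuous (modulus f).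
Proof.
move=> /DP_continuous[cRe cIm] x; rewrite /modulus /dens /sqnorm.
apply: (@continuous_comp _ _ _ (fun y => ReC (f y) ^+ 2 + ImC (f y) ^+ 2) (@Num.sqrt R)).
  by apply: cvgD; apply: (@cvgM _ _ _ _ _ _); (exact: cRe || exact: cIm).
exact: sqrt_continuous.
Qed.

(** The reverse triangle inequality. *)
Lemma modulus_dist f x y : (modulus f y - modulus f x) ^+ 2 <=
  (ReC (f y) - ReC (f x)) ^+ 2 + (ImC (f y) - ImC (f x)) ^+ 2.
Proof.
have h1 := modulus_sqr f x; have h2 := modulus_sqr f y.
have m1 := modulus_ge0 f x; have m2 := modulus_ge0 f y.
move: (modulus f x) (modulus f y) m1 m2 h1 h2 => s t s0 t0.
rewrite /dens /sqnorm; move: (ReC (f x)) (ImC (f x)) (ReC (f y)) (ImC (f y)) => a b c d h1 h2.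
have st : a * c + b * d <= s * t.
  rewrite (le_trans (ler_norm _))// -ler_sqr ?nnegrE ?mulr_ge0//.
  rewrite -normrX ger0_norm ?sqr_ge0// exprMn h1 h2.
  have := sqr_ge0 (a * d - b * c); nra.
nra.
Qed.

(** Instead of differentiating the modulus at its zeros, the increments of f
    are compared with its energy and then dominate those of the modulus. *)
Lemma modulus_cauchy_schwarz f a b : DP f -> a < b ->
  (((modulus f b - modulus f a) ^+ 2)%:E <=
   (b - a)%:E * \int[mu]_(x in `]a, b[) (speed f x)%:E)%E.
Proof.
move=> fDP ab; have [aRe aIm] := DP_loc_ac fDP; have [cRe cIm] := DP_continuous fDP.
have := leeD (loc_ac_cauchy_schwarz aRe ab) (loc_ac_cauchy_schwarz aIm ab).
rewrite -ge0_muleDr; last 2 first.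
- by apply: integral_ge0 => x _; rewrite lee_fin sqr_ge0.
- by apply: integral_ge0 => x _; rewrite lee_fin sqr_ge0.
rewrite -ge0_integralD//=; last 4 first.
- by move=> x _; rewrite lee_fin sqr_ge0.
- apply/measurable_EFinP; apply: measurable_funX; apply: measurable_funTS; exact: measurable_derive1.
- by move=> x _; rewrite lee_fin sqr_ge0.
- apply/measurable_EFinP; apply: measurable_funX; apply: measurable_funTS; exact: measurable_derive1.
by apply: le_trans; rewrite -EFinD lee_fin; exact: modulus_dist.
Qed.

(** Since f vanishes on the negative half-line, so does its speed; the point
    0 is negligible. *)
Lemma integral_speed f : DP f ->
  (\int[mu]_x (speed f x)%:E = (\int[mu]_(x in Rpos) speed f x)%:E)%E.
Proof.
move=> fDP; have [iA _ _ _ _] := DP_integrable fDP.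
have ms := measurable_speed fDP.
transitivity (\int[mu]_(x in Rpos) (speed f x)%:E)%E; last first.
  by rewrite /Rintegral fineK//; exact: integrable_fin_num.
rewrite [RHS]integral_mkcond; apply: ge0_ae_eq_integral => //.
- exact/measurable_EFinP.
- apply: (measurable_restrictT _ measurable_Rpos).1.
  by apply/measurable_EFinP; exact: measurable_funTS.
- by move=> x _; rewrite lee_fin sqnorm_ge0.
- by move=> x _; rewrite patchE; case: ifPn => // _; rewrite lee_fin sqnorm_ge0.
- exists [set 0]; split; [exact: measurable_set1|exact: lebesgue_measure_set1|].
  move=> x /= /not_implyP[_]; rewrite patchE; case: ifPn => // /negP xn h.
  have [x0|x0|//] := ltgtP x 0.
    by exfalso; apply: h; rewrite speed_neg.
  by exfalso; apply: xn; rewrite inE RposE.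
Qed.

(** Each increment is at most sqrt((r - l) S) <= ((r - l) / eta + eta S) / 2,
    where S is the share of the energy in ]l, r[. The free parameter eta
    replaces the Cauchy-Schwarz inequality for finite sums. *)
Lemma energy_variation_bound u s (K eta : R) n (l r : 'I_n -> R) :
  measurable_fun setT s -> (forall x, 0 <= s x) ->
  (\int[mu]_x (s x)%:E <= K%:E)%E ->
  (forall a b, a < b -> (((u b - u a) ^+ 2)%:E <= (b - a)%:E * \int[mu]_(x in `]a, b[) (s x)%:E)%E) ->
  0 < eta -> (forall k, l k <= r k) -> trivIset setT (fun k => [set` `]l k, r k[]) ->
  \sum_(k < n) `|u (r k) - u (l k)| <= (\sum_(k < n) (r k - l k) / eta + eta * K) / 2.
Proof.
move=> ms s0 sK us eta0 lr tlr.
have isS (A : set R) : measurable A -> mu.-integrable A (EFin \o s).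
  move=> mA; apply/integrableP; split; first by apply/measurable_EFinP; exact: measurable_funTS.
  apply: le_lt_trans (ltry K); apply: le_trans sK.
  rewrite [leRHS](_ : _ = \int[mu]_x `|(EFin \o s) x|)%E; last first.
    by apply: eq_integral => x _; rewrite gee0_abs// lee_fin.
  by apply: ge0_subset_integral => //; apply: measurableT_comp => //; exact/measurable_EFinP.
pose S k := \int[mu]_(x in `]l k, r k[) s x.
have SE k : (\int[mu]_(x in `]l k, r k[) (s x)%:E = (S k)%:E)%E.
  by rewrite /S /Rintegral fineK//; apply: integrable_fin_num => //; exact: isS.
have sumS : \sum_(k < n) S k <= K.
  rewrite -lee_fin -sumEFin; apply: le_trans sK.
  rewrite (eq_bigr (fun k => \int[mu]_(x in `]l k, r k[) (s x)%:E)%E); last by move=> k _; rewrite SE.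
  rewrite -(@ge0_integral_bigsetU _ _ _ mu _ (fun k => `]l k, r k[%classic) (fun x => (s x)%:E)) //=.
  - apply: ge0_subset_integral => //.
    + by apply: bigsetU_measurable.
    + exact/measurable_EFinP.
    + by move=> x _; rewrite lee_fin.
  - by rewrite index_enum_uniq.
  - by apply: sub_trivIset tlr.
  - by apply/measurable_EFinP; apply: measurable_funTS.
  - by move=> x _; rewrite lee_fin.
have term k : `|u (r k) - u (l k)| <= ((r k - l k) / eta + eta * S k) / 2.
  have := lr k; rewrite le_eqVlt => /predU1P[<-|lrk].
    rewrite !subrr normr0 mul0r add0r divr_ge0// mulr_ge0 ?(ltW eta0)//.
    by apply: Rintegral_ge0 => x _.
  have := us _ _ lrk; rewrite SE -EFinM lee_fin => h.
  have S0 : 0 <= S k by apply: Rintegral_ge0 => x _.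
  have L0 : 0 < (r k - l k) / eta by rewrite divr_gt0// subr_gt0.
  rewrite -ler_sqr ?nnegrE//; last by rewrite divr_ge0// addr_ge0 ?(ltW L0)// mulr_ge0// ltW.
  rewrite -normrX ger0_norm ?sqr_ge0//; apply: le_trans h _.
  have -> : (r k - l k) * S k = ((r k - l k) / eta) * (eta * S k) by field; rewrite gt_eqF.
  move: (_ / eta) (eta * S k) => p q; have := sqr_ge0 (p - q); nra.
have : \sum_(k < n) `|u (r k) - u (l k)| <=
    \sum_(k < n) (((r k - l k) / eta + eta * S k) / 2).
  by apply: ler_sum => k _; exact: term.
move=> /le_trans; apply; rewrite -mulr_suml big_split/= -mulr_sumr ler_wpM2r// lerD2l ler_wpM2l//; exact: ltW.
Qed.

Lemma cvg_fin_sum (I : Type) (r : seq I) (F : I -> nat -> R) (G : I -> R) :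
  (forall i, F i m @[m --> \oo] --> G i) ->
  \sum_(i <- r) F i m @[m --> \oo] --> \sum_(i <- r) G i.
Proof.
move=> FG; elim: r => [|i r IH].
  by rewrite big_nil; under eq_fun do rewrite big_nil; exact: cvg_cst.
by rewrite big_cons; under eq_fun do rewrite big_cons; apply: cvgD.
Qed.

(** The preceding bound depends only on the energy bound K and is closed
    under pointwise limits. *)
Lemma line_ac_limit (u_ s_ : nat -> R -> R) u (K : R) : 0 <= K ->
  (forall n, measurable_fun setT (s_ n)) -> (forall n x, 0 <= s_ n x) ->
  (forall n, (\int[mu]_x (s_ n x)%:E <= K%:E)%E) ->
  (forall n a b, a < b -> (((u_ n b - u_ n a) ^+ 2)%:E <=
     (b - a)%:E * \int[mu]_(x in `]a, b[) (s_ n x)%:E)%E) ->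
  (forall x, u_ n x @[n --> \oo] --> u x) -> line_ac u.
Proof.
move=> K0 ms s0 sK us uu e e0.
pose eta := e / (K + 1); have eta0 : 0 < eta by rewrite divr_gt0//; lra.
exists (e * eta / 2); first by rewrite divr_gt0// mulr_gt0.
move=> n l r lr tlr Sd.
have cv : \sum_(k < n) `|u_ m (r k) - u_ m (l k)| @[m --> \oo] --> \sum_(k < n) `|u (r k) - u (l k)|.
  by apply: cvg_fin_sum => k; apply: cvg_norm; apply: cvgB; exact: uu.
apply: (@le_lt_trans _ _ ((\sum_(k < n) (r k - l k) / eta + eta * K) / 2)).
  rewrite -(cvg_lim _ cv)//; apply: limr_le; first by apply: cvgP cv.
  by apply: nearW => m; exact: (energy_variation_bound (ms m) (s0 m) (sK m) (us m)).
rewrite -mulr_suml.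
have h1 : (\sum_(k < n) (r k - l k)) / eta < e / 2.
  by rewrite ltr_pdivrMr// mulrAC.
have h2 : eta * K < e by rewrite /eta mulrAC ltr_pdivrMr; nra.
lra.
Qed.

End modulus.

(** * Lower semicontinuity of the energies *)

Section lower_semicontinuity.
Context {R : realType}.
Implicit Types (f : R -> R[i]) (u w s : R -> R) (a b x : R).
Local Notation mu := (@lebesgue_measure R).

(** First choose one difference quotient of the limit whose energy still
    exceeds t, then let n tend to infinity at this fixed step; the energies
    of the quotients of u_n are at most those of u_n. *)
Lemma energy_lsc (u_ s_ : nat -> R -> R) u w (t : R) :
  (forall n, continuous (u_ n)) -> continuous u ->
  (forall n, measurable_fun setT (s_ n)) -> (forall n x, 0 <= s_ n x) ->
  (forall n a b, a < b -> (((u_ n b - u_ n a) ^+ 2)%:E <=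
     (b - a)%:E * \int[mu]_(x in `]a, b[) (s_ n x)%:E)%E) ->
  (forall x, u_ n x @[n --> \oo] --> u x) ->
  measurable_fun setT w -> (forall x, 0 < x -> 0 <= w x) ->
  (forall x y, 0 < x -> x <= y -> w x <= w y) ->
  (t%:E < \int[mu]_(x in Rpos) (w x * u^`()%classic x ^+ 2)%:E)%E ->
  \forall n \near \oo, (t%:E < \int[mu]_(x in Rpos) (w x * s_ n x)%:E)%E.
Proof.
move=> cu_ cu ms s0 us uu mw w0 wnd tu.
have mdq (v : R -> R) h : continuous v -> measurable_fun (@Rpos R) (fun x => w x * diff_quotient v h x ^+ 2).
  move=> cv; apply: measurable_funM; first exact: measurable_funTS.
  apply: measurable_funX; apply: measurable_funM; first exact: measurable_cst.
  apply: measurable_funB; apply: measurable_funTS; last exact: continuous_measurable_fun.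
  apply: measurableT_comp; first exact: continuous_measurable_fun.
  by apply: measurable_funD.
have [m _ tm] : \forall m \near \oo,
    (t%:E < \int[mu]_(x in Rpos) (w x * diff_quotient u m.+1%:R^-1 x ^+ 2)%:E)%E.
  apply: (fatou_eventually measurable_Rpos _ _ _ _ tu).
  - by move=> m; exact: mdq.
  - apply: measurable_funM; first exact: measurable_funTS.
    by apply: measurable_funX; apply: measurable_funTS; exact: measurable_derive1.
  - by move=> m x; rewrite RposE => x0; rewrite mulr_ge0 ?w0 ?sqr_ge0.
  - move=> x _; have [du|ndu] := pselect (derivable u x 1); [right|left].
      apply: cvgM; first exact: cvg_cst.
      by apply: cvgM; exact: derivable_cvg_diff_quotient.
    by rewrite derive1E /derive (dvgP ndu) expr0n mulr0.
have {}tm := tm m (leqnn m); set h := m.+1%:R^-1 in tm.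
have h0 : 0 < h by rewrite invr_gt0.
have tn : \forall n \near \oo, (t%:E < \int[mu]_(x in Rpos) (w x * diff_quotient (u_ n) h x ^+ 2)%:E)%E.
  apply: (fatou_eventually measurable_Rpos _ _ _ _ tm).
  - by move=> n; exact: mdq.
  - exact: mdq.
  - by move=> n x; rewrite RposE => x0; rewrite mulr_ge0 ?w0 ?sqr_ge0.
  - move=> x _; right; apply: cvgM; first exact: cvg_cst.
    have cdq : diff_quotient (u_ n) h x @[n --> \oo] --> diff_quotient u h x.
      by apply: cvgM; [exact: cvg_cst|apply: cvgB; exact: uu].
    exact: cvgM.
apply: filterS tn => n /lt_le_trans; apply.
apply: (diff_quotient_energy h0 (cu_ n) _ (fun x _ => s0 n x) mw w0 wnd).
- apply: measurable_funTS; exact: ms.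
- by move=> x x0; have := us n x (x + h); rewrite addrAC subrr add0r; apply; rewrite ltrDl.
Qed.

Definition kinetic f := \int[mu]_(x in Rpos) speed f x.
Definition wkinetic f := \int[mu]_(x in Rpos) (x * speed f x).

(** It is the integral of (ln x - c)^2 against rho(x) dx / x, divided by N,
    with c the mean. *)
Lemma log_variance_ge0 f (rho := dens f) : DP f ->
  0 <= moment (fun x => ln x ^+ 2 / x) rho / moment (fun x => x^-1) rho
      - (moment (fun x => ln x / x) rho / moment (fun x => x^-1) rho) ^+ 2.
Proof.
move=> fDP; have [i1 iN iM1 iM2] := DP_moments fDP; have N0 := DP_W_gt0 fDP.
rewrite -/rho in i1 iN iM1 iM2 N0; set N := moment (fun x => x^-1) rho in N0 *.
set M1 := moment (fun x => ln x / x) rho; set M2 := moment _ rho.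
have [c c_def] : exists c, c = M1 / N by exists (M1 / N).
have : 0 <= \int[mu]_(x in Rpos) (ln x ^+ 2 / x * rho x + ((-2 * c) * (ln x / x * rho x) + c ^+ 2 * (x^-1 * rho x))).
  apply: Rintegral_ge0 => x; rewrite RposE => x0.
  rewrite (_ : _ + _ = (ln x - c) ^+ 2 * (x^-1 * rho x)); last by ring.
  by rewrite mulr_ge0 ?sqr_ge0// mulr_ge0 ?sqnorm_ge0// invr_ge0 ltW.
rewrite RintegralD//; last by apply: integrable_RposD; exact: integrable_RposZ.
rewrite RintegralD//; [|exact: integrable_RposZ|exact: integrable_RposZ].
rewrite !RintegralZl// -/(moment (fun x => ln x ^+ 2 / x) rho) -/M2.
rewrite -/(moment (fun x => ln x / x) rho) -/M1 -/(moment (fun x => x^-1) rho) -/N => h.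
have -> : M2 / N - (M1 / N) ^+ 2 = (M2 + (-2 * c * M1 + c ^+ 2 * N)) / N.
  by rewrite c_def; field; rewrite gt_eqF.
by rewrite divr_ge0// ltW.
Qed.

(** Each of the four nonnegative summands is at most their sum. *)
Lemma LP_bounds f (K : R) (rho := dens f) : DP f -> LP f <= K ->
  [/\ 0 <= kinetic f <= K, 0 <= moment (fun x => ln x ^+ 2) rho <= K,
   0 <= wkinetic f, 0 <= moment (fun x => x ^- 2) rho &
   wkinetic f * moment (fun x => x ^- 2) rho <= K * moment (fun x => x^-1) rho].
Proof.
move=> fDP; rewrite LPE// -/(kinetic f) -/(wkinetic f) -/rho.
have V0 := log_variance_ge0 fDP; have N0 := DP_W_gt0 fDP; rewrite -/rho in V0 N0.
have A0 : 0 <= kinetic f by apply: Rintegral_ge0 => x _; exact: sqnorm_ge0.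
have C0 : 0 <= wkinetic f.
  by apply: Rintegral_ge0 => x; rewrite RposE => x0; rewrite mulr_ge0 ?sqnorm_ge0 ?ltW.
have B0 : 0 <= moment (fun x => ln x ^+ 2) rho.
  by apply: Rintegral_ge0 => x _; rewrite mulr_ge0 ?sqnorm_ge0 ?sqr_ge0.
have D0 : 0 <= moment (fun x => x ^- 2) rho.
  by apply: Rintegral_ge0 => x _; rewrite mulr_ge0 ?sqnorm_ge0// invr_ge0 sqr_ge0.
have CD0 : 0 <= wkinetic f / moment (fun x => x^-1) rho * moment (fun x => x ^- 2) rho.
  by rewrite mulr_ge0// divr_ge0// ltW.
move=> LK; split => //; [lra|lra|].
rewrite -ler_pdivrMr// mulrAC; lra.
Qed.

End lower_semicontinuity.

(** * Uniform bounds along a minimizing sequence *)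

Section uniform_bounds.
Context {R : realType}.
Implicit Types (f : R -> R[i]) (u w s : R -> R) (a b x : R).
Local Notation mu := (@lebesgue_measure R).

(** Outside the interval |ln| exceeds L, and with L >= 4 / e this gives ln^2
    >= (4 / e) |ln|. The factor 4 absorbs the one in ln(x)^2 <= 4 / x. *)
Lemma ln_cut (e : R) : 0 < e -> exists L, [/\ 1 <= L, 4 <= e * L &
  forall x, 0 < x -> if expR (- L) <= x <= expR L then `|ln x| <= L /\ x^-1 <= expR L
    else L <= `|ln x|].
Proof.
move=> e0; exists (1 + 4 / e); set L := 1 + 4 / e.
have e4 : 0 < 4 / e by rewrite divr_gt0.
split; [rewrite /L; lra|by rewrite /L mulrDr mulr1 mulrCA divff ?gt_eqF// mulr1; lra|].
move=> x x0; have -> : (expR (- L) <= x <= expR L) = (`|ln x| <= L).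
  have xE : expR (ln x) = x by rewrite lnK ?posrE.
  by rewrite ler_norml -[in LHS]xE !ler_expR.
case: ifPn => [h|]; last by rewrite -ltNge => /ltW.
split => //; rewrite -{1}(lnK (x := x)) ?posrE// -expRN ler_expR.
by move: h; rewrite ler_norml => /andP[? ?]; lra.
Qed.

Lemma cut_weight_ln : cut_weight (cst 1) (fun x => ln x ^+ 2) /\
  cut_weight (@ln R) (fun x => ln x ^+ 2).
Proof.
split=> e e0; have [L [L1 eL LP]] := ln_cut e0.
- exists (expR (- L), expR L, 1); split => //=; first exact: expR_gt0.
  move=> x x0; have := LP x x0; rewrite normr1; case: ifPn => // _ lL.
  rewrite -(real_normK (num_real (ln x))); nra.
- exists (expR (- L), expR L, L); split => //=; [exact: expR_gt0|lra|].
  move=> x x0; have := LP x x0; case: ifPn => [_ []//|_ lL].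
  rewrite -(real_normK (num_real (ln x))); nra.
Qed.

(** Close to 0 the weight 1/x^2 dominates because |ln x| is large but ln(x)^2
    <= 4 / x; beyond 1 the weight ln^2 dominates because 1/x <= 1. *)
Lemma cut_weight_div : cut_weight (fun x => x^-1) (fun x => ln x ^+ 2 + x ^- 2) /\
  cut_weight (fun x => ln x / x) (fun x => ln x ^+ 2 + x ^- 2).
Proof.
have key (e x L : R) : 0 < x -> 1 <= L -> 4 <= e * L -> L <= `|ln x| ->
    0 < x^-1 /\ (`|x^-1| <= e * (ln x ^+ 2 + x ^- 2) /\ `|ln x / x| <= e * (ln x ^+ 2 + x ^- 2)).
  move=> x0 L1 eL lL; have e0 : 0 < e by nra.
  have v0 : 0 < x^-1 by rewrite invr_gt0.
  rewrite normrM (gtr0_norm v0) -exprVn; split => //.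
  have l2 : ln x ^+ 2 = `|ln x| ^+ 2 by rewrite real_normK// num_real.
  have [x1|x1] := ltP x 1.
    have : ln x ^+ 2 <= 4 * x^-1 by apply: ln_sqrt_le; rewrite x0.
    rewrite l2; move: (x^-1) (`|ln x|) v0 lL => v l v0 lL lv.
    have ev : l <= e * v by nra.
    have evv : e * v * v = e * v ^+ 2 by ring.
    split; nra.
  have : x^-1 <= 1 by rewrite invf_le1.
  rewrite l2; move: (x^-1) (`|ln x|) v0 lL => v l v0 lL v1.
  have el : l <= e * l ^+ 2 by nra.
  split; nra.
split=> e e0; have [L [L1 eL LP]] := ln_cut e0.
- exists (expR (- L), expR L, expR L); split => /=; [exact: expR_gt0|exact: expR_ge0|].
  move=> x x0; have := LP x x0; case: ifPn => [_ [_]|_ lL].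
    by rewrite ger0_norm// invr_ge0 ltW.
  by have [_ []] := key _ _ _ x0 L1 eL lL.
- exists (expR (- L), expR L, L * expR L); split => /=; [exact: expR_gt0| |].
    by rewrite mulr_ge0 ?expR_ge0//; lra.
  move=> x x0; have := LP x x0; case: ifPn => [_ [h1 h2]|_ lL].
    rewrite normrM ler_pM// ger0_norm// invr_ge0; exact: ltW.
  by have [_ []] := key _ _ _ x0 L1 eL lL.
Qed.

Lemma EFin_Rintegral (h : R -> R) : mu.-integrable Rpos (EFin \o h) ->
  (\int[mu]_(x in Rpos) (h x)%:E)%E = (\int[mu]_(x in Rpos) h x)%:E.
Proof. by move=> ih; rewrite /Rintegral fineK//; exact: integrable_fin_num. Qed.

Lemma modulus_holder f (K x y : R) : DP f -> kinetic f <= K ->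
  (modulus f x - modulus f y) ^+ 2 <= K * `|x - y|.
Proof.
move=> fDP fK; wlog xy : x y / x < y.
  move=> H; have [|yx|->] := ltgtP x y; first exact: H.
    by rewrite distrC -sqrrN opprB; exact: H.
  by rewrite !subrr normr0 mulr0 expr0n.
rewrite distrC gtr0_norm ?subr_gt0// -sqrrN opprB mulrC -lee_fin.
apply: le_trans (modulus_cauchy_schwarz fDP xy) _.
rewrite EFinM lee_wpmul2l// ?lee_fin ?subr_ge0 ?(ltW xy)//.
apply: (@le_trans _ _ (kinetic f)%:E); last by rewrite lee_fin.
rewrite -integral_speed//; apply: ge0_subset_integral => //.
- by apply/measurable_EFinP; exact: measurable_speed.
- by move=> z _; rewrite lee_fin sqnorm_ge0.
Qed.

Lemma modulus_vanish f x : DP f -> x <= 0 -> modulus f x = 0.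
Proof.
by move=> fDP x0; rewrite /modulus /dens (DP_vanish fDP x0) /sqnorm /= expr0n addr0 sqrtr0.
Qed.

(** Integrate 1/x <= (s + 1 / (s x^2)) / 2 against rho, which has mass 1. *)
Lemma W_norm_bound f (s : R) (rho := dens f) : DP f -> 0 < s ->
  moment (fun x => x^-1) rho <= (s + moment (fun x => x ^- 2) rho / s) / 2.
Proof.
move=> fDP s0; have [_ _ i1 iD _] := DP_integrable fDP; have [_ iN _ _] := DP_moments fDP.
have m1 := DP_mass fDP; rewrite -/rho in i1 iD iN m1.
have -> : (s + moment (fun x => x ^- 2) rho / s) / 2 =
    \int[mu]_(x in Rpos) (s / 2 * rho x + (s^-1 / 2) * (x ^- 2 * rho x)).
  rewrite RintegralD//; [|exact: integrable_RposZ|exact: integrable_RposZ].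
  by rewrite !RintegralZl// m1 /moment; field; rewrite gt_eqF.
apply: le_Rintegral => //; first by apply: integrable_RposD; exact: integrable_RposZ.
move=> x; rewrite RposE => x0; rewrite mulrA -mulrDl ler_wpM2r ?sqnorm_ge0//.
have sV : s * s^-1 = 1 by rewrite divff ?gt_eqF.
have sV0 : 0 < s^-1 by rewrite invr_gt0.
rewrite -exprVn; move: (x^-1) (s^-1) sV sV0 => v r sr r0.
have -> : s / 2 + r / 2 * v ^+ 2 = v + (s * r * s + r * v ^+ 2 - 2 * v * (s * r)) / 2.
  by rewrite sr; field.
have -> : s * r * s + r * v ^+ 2 - 2 * v * (s * r) = r * (s - v) ^+ 2 by ring.
by rewrite lerDl divr_ge0// mulr_ge0 ?sqr_ge0// ltW.
Qed.

Lemma moment_lsc (f_ : nat -> R -> R[i]) (rho phi : R -> R) (t : R) :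
  (forall n, DP (f_ n)) -> measurable_fun (@Rpos R) phi -> (forall x, 0 < x -> 0 <= phi x) ->
  measurable_fun (@Rpos R) rho ->
  (forall n, mu.-integrable Rpos (EFin \o (fun x => phi x * dens (f_ n) x))) ->
  (forall x, 0 < x -> dens (f_ n) x @[n --> \oo] --> rho x) ->
  (t%:E < \int[mu]_(x in Rpos) (phi x * rho x)%:E)%E ->
  \forall n \near \oo, t < moment phi (dens (f_ n)).
Proof.
move=> fDP mphi phi0 mrho iphi frho tm.
have : \forall n \near \oo, (t%:E < \int[mu]_(x in Rpos) (phi x * dens (f_ n) x)%:E)%E.
  apply: (fatou_eventually measurable_Rpos _ _ _ _ tm).
  - by move=> n; apply: measurable_funM => //; apply: measurable_funTS; exact: measurable_dens.
  - exact: measurable_funM.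
  - by move=> n x; rewrite RposE => x0; rewrite mulr_ge0 ?phi0 ?sqnorm_ge0.
  - move=> x; rewrite RposE => x0; right; apply: cvgM; [exact: cvg_cst|exact: frho].
by apply: filterS => n; rewrite EFin_Rintegral// lte_fin.
Qed.

End uniform_bounds.

(** * The limit of the moduli *)

Section moduli_limit.
Context {R : realType}.
Implicit Types (f : R -> R[i]) (u w s : R -> R) (a b x : R).
Local Notation mu := (@lebesgue_measure R).

(** The bound on the kinetic term gives a uniform Hoelder estimate and, as
    the moduli vanish at 0, pointwise boundedness. *)
Lemma minimizing_subsequence (f_ : nat -> R -> R[i]) (K : R) :
  (forall n, DP (f_ n)) -> (forall n, LP (f_ n) <= K) ->
  exists (phi : nat -> nat) (u : R -> R), (forall k, (k <= phi k)%N) /\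
    forall x, modulus (f_ (phi k)) x @[k --> \oo] --> u x.
Proof.
move=> fDP fK.
have kK n : 0 <= kinetic (f_ n) <= K by have [] := LP_bounds (fDP n) (fK n).
have K0 : 0 <= K by have /andP[] := kK 0%N; exact: le_trans.
apply: (@equicontinuous_extraction _ (fun n => modulus (f_ n)) (fun x => K * `|x| + 1) K) => //.
- move=> n x; rewrite ger0_norm ?modulus_ge0//.
  have /andP[_ nK] := kK n.
  have := modulus_holder x 0 (fDP n) nK; rewrite subr0 (modulus_vanish (fDP n) (lexx _)) subr0.
  have := modulus_ge0 (f_ n) x; move: (modulus _ _) => s s0; nra.
- by move=> n x y; apply: modulus_holder => //; case/andP: (kK n).
Qed.

Section limit.
Context (g_ : nat -> R -> R[i]) (u : R -> R) (K : R).
Context (gDP : forall n, DP (g_ n)) (gK : forall n, LP (g_ n) <= K).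
Context (gu : forall x, modulus (g_ n) x @[n --> \oo] --> u x).

Let kK n : 0 <= kinetic (g_ n) <= K.
Proof. by have [] := LP_bounds (gDP n) (gK n). Qed.

Let K0 : 0 <= K.
Proof. by have /andP[] := kK 0%N; exact: le_trans. Qed.

Lemma dens_cvg x : dens (g_ n) x @[n --> \oo] --> u x ^+ 2.
Proof. by under eq_fun do rewrite -modulus_sqr; apply: cvgM; exact: gu. Qed.

Lemma limit_vanish x : x <= 0 -> u x = 0.
Proof.
move=> x0; rewrite -(cvg_lim _ (@gu x))//; apply: lim_near_cst => //.
by apply: nearW => n; exact: modulus_vanish.
Qed.

Lemma limit_line_ac : line_ac u.
Proof.
apply: (@line_ac_limit _ (fun n => modulus (g_ n)) (fun n => speed (g_ n)) u K) => //.
- by move=> n; exact: measurable_speed.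
- by move=> n x; exact: sqnorm_ge0.
- by move=> n; rewrite integral_speed// lee_fin; case/andP: (kK n).
- by move=> n a b; exact: modulus_cauchy_schwarz.
Qed.

Let ucont : continuous u.
Proof. exact: loc_ac_continuous (line_ac_loc_ac limit_line_ac). Qed.

Lemma measurable_limit : measurable_fun (@Rpos R) (fun x => u x ^+ 2).
Proof. by apply: measurable_funX; apply: measurable_funTS; exact: continuous_measurable_fun. Qed.

Let mdens n : measurable_fun (@Rpos R) (dens (g_ n)).
Proof. by apply: measurable_funTS; exact: measurable_dens. Qed.

Let dens_bound n x : 0 < x -> 0 <= dens (g_ n) x <= K * x.
Proof.
move=> x0; rewrite sqnorm_ge0/=; have /andP[_ nK] := kK n.
have := modulus_holder x 0 (gDP n) nK.
by rewrite subr0 (modulus_vanish (gDP n) (lexx _)) subr0 modulus_sqr (gtr0_norm x0).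
Qed.

Lemma limit_cut_weight (phi w : R -> R) (M : R) : cut_weight phi w ->
  measurable_fun (@Rpos R) phi -> measurable_fun (@Rpos R) w -> (forall x, 0 < x -> 0 <= w x) ->
  (forall n, mu.-integrable Rpos (EFin \o (fun x => w x * dens (g_ n) x))) ->
  (forall n, moment w (dens (g_ n)) <= M) ->
  mu.-integrable Rpos (EFin \o (fun x => phi x * u x ^+ 2)) /\
  moment phi (dens (g_ n)) @[n --> \oo] --> moment phi (fun x => u x ^+ 2).
Proof.
move=> cphi mphi mw w0 iw wM.
have [|_ i c] := tight_moment_cvg mdens measurable_limit mphi mw K0 dens_bound
  (fun x _ => @dens_cvg x) w0 (M := M) _ cphi; last by split.
by move=> n; rewrite EFin_Rintegral// lee_fin; exact: wM.
Qed.

Lemma limit_fatou (w : R -> R) (M : R) : measurable_fun (@Rpos R) w ->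
  (forall x, 0 < x -> 0 <= w x) ->
  (forall n, mu.-integrable Rpos (EFin \o (fun x => w x * dens (g_ n) x))) ->
  (forall n, moment w (dens (g_ n)) <= M) ->
  (\int[mu]_(x in Rpos) (w x * u x ^+ 2)%:E <= M%:E)%E.
Proof.
move=> mw w0 iw wM; apply: (@fatou_le _ (fun n x => w x * dens (g_ n) x)).
- by move=> n; exact: measurable_funM.
- by apply: measurable_funM => //; exact: measurable_limit.
- by move=> n x x0; rewrite mulr_ge0 ?w0 ?sqnorm_ge0.
- by move=> x x0; apply: cvgM; [exact: cvg_cst|exact: dens_cvg].
- by move=> n; rewrite EFin_Rintegral// lee_fin; exact: wM.
Qed.

Let mln2 : measurable_fun (@Rpos R) (fun x => ln x ^+ 2).
Proof. apply: measurable_funX; exact: measurable_ln_Rpos. Qed.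

Let iln2 n : mu.-integrable Rpos (EFin \o (fun x => ln x ^+ 2 * dens (g_ n) x)).
Proof. by have [] := DP_integrable (gDP n). Qed.

Let ln2K n : moment (fun x => ln x ^+ 2) (dens (g_ n)) <= K.
Proof. by have [_ /andP[]] := LP_bounds (gDP n) (gK n). Qed.

Lemma limit_ln2 : (\int[mu]_(x in Rpos) (ln x ^+ 2 * u x ^+ 2)%:E <= K%:E)%E.
Proof. by apply: limit_fatou => // x _; exact: sqr_ge0. Qed.

Lemma limit_mass : mu.-integrable Rpos (EFin \o (fun x => u x ^+ 2)) /\
  \int[mu]_(x in Rpos) u x ^+ 2 = 1.
Proof.
have [i c] := limit_cut_weight cut_weight_ln.1 (measurable_cst _) mln2
  (fun x _ => sqr_ge0 (ln x)) iln2 ln2K.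
have E (h : R -> R) : moment (cst 1) h = \int[mu]_(x in Rpos) h x.
  by apply: eq_Rintegral => x _; rewrite mul1r.
split.
  by apply: eq_integrable i => // x _; rewrite /= mul1r.
rewrite -E; apply: (cvg_unique _ c); first exact: Rhausdorff.
by apply: cvg_near_cst; apply: nearW => n; rewrite E DP_mass.
Qed.

Lemma limit_ln_mean : moment (@ln R) (fun x => u x ^+ 2) = 0.
Proof.
have [i c] := limit_cut_weight cut_weight_ln.2 (@measurable_ln_Rpos R) mln2
  (fun x _ => sqr_ge0 (ln x)) iln2 ln2K.
apply: (cvg_unique _ c); first exact: Rhausdorff.
by apply: cvg_near_cst; apply: nearW => n; rewrite DP_ln_mean.
Qed.

Lemma limit_energy_lsc (w : R -> R) (t : R) : measurable_fun setT w ->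
  (forall x, 0 < x -> 0 <= w x) -> (forall x y, 0 < x -> x <= y -> w x <= w y) ->
  (forall n, mu.-integrable Rpos (EFin \o (fun x => w x * speed (g_ n) x))) ->
  (t%:E < \int[mu]_(x in Rpos) (w x * u^`()%classic x ^+ 2)%:E)%E ->
  \forall n \near \oo, t < \int[mu]_(x in Rpos) (w x * speed (g_ n) x).
Proof.
move=> mw w0 wnd iw tw.
have := energy_lsc (fun n => modulus_continuous (gDP n)) ucont
  (fun n => measurable_speed (gDP n)) (fun n x => sqnorm_ge0 _)
  (fun n a b ab => modulus_cauchy_schwarz (gDP n) ab) gu mw w0 wnd tw.
by apply: filterS => n; rewrite EFin_Rintegral// lte_fin.
Qed.

Lemma limit_kinetic_lsc t : (t%:E < \int[mu]_(x in Rpos) (u^`()%classic x ^+ 2)%:E)%E ->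
  \forall n \near \oo, t < kinetic (g_ n).
Proof.
move=> tw.
have tw1 : (t%:E < \int[mu]_(x in Rpos) (cst 1 x * u^`()%classic x ^+ 2)%:E)%E.
  apply: lt_le_trans tw _; rewrite le_eqVlt; apply/orP; left; apply/eqP.
  by apply: eq_integral => x _; rewrite /= mul1r.
have := @limit_energy_lsc (cst 1) t (measurable_cst _) (fun _ _ => ler01)
  (fun _ _ _ _ => lexx _) _ tw1.
have i1 n : mu.-integrable Rpos (EFin \o (fun x => cst 1 x * speed (g_ n) x)).
  have [i _ _ _ _] := DP_integrable (gDP n).
  by apply: eq_integrable i => // x _ /=; rewrite mul1r.
move=> /(_ i1); apply: filterS => n.
by congr (_ < _); apply: eq_Rintegral => x _; rewrite /= mul1r.
Qed.

Lemma limit_kinetic : (\int[mu]_(x in Rpos) (u^`()%classic x ^+ 2)%:E <= K%:E)%E.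
Proof.
rewrite leNgt; apply/negP => /limit_kinetic_lsc[n _ /(_ n (leqnn n))].
by rewrite ltNge; case/andP: (kK n) => _ ->.
Qed.

Lemma limit_wkinetic_lsc t : (t%:E < \int[mu]_(x in Rpos) (x * u^`()%classic x ^+ 2)%:E)%E ->
  \forall n \near \oo, t < wkinetic (g_ n).
Proof.
move=> tw; apply: (@limit_energy_lsc id) => //.
- by move=> x /ltW.
- by move=> n; have [] := DP_integrable (gDP n).
Qed.

End limit.

End moduli_limit.

(** * The limit is a minimizer *)

Section minimality.
Context {R : realType}.
Implicit Types (f : R -> R[i]) (u w s : R -> R) (a b x : R).
Local Notation mu := (@lebesgue_measure R).

(** If it vanished, u' would vanish almost everywhere and u, starting from 0,
    would be zero, against its unit mass. *)
Lemma wkinetic_gt0 u : loc_ac u -> u 0 = 0 ->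
  \int[mu]_(x in Rpos) u x ^+ 2 = 1 ->
  mu.-integrable Rpos (EFin \o (fun x => u^`()%classic x ^+ 2)) ->
  (0 < \int[mu]_(x in Rpos) (x * u^`()%classic x ^+ 2)%:E)%E.
Proof.
move=> uac u0 u1 iu'; have cu := loc_ac_continuous uac.
have mu' : measurable_fun (@Rpos R) (fun x => u^`()%classic x ^+ 2).
  by apply: measurable_funX; apply: measurable_funTS; exact: measurable_derive1.
rewrite lt_neqAle integral_ge0 ?andbT; last first.
  by move=> x; rewrite RposE => x0; rewrite lee_fin mulr_ge0 ?sqr_ge0// ltW.
apply/negP => /eqP C0.
have mxu' : measurable_fun (@Rpos R) (fun x => x * u^`()%classic x ^+ 2).
  by apply: measurable_funM => //; exact: measurable_id.
have [||ix mx] := @integrable_ge0_bounded _ (fun x => x * u^`()%classic x ^+ 2) 0 mxu'.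
- by move=> x x0; rewrite mulr_ge0 ?sqr_ge0// ltW.
- by rewrite -C0.
have [E0|] := eqVneq (\int[mu]_(x in Rpos) u^`()%classic x ^+ 2) 0; last first.
  move=> /(moment_gt0 (phi := id) mu' (fun x _ => sqr_ge0 _) (fun _ h => h) ix).
  by rewrite ltNge => /negP; apply; exact: mx.
have : \int[mu]_(x in Rpos) u x ^+ 2 = \int[mu]_(x in @Rpos R) 0.
  apply: eq_Rintegral => x; rewrite inE RposE => x0.
  have := loc_ac_cauchy_schwarz uac x0; rewrite u0 !subr0 => h.
  apply/eqP; rewrite eq_le sqr_ge0 andbT -lee_fin; apply: le_trans h _.
  rewrite [leRHS](_ : _ = x%:E * (\int[mu]_(x in Rpos) u^`()%classic x ^+ 2)%:E)%E; last by rewrite E0 mule0.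
  rewrite -EFin_Rintegral// lee_wpmul2l ?lee_fin ?(ltW x0)//.
  apply: ge0_subset_integral => //.
  - exact/measurable_EFinP.
  - by move=> y _; rewrite lee_fin sqr_ge0.
  - by move=> y; rewrite /= in_itv/= RposE => /andP[].
by rewrite u1 Rintegral_cst// mul0r => /eqP; rewrite oner_eq0.
Qed.

(** From c D <= C D <= K N and N <= (s + D / s) / 2 with s = K / c one gets c
    D <= K^2 / (2 c) + c D / 2, and D can be absorbed on the left. *)
Lemma singular_moment_bound f (K c : R) : DP f -> LP f <= K -> 0 < c < wkinetic f ->
  moment (fun x => x ^- 2) (dens f) <= K ^+ 2 / c ^+ 2.
Proof.
move=> fDP fK /andP[c0 cC]; have [/andP[_ _] /andP[B0 BK] C0 D0 CD] := LP_bounds fDP fK.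
have K0 : 0 <= K by exact: le_trans BK.
have N0 := DP_W_gt0 fDP.
set D := moment (fun x => x ^- 2) _ in D0 CD *; set N := moment (fun x => x^-1) _ in N0 CD.
have cD : c * D <= K * N by apply: le_trans CD; rewrite ler_wpM2r// ltW.
have [Kz|Kn0] := eqVneq K 0.
  move: cD; rewrite Kz mul0r expr0n mul0r pmulr_rle0//.
have Kpos : 0 < K by rewrite lt_neqAle eq_sym Kn0.
have := W_norm_bound fDP (divr_gt0 Kpos c0); rewrite -/D -/N invf_div => ND.
have : c * D <= K * ((K / c + D * (c / K)) / 2) by apply: le_trans cD _; rewrite ler_wpM2l.
have -> : K * ((K / c + D * (c / K)) / 2) = (K ^+ 2 / c + c * D) / 2.
  by field; rewrite !gt_eqF.
move=> h; rewrite ler_pdivlMr ?exprn_gt0//.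
have h2 : c * D <= K ^+ 2 / c by lra.
have -> : D * c ^+ 2 = c * (c * D) by ring.
by apply: le_trans (ler_wpM2l (ltW c0) h2) _; rewrite mulrCA divff ?gt_eqF// mulr1.
Qed.

(** Bounds come in a definite order: C > 0 for the limit, then D along the
    sequence, then convergence of N, and only then finiteness of C for the
    limit, from C D <= K N and a positive lower bound for D. *)
Lemma minimizing_limit (f_ : nat -> R -> R[i]) (l : R) :
  (forall n, DP (f_ n)) -> (forall n, LP (f_ n) <= l + n.+1%:R^-1) ->
  exists2 f0, DP f0 & LP f0 <= l.
Proof.
move=> fDP fl; pose K := l + 1.
have le_K n (t : R) : t <= l + n.+1%:R^-1 -> t <= K.
  move=> /le_trans; apply; rewrite /K lerD2l invf_le1 ?ltr0n// ler1n//.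
have [phi [u [phik gu]]] := minimizing_subsequence fDP (fun n => le_K n _ (fl n)).
pose g_ k := f_ (phi k).
have gDP k : DP (g_ k) by exact: fDP.
have gl k : LP (g_ k) <= l + k.+1%:R^-1.
  apply: le_trans (fl _) _; rewrite lerD2l lef_pV2 ?posrE// ler_nat ltnS; exact: phik.
have gK k : LP (g_ k) <= K by exact: le_K (gl k).
have u0 x : x <= 0 -> u x = 0 by move=> x0; exact: (limit_vanish gDP gu).
have uac : line_ac u := limit_line_ac gDP gK gu.
have lac := line_ac_loc_ac uac; have cu := loc_ac_continuous lac.
have [iu u1] := limit_mass gDP gK gu.
have lnu := limit_ln_mean gDP gK gu.
have uK := limit_kinetic gDP gK gu.
have mu'2 : measurable_fun (@Rpos R) (fun x => u^`()%classic x ^+ 2).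
  by apply: measurable_funX; apply: measurable_funTS; exact: measurable_derive1.
have [iu' _] := integrable_ge0_bounded mu'2 (fun x _ => sqr_ge0 _) uK.
have C0 := wkinetic_gt0 lac (u0 _ (lexx _)) u1 iu'.
have [c /andP[c0 cC]] : exists c : R, (0 < c) && (c%:E < \int[mu]_(x in Rpos) (x * u^`()%classic x ^+ 2)%:E)%E.
  move: C0; case: (\int[mu]_(x in Rpos) _)%E => [r| |]// r0.
    by exists (r / 2); move: r0; rewrite !lte_fin => r0; apply/andP; split; lra.
  by exists 1; rewrite ltr01 ltry.
have [k0 _ k0P] := limit_wkinetic_lsc gDP gK gu cC.
(* From here on C > c along the sequence. *)
pose h_ k := g_ (k + k0)%N.
have hDP k : DP (h_ k) by exact: gDP.
have hl k : LP (h_ k) <= l + k.+1%:R^-1.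
  apply: le_trans (gl _) _; rewrite lerD2l lef_pV2 ?posrE// ler_nat ltnS leq_addr//.
have hK k : LP (h_ k) <= K by exact: le_K (hl k).
have hu x : modulus (h_ n) x @[n --> \oo] --> u x.
  by have := gu x; rewrite -(cvg_shiftn k0).
pose M := K ^+ 2 / c ^+ 2.
have hM k : moment (fun x => x ^- 2) (dens (h_ k)) <= M.
  by apply: singular_moment_bound => //; rewrite c0; apply: k0P; rewrite /= leq_addl.
have mln := @measurable_ln_Rpos R; have mV := @measurable_Vr R.
have mln2 : measurable_fun (@Rpos R) (fun x => ln x ^+ 2) by exact: measurable_funX.
have mV2 : measurable_fun (@Rpos R) (fun x => x ^- 2).
  by under eq_fun do rewrite -exprVn; exact: measurable_funX.
have V2ge0 x : 0 < x -> 0 <= x ^- 2 :> R by move=> _; rewrite invr_ge0 sqr_ge0.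
have iV2 k : mu.-integrable Rpos (EFin \o (fun x => x ^- 2 * dens (h_ k) x)).
  by have [] := DP_integrable (hDP k).
have iln2 k : mu.-integrable Rpos (EFin \o (fun x => ln x ^+ 2 * dens (h_ k) x)).
  by have [] := DP_integrable (hDP k).
pose w x := ln x ^+ 2 + x ^- 2.
have wE x y : w x * y = ln x ^+ 2 * y + x ^- 2 * y by rewrite /w mulrDl.
have iw k : mu.-integrable Rpos (EFin \o (fun x => w x * dens (h_ k) x)).
  by under eq_fun do rewrite wE; exact: integrable_RposD.
have wKM k : moment w (dens (h_ k)) <= K + M.
  have -> : moment w (dens (h_ k)) = moment (fun x => ln x ^+ 2) (dens (h_ k)) + moment (fun x => x ^- 2) (dens (h_ k)).
    by rewrite -RintegralD//; apply: eq_Rintegral => x _; exact: wE.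
  by rewrite lerD//; have [_ /andP[]] := LP_bounds (hDP k) (hK k).
have w0 x : 0 < x -> 0 <= w x by move=> x0; rewrite addr_ge0 ?sqr_ge0 ?V2ge0.
have mw : measurable_fun (@Rpos R) w by exact: measurable_funD.
have [iN cN] := limit_cut_weight hDP hK hu cut_weight_div.1 mV mw w0 iw wKM.
have [iM1 cM1] := limit_cut_weight hDP hK hu cut_weight_div.2 (measurable_funM mln mV) mw w0 iw wKM.
have mu2 : measurable_fun (@Rpos R) (fun x => u x ^+ 2) := measurable_limit hDP hK hu.
have hdens x : 0 < x -> dens (h_ n) x @[n --> \oo] --> u x ^+ 2.
  by move=> _; exact: (dens_cvg hu).
have DM := limit_fatou hDP hK hu mV2 V2ge0 iV2 hM.
have BK := limit_ln2 hDP hK hu.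
have [iD _] := integrable_ge0_bounded (measurable_funM mV2 mu2)
  (fun _ h => mulr_ge0 (V2ge0 _ h) (sqr_ge0 _)) DM.
have D0 : 0 < moment (fun x => x ^- 2) (fun x => u x ^+ 2).
  apply: moment_gt0 => //.
  - by move=> x _; exact: sqr_ge0.
  - by move=> x x0; rewrite invr_gt0 exprn_gt0.
  - by rewrite u1 oner_neq0.
set D := moment (fun x => x ^- 2) _ in D0.
have lscD t : t < D -> \forall n \near \oo, t < moment (fun x => x ^- 2) (dens (h_ n)).
  move=> tD; apply: (moment_lsc hDP mV2 V2ge0 mu2 iV2 hdens).
  by rewrite EFin_Rintegral// lte_fin.
have Nbound k : moment (fun x => x^-1) (dens (h_ k)) <= 1 + M.
  have := W_norm_bound (hDP k) ltr01; rewrite divr1; have := hM k.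
  have [_ _ _ + _] := LP_bounds (hDP k) (hK k); lra.
have Kge0 : 0 <= K by have [/andP[+ h] _ _ _ _] := LP_bounds (hDP 0%N) (hK 0%N); move=> /le_trans; apply.
have Mge0 : 0 <= M by have [_ _ _ + _] := LP_bounds (hDP 0%N) (hK 0%N); move=> /le_trans; apply; exact: hM.
have mxu' : measurable_fun (@Rpos R) (fun x => x * u^`()%classic x ^+ 2).
  by apply: measurable_funM; [exact: measurable_id|exact: mu'2].
(* N <= 1 + M, so C D <= K N forces C <= t as soon as D_n > D / 2. *)
pose t := K * (1 + M) / (D / 2).
have t0 : 0 <= t.
  rewrite /t; apply: divr_ge0; [apply: mulr_ge0 => //; lra|lra].
have CM : (\int[mu]_(x in Rpos) (x * u^`()%classic x ^+ 2)%:E <= t%:E)%E.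
  rewrite leNgt; apply/negP => tC.
  have D2 : D / 2 < D by lra.
  have [n [tn Dn]] := filter_ex (filterI (limit_wkinetic_lsc hDP hK hu tC) (lscD _ D2)).
  have [_ _ _ _ CDn] := LP_bounds (hDP n) (hK n).
  have : t * (D / 2) < wkinetic (h_ n) * moment (fun x => x ^- 2) (dens (h_ n)).
    by rewrite ltr_pM// divr_ge0// ltW.
  rewrite ltNge => /negP; apply; apply: le_trans CDn _.
  rewrite /t divfK; last by rewrite gt_eqF// divr_gt0.
  by rewrite ler_wpM2l.
have [iC _] := integrable_ge0_bounded mxu' (fun _ h => mulr_ge0 (ltW h) (sqr_ge0 _)) CM.
have f0DP : DP (fun x => (u x)%:C).
  apply: DP_real => //.
  - exact: le_lt_trans uK (ltry _).
  - exact: le_lt_trans CM (ltry _).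
  - by rewrite EFin_Rintegral// ltry.
  - exact: le_lt_trans DM (ltry _).
  - exact: le_lt_trans BK (ltry _).
exists (fun x => (u x)%:C) => //.
rewrite LPE// dens_real speed_real.
have [_ iN0 iM10 iM2] := DP_moments f0DP; rewrite dens_real in iN0 iM10 iM2.
have [_ _ _ _ iB] := DP_integrable f0DP; rewrite dens_real in iB.
have N0 := DP_W_gt0 f0DP; rewrite dens_real in N0.
set A := \int[mu]_(x in Rpos) _; set B := moment (fun x => ln x ^+ 2) _.
set C := \int[mu]_(x in Rpos) _; set N := moment (fun x => x^-1) _ in N0 cN *.
rewrite -/D; set M2 := moment (fun x => ln x ^+ 2 / x) _.
set M1 := moment (fun x => ln x / x) _ in cM1 *.
have Cgt0 : 0 < C by move: C0; rewrite EFin_Rintegral// lte_fin.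
have lscA t' : t' < A -> \forall n \near \oo, t' < kinetic (h_ n).
  by move=> tA; apply: (limit_kinetic_lsc hDP hK hu); rewrite EFin_Rintegral// lte_fin.
have lscC t' : t' < C -> \forall n \near \oo, t' < wkinetic (h_ n).
  by move=> tC; apply: (limit_wkinetic_lsc hDP hK hu); rewrite EFin_Rintegral// lte_fin.
have lscB t' : t' < B -> \forall n \near \oo, t' < moment (fun x => ln x ^+ 2) (dens (h_ n)).
  move=> tB; apply: (moment_lsc hDP mln2 (fun x _ => sqr_ge0 _) mu2 iln2 hdens).
  by rewrite EFin_Rintegral// lte_fin.
have lscM2 t' : t' < M2 -> \forall n \near \oo, t' < moment (fun x => ln x ^+ 2 / x) (dens (h_ n)).
  move=> tM; apply: (moment_lsc hDP (measurable_funM mln2 mV) _ mu2 _ hdens).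
  - by move=> x x0; rewrite mulr_ge0 ?sqr_ge0// invr_ge0 ltW.
  - by move=> n; have [] := DP_moments (hDP n).
  - by rewrite EFin_Rintegral// lte_fin.
(* A lower bound for the functional along the sequence in which the
   semicontinuous quantities are lowered by e, whereas N and M1 are kept as
   they converge; e tends to 0 at the end. *)
pose Phi (e n m : R) := (A - e) + (B - e) + (C - e) / n * (D - e) + ((M2 - e) / n - (m / n) ^+ 2).
have Phi_le e : 0 < e -> e < C -> e < D -> Phi e N M1 <= l.
  move=> e0 eC eD.
  pose v n := Phi e (moment (fun x => x^-1) (dens (h_ n))) (moment (fun x => ln x / x) (dens (h_ n))).
  have cv : v n @[n --> \oo] --> Phi e N M1.
    have cNV : (moment (fun x => x^-1) (dens (h_ n)))^-1 @[n --> \oo] --> N^-1.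
      by apply: cvgV => //; rewrite gt_eqF.
    rewrite /v /Phi; apply: cvgD; first apply: cvgD; first exact: cvg_cst.
      apply: cvgM; last exact: cvg_cst.
      by apply: cvgM => //; exact: cvg_cst.
    apply: cvgB; first by apply: cvgM => //; exact: cvg_cst.
    by apply: cvgM; apply: cvgM.
  have cl : l + n.+1%:R^-1 @[n --> \oo] --> l.
    by rewrite -[X in _ --> X]addr0; apply: cvgD; [exact: cvg_cst|exact: cvg_harmonic].
  apply: (ler_cvg_to cv cl).
  have lt_sub (z : R) : z - e < z by rewrite ltrBlDr ltrDl.
  near=> n.
  have An : A - e < kinetic (h_ n) by near: n; exact: lscA.
  have Bn : B - e < moment (fun x => ln x ^+ 2) (dens (h_ n)) by near: n; exact: lscB.
  have Cn : C - e < wkinetic (h_ n) by near: n; exact: lscC.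
  have Dn : D - e < moment (fun x => x ^- 2) (dens (h_ n)) by near: n; exact: lscD.
  have M2n : M2 - e < moment (fun x => ln x ^+ 2 / x) (dens (h_ n)) by near: n; exact: lscM2.
  apply: le_trans (hl n); rewrite LPE// -/(kinetic _) -/(wkinetic _) /v /Phi.
  have Nn := DP_W_gt0 (hDP n).
  apply: lerD; last by rewrite lerD2r ler_wpM2r ?invr_ge0 ?(ltW Nn) ?(ltW M2n).
  apply: lerD; first by apply: lerD; exact: ltW.
  apply: ler_pM.
  - by apply: divr_ge0; [rewrite subr_ge0; exact: ltW eC|exact: ltW Nn].
  - by rewrite subr_ge0 ltW.
  - by rewrite ler_wpM2r ?invr_ge0 ?(ltW Nn) ?(ltW Cn).
  - exact: ltW.
have cPhi : Phi n.+1%:R^-1 N M1 @[n --> \oo] --> Phi 0 N M1.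
  have ch := @cvg_harmonic R.
  have csub (z : R) : z - n.+1%:R^-1 @[n --> \oo] --> z - 0 by apply: cvgB => //; exact: cvg_cst.
  rewrite /Phi; apply: cvgD; first apply: cvgD; first exact: cvgD.
    by apply: cvgM => //; apply: cvgM => //; exact: cvg_cst.
  apply: cvgB; last exact: cvg_cst.
  by apply: cvgM => //; exact: cvg_cst.
have <- : Phi 0 N M1 = A + B + C / N * D + (M2 / N - (M1 / N) ^+ 2).
  by rewrite /Phi !subr0.
rewrite -(cvg_lim _ cPhi)//; apply: limr_le; first by apply: cvgP cPhi.
have hsmall (z : R) : 0 < z -> \forall n \near \oo, n.+1%:R^-1 < z.
  move=> z0; have /cvgrPdist_lt/(_ _ z0) := @cvg_harmonic R.
  by apply: filterS => n; rewrite sub0r normrN gtr0_norm// invr_gt0.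
near=> n; apply: Phi_le; first by rewrite invr_gt0.
  by near: n; exact: hsmall.
by near: n; exact: hsmall.
Unshelve. all: by end_near. Qed.

End minimality.

(** * The domain is not empty *)

Section nonempty.
Context {R : realType}.
Implicit Types (u w s : R -> R) (a b c r x : R).
Local Notation mu := (@lebesgue_measure R).

(** Difference quotients are at most L; at points without a derivative the
    default value is 0. *)
Lemma lipschitz_derive1_le u (L : R) x : 0 <= L -> (forall y z, `|u y - u z| <= L * `|y - z|) ->
  `|u^`()%classic x| <= L.
Proof.
move=> L0 uL; have [du|ndu] := pselect (derivable u x 1); last first.
  by rewrite derive1E /derive (dvgP ndu) normr0.
have h : `|diff_quotient u n.+1%:R^-1 x| @[n --> \oo] --> `|u^`()%classic x|.
  by apply: cvg_norm; exact: derivable_cvg_diff_quotient.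
rewrite -(cvg_lim _ h)//; apply: limr_le; first by apply: cvgP h.
apply: nearW => n; have h0 : 0 < n.+1%:R^-1 :> R by rewrite invr_gt0.
rewrite /diff_quotient; move: (n.+1%:R^-1) h0 => t t0.
rewrite normrM normfV (gtr0_norm t0) mulrC ler_pdivrMr//; apply: le_trans (uL _ _) _.
by rewrite addrAC subrr add0r gtr0_norm.
Qed.

Lemma lipschitz_line_ac u (L : R) : 0 <= L ->
  (forall y z, `|u y - u z| <= L * `|y - z|) -> line_ac u.
Proof.
move=> L0 uL e e0; exists (e / (L + 1)); first by rewrite divr_gt0//; lra.
move=> n l r lr _ lrd.
apply: (@le_lt_trans _ _ (L * \sum_(k < n) (r k - l k))).
  rewrite mulr_sumr ler_sum// => k _; apply: le_trans (uL _ _) _.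
  by rewrite ger0_norm// subr_ge0.
have S0 : 0 <= \sum_(k < n) (r k - l k) by rewrite sumr_ge0// => k _; rewrite subr_ge0.
move: lrd; rewrite ltr_pdivlMr; [nra|lra].
Qed.

Lemma integrable_Rpos_bounded u (B M : R) : measurable_fun (@Rpos R) u ->
  (forall x, 0 < x -> `|u x| <= B) -> (forall x, M < x -> u x = 0) ->
  mu.-integrable Rpos (EFin \o u).
Proof.
move=> mu_ uB uM; apply: (@integrable_Rpos_le _ _ (fun x => B * (\1_(`[0, M]%classic) : R -> R) x)) => //.
- move=> x x0; rewrite indicE; case: (boolP (x \in _)) => [_|]; first by rewrite mulr1 uB.
  rewrite notin_setE /= in_itv/= (ltW x0)/= => /negP; rewrite -ltNge => /uM ->.
  by rewrite mulr0 normr0.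
- by apply: integrable_RposZ; exact: integrable_Rpos_indic.
Qed.

Lemma ereal_lty (h : R -> R) : mu.-integrable Rpos (EFin \o h) ->
  (\int[mu]_(x in Rpos) (h x)%:E < +oo)%E.
Proof. by move=> ih; rewrite EFin_Rintegral// ltry. Qed.

(** All weights are bounded on the support, which is a compact subset of the
    open half-line. *)
Lemma lipschitz_bump_DP u (L a b : R) : 0 < a -> 0 <= L ->
  (forall y z, `|u y - u z| <= L * `|y - z|) -> (forall x, ~~ (a <= x <= b) -> u x = 0) ->
  \int[mu]_(x in Rpos) (u x ^+ 2) = 1 -> moment (@ln R) (fun x => u x ^+ 2) = 0 ->
  DP (fun x => (u x)%:C).
Proof.
move=> a0 L0 uL uab u1 lnu.
have uac := lipschitz_line_ac L0 uL; have lac := line_ac_loc_ac uac.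
have cu := loc_ac_continuous lac.
have mu_ : measurable_fun (@Rpos R) u.
  by apply: measurable_funTS; exact: continuous_measurable_fun.
have mu' : measurable_fun (@Rpos R) u^`()%classic.
  by apply: measurable_funTS; exact: measurable_derive1.
have ub x : b < x -> u x = 0 by move=> bx; apply: uab; rewrite negb_and -!ltNge bx orbT.
have ua x : x < a -> u x = 0 by move=> xa; apply: uab; rewrite negb_and -!ltNge xa.
have u'b x : b < x -> u^`()%classic x = 0.
  move=> bx; rewrite derive1E (@near_eq_derive _ _ _ _ (cst 0) _ (1 : R)) ?derive_cst//.
  by near=> y; apply: ub; near: y; exact: lt_nbhsr.
pose U := L * (a + `|b|); have U0 : 0 <= U by rewrite mulr_ge0// addr_ge0// ltW.
have uU x : `|u x| <= U.
  have [xab|/uab ->] := boolP (a <= x <= b); last by rewrite normr0.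
  rewrite -[u x]subr0 -(ua (a / 2)); last by lra.
  apply: le_trans (uL _ _) _; rewrite ler_wpM2l// ler_norml.
  by case/andP: xab => ax xb; have := ler_norm b; move=> bb; apply/andP; split; lra.
have u2 x : u x ^+ 2 <= U ^+ 2.
  by rewrite -[u x ^+ 2]ger0_norm ?sqr_ge0// normrX lerXn2r ?nnegrE.
have u'2 x : u^`()%classic x ^+ 2 <= L ^+ 2.
  rewrite -[_ ^+ 2]ger0_norm ?sqr_ge0// normrX lerXn2r ?nnegrE//.
  exact: lipschitz_derive1_le.
(* phi need only be bounded where v does not vanish. *)
have sq_bounded (phi v : R -> R) (P V : R) : 0 <= P -> measurable_fun (@Rpos R) phi ->
    measurable_fun (@Rpos R) v -> (forall x, v x ^+ 2 <= V ^+ 2) -> (forall x, b < x -> v x = 0) ->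
    (forall x, 0 < x -> v x ^+ 2 != 0 -> `|phi x| <= P) ->
    (\int[mu]_(x in Rpos) (phi x * v x ^+ 2)%:E < +oo)%E.
  move=> P0 mphi mv vV vb phiP; apply: ereal_lty.
  apply: (@integrable_Rpos_bounded _ (P * V ^+ 2) b).
  - by apply: measurable_funM => //; exact: measurable_funX.
  - move=> x x0; have [->|vx] := eqVneq (v x ^+ 2) 0.
      by rewrite mulr0 normr0 mulr_ge0// sqr_ge0.
    by rewrite normrM (ger0_norm (sqr_ge0 (v x))) ler_pM ?sqr_ge0 ?phiP.
  - by move=> x /vb ->; rewrite expr0n mulr0.
have int1 (v : R -> R) (V : R) : measurable_fun (@Rpos R) v ->
    (forall x, v x ^+ 2 <= V ^+ 2) -> (forall x, b < x -> v x = 0) ->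
    (\int[mu]_(x in Rpos) (v x ^+ 2)%:E < +oo)%E.
  move=> mv vV vb.
  have n1 x : 0 < x -> v x ^+ 2 != 0 -> `|cst 1 x : R| <= 1 by rewrite /= normr1.
  apply: le_lt_trans (@sq_bounded (cst 1) v 1 V ler01 (measurable_cst _) mv vV vb n1).
  rewrite le_eqVlt; apply/orP; left; apply/eqP.
  by apply: eq_integral => x _; rewrite /= mul1r.
have u_in x : u x ^+ 2 != 0 -> a <= x <= b.
  by apply: contraR => /uab ->; rewrite expr0n.
apply: DP_real => //.
- by move=> x x0; apply: ua; exact: le_lt_trans a0.
- exact: int1 mu' u'2 u'b.
- apply: (@sq_bounded id _ `|b| L) => //.
  move=> x x0; rewrite gtr0_norm// => vx; apply: le_trans (ler_norm b).
  by rewrite leNgt; apply: contra vx => /u'b ->; rewrite expr0n.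
- exact: int1 mu_ u2 ub.
- apply: (@sq_bounded _ _ (a ^- 2) U) => //.
  + by rewrite invr_ge0 sqr_ge0.
  + by under eq_fun do rewrite -exprVn; apply: measurable_funX; exact: measurable_Vr.
  + move=> x x0 /u_in/andP[ax _]; rewrite ger0_norm ?invr_ge0 ?sqr_ge0//.
    by rewrite lef_pV2 ?posrE ?exprn_gt0// lerXn2r ?nnegrE// ltW.
- apply: (@sq_bounded _ _ ((a^-1 + `|b|) ^+ 2) U) => //.
  + exact: sqr_ge0.
  + by apply: measurable_funX; exact: measurable_ln_Rpos.
  + move=> x x0 /u_in/andP[ax xb].
    have aV : 0 < a^-1 by rewrite invr_gt0.
    rewrite normrX lerXn2r ?nnegrE ?addr_ge0 ?(ltW aV)// ler_norml.
    have h1 := ln_sublinear x0.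
    have h2 : - ln x < x^-1 by rewrite -lnV ?posrE// ln_sublinear// invr_gt0.
    have h3 : x^-1 <= a^-1 by rewrite lef_pV2 ?posrE.
    by have h4 := ler_norm b; apply/andP; split; lra.
Unshelve. all: by end_near. Qed.

Definition tent c r x := Num.max 0 (1 - `|x - c| / r).

Lemma tent_lip c r y z : 0 < r -> `|tent c r y - tent c r z| <= r^-1 * `|y - z|.
Proof.
move=> r0; have rV : 0 < r^-1 by rewrite invr_gt0.
have h : `| `|y - c| - `|z - c| | <= `|y - z|.
  by rewrite (le_trans (ler_dist_dist _ _))// opprB addrA subrK.
have {}h : `| `|y - c| / r - `|z - c| / r| <= r^-1 * `|y - z|.
  by rewrite -mulrBl normrM (gtr0_norm rV) mulrC ler_wpM2l// ltW.
move: h; rewrite /tent /Num.max; move: (`|y - c| / r) (`|z - c| / r) (r^-1 * _) => s t d.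
rewrite !ler_norml => /andP[? ?]; case: ifPn => ?; case: ifPn => ?; apply/andP; split; lra.
Qed.

Lemma tent_supp c r x : 0 < r -> ~~ (c - r <= x <= c + r) -> tent c r x = 0.
Proof.
move=> r0; rewrite -ler_distl -ltNge => h; apply/max_idPl.
by rewrite subr_le0 ler_pdivlMr// mul1r ltW.
Qed.

Lemma tent_ge0 c r x : 0 <= tent c r x.
Proof. by rewrite le_max lexx. Qed.

Lemma tent_le1 c r x : 0 < r -> tent c r x <= 1.
Proof. by move=> r0; rewrite ge_max ler01 lerBlDr lerDl divr_ge0// ltW. Qed.

Lemma measurable_tent_sqr c r : 0 < r -> measurable_fun (@Rpos R) (fun x => tent c r x ^+ 2).
Proof.
move=> r0; apply: measurable_funX; apply: measurable_funTS; apply: continuous_measurable_fun.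
apply: loc_ac_continuous; apply: line_ac_loc_ac.
apply: (@lipschitz_line_ac _ r^-1); first by rewrite invr_ge0 ltW.
by move=> y z; exact: tent_lip.
Qed.

Lemma integrable_tent c r (phi : R -> R) : 0 < r < c -> measurable_fun (@Rpos R) phi ->
  (forall x, c - r <= x <= c + r -> `|phi x| <= (c - r)^-1 + (c + r)) ->
  mu.-integrable Rpos (EFin \o (fun x => phi x * tent c r x ^+ 2)).
Proof.
move=> /andP[r0 rc] mphi phiB.
have cr : 0 < (c - r)^-1 by rewrite invr_gt0; lra.
apply: (@integrable_Rpos_bounded _ ((c - r)^-1 + (c + r)) (c + r)).
- by apply: measurable_funM => //; exact: measurable_tent_sqr.
- move=> x x0; have [xin|/tent_supp ->//] := boolP (c - r <= x <= c + r); last first.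
    by rewrite expr0n mulr0 normr0; lra.
  rewrite normrM -[leRHS]mulr1 ler_pM ?phiB// normrX ger0_norm ?tent_ge0//.
  by rewrite expr_le1 ?tent_ge0// tent_le1.
- by move=> x cx; rewrite tent_supp// ?expr0n ?mulr0// negb_and -!ltNge cx orbT.
Qed.

Lemma integrable_tent_sqr c r : 0 < r < c ->
  mu.-integrable Rpos (EFin \o (fun x => tent c r x ^+ 2)).
Proof.
move=> /andP[r0 rc].
apply: (@integrable_Rpos_bounded _ 1 (c + r)); first exact: measurable_tent_sqr.
- move=> x _; rewrite normrX ger0_norm ?tent_ge0//.
  by rewrite expr_le1 ?tent_ge0// tent_le1.
- by move=> x cx; rewrite tent_supp// ?expr0n ?mulr0// negb_and -!ltNge cx orbT.
Qed.

(** On the inner half of its support the tent is at least 1/2. *)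
Lemma tent_mass_gt0 c r : 0 < r < c -> 0 < \int[mu]_(x in Rpos) tent c r x ^+ 2.
Proof.
move=> /[dup] rc0 /andP[r0 rc].
have it := integrable_tent_sqr rc0; pose J : set R := `[c - r / 2, c + r / 2]%classic.
have mJ : measurable J by exact: measurable_itv.
rewrite -lte_fin -EFin_Rintegral//.
apply: (@lt_le_trans _ _ (\int[mu]_(x in J) cst ((1 / 2) ^+ 2)%R%:E x)%E).
  rewrite integral_cst//= /J lebesgue_measure_itv/= lte_fin ifT; last by lra.
  by rewrite -EFinB -EFinM lte_fin mulr_gt0 ?exprn_gt0//; lra.
apply: (@le_trans _ _ (\int[mu]_(x in J) (tent c r x ^+ 2)%R%:E)%E).
  apply: ge0_le_integral => //.
  - by move=> x _; rewrite lee_fin sqr_ge0.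
  - apply/measurable_EFinP; apply: measurable_funS (measurable_tent_sqr c r0) => //.
    by move=> x; rewrite /J /= in_itv/= RposE => /andP[h _]; apply: lt_le_trans h; lra.
  - move=> x; rewrite /J /= in_itv/= => xin; rewrite lee_fin lerXn2r ?nnegrE ?tent_ge0//.
    rewrite le_max; apply/orP; right.
    have : `|x - c| <= r / 2 by rewrite ler_distl.
    rewrite lerBrDr -lerBrDl ler_pdivrMr//; lra.
apply: ge0_subset_integral => //.
- apply/measurable_EFinP; exact: measurable_tent_sqr.
- by move=> x _; rewrite lee_fin sqr_ge0.
- by move=> x; rewrite /J /= in_itv/= RposE => /andP[h _]; apply: lt_le_trans h; lra.
Qed.

(** Two tents with disjoint supports to the left and to the right of 1 have
    ln-moments m1 < 0 < m2. The squared weights m2 / d and - m1 / d, with d =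
    m2 N1 - m1 N2 > 0, annihilate the ln-moment and normalize the mass. *)
Lemma DP_nonempty : exists f : R -> R[i], DP f.
Proof.
have r14 : 0 < (1 / 4 : R) < 1 / 2 by apply/andP; split; lra.
have r13 : 0 < (1 : R) < 3 by apply/andP; split; lra.
have r4 : (0 : R) < 1 / 4 by lra.
pose t1 : R -> R := tent (1 / 2) (1 / 4); pose t2 : R -> R := tent 3 1.
have t1s x : ~~ (1 / 4 <= x <= 3 / 4) -> t1 x = 0.
  move=> h; apply: tent_supp => //; apply: contra h => /andP[? ?]; apply/andP; split; lra.
have t2s x : ~~ (2 <= x <= 4) -> t2 x = 0.
  move=> h; apply: tent_supp => //; apply: contra h => /andP[? ?]; apply/andP; split; lra.
have t12 x : t1 x * t2 x = 0.
  have [x1|x1] := leP x 1.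
    by rewrite t2s ?mulr0// negb_and -!ltNge; apply/orP; left; lra.
  by rewrite t1s ?mul0r// negb_and -!ltNge; apply/orP; right; lra.
have mln := @measurable_ln_Rpos R.
have lnB (a b x : R) : 0 < a -> a <= x <= b -> `|ln x| <= a^-1 + b.
  move=> a0 /andP[ax xb]; have x0 : 0 < x by exact: lt_le_trans ax.
  have aV : 0 < a^-1 by rewrite invr_gt0.
  have h1 := ln_sublinear x0.
  have h2 : - ln x < x^-1 by rewrite -lnV ?posrE// ln_sublinear// invr_gt0.
  have h3 : x^-1 <= a^-1 by rewrite lef_pV2 ?posrE.
  by rewrite ler_norml; apply/andP; split; lra.
have i1 : mu.-integrable Rpos (EFin \o (fun x => ln x * t1 x ^+ 2)).
  by apply: integrable_tent => // x; apply: lnB; lra.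
have i2 : mu.-integrable Rpos (EFin \o (fun x => ln x * t2 x ^+ 2)).
  by apply: integrable_tent => // x; apply: lnB; lra.
have one1 : mu.-integrable Rpos (EFin \o (fun x => t1 x ^+ 2)).
  exact: integrable_tent_sqr.
have one2 : mu.-integrable Rpos (EFin \o (fun x => t2 x ^+ 2)).
  exact: integrable_tent_sqr.
have n1 := tent_mass_gt0 r14; have n2 := tent_mass_gt0 r13.
rewrite -/t1 in n1; rewrite -/t2 in n2.
set N1 := \int[mu]_(x in _) _ in n1; set N2 := \int[mu]_(x in _) _ in n2.
pose m1 := moment (@ln R) (fun x => t1 x ^+ 2); pose m2 := moment (@ln R) (fun x => t2 x ^+ 2).
have m10 : m1 < 0.
  apply: (@le_lt_trans _ _ (ln (3 / 4) * N1)).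
    rewrite -RintegralZl//; apply: le_Rintegral => //; first exact: integrable_RposZ.
    move=> x; rewrite RposE => x0; have [/andP[_ xle]|/t1s ->] := boolP (1 / 4 <= x <= 3 / 4).
      by rewrite ler_wpM2r ?sqr_ge0// ler_ln ?posrE//; lra.
    by rewrite expr0n !mulr0.
  by rewrite nmulr_rlt0// ln_lt0//; apply/andP; split; lra.
have m20 : 0 < m2.
  apply: (@lt_le_trans _ _ (ln 2 * N2)).
    by rewrite mulr_gt0// ln_gt0//; lra.
  rewrite -RintegralZl//; apply: le_Rintegral => //; first exact: integrable_RposZ.
  move=> x; rewrite RposE => x0; have [/andP[xge _]|/t2s ->] := boolP (2 <= x <= 4).
    by rewrite ler_wpM2r ?sqr_ge0// ler_ln ?posrE//; lra.
  by rewrite expr0n !mulr0.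
pose d := m2 * N1 - m1 * N2.
have d0 : 0 < d by rewrite /d; nra.
pose p := Num.sqrt (m2 / d); pose q := Num.sqrt (- m1 / d).
have p2 : p ^+ 2 = m2 / d by rewrite sqr_sqrtr// divr_ge0// ltW.
have q2 : q ^+ 2 = - m1 / d by rewrite sqr_sqrtr// divr_ge0 ?(ltW d0)// oppr_ge0 ltW.
have p0 : 0 <= p by exact: sqrtr_ge0.
have q0 : 0 <= q by exact: sqrtr_ge0.
pose u x := p * t1 x + q * t2 x.
have u2 x : u x ^+ 2 = p ^+ 2 * t1 x ^+ 2 + q ^+ 2 * t2 x ^+ 2.
  have -> : u x ^+ 2 = p ^+ 2 * t1 x ^+ 2 + q ^+ 2 * t2 x ^+ 2 + 2 * p * q * (t1 x * t2 x).
    by rewrite /u; ring.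
  by rewrite t12 mulr0 addr0.
exists (fun x => (u x)%:C); apply: (@lipschitz_bump_DP _ (p * 4 + q) (1 / 4) 4) => //.
- lra.
- move=> y z; have h1 := tent_lip (1 / 2) y z r4; have h2 := tent_lip 3 y z ltr01.
  have -> : u y - u z = p * (t1 y - t1 z) + q * (t2 y - t2 z) by rewrite /u; ring.
  apply: le_trans (ler_normD _ _) _; rewrite !normrM (ger0_norm p0) (ger0_norm q0) mulrDl.
  rewrite -mulrA; apply: lerD; rewrite ler_wpM2l//.
    by apply: le_trans h1 _; rewrite mul1r invrK.
  by apply: le_trans h2 _; rewrite invr1 mul1r.
- move=> x xn; rewrite /u t1s ?t2s ?mulr0 ?addr0//; apply: contra xn => /andP[? ?];
    apply/andP; split; lra.
- rewrite (_ : \int[mu]_(x in Rpos) _ =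
    \int[mu]_(x in Rpos) (p ^+ 2 * t1 x ^+ 2 + q ^+ 2 * t2 x ^+ 2)); last first.
    by apply: eq_Rintegral => x _; exact: u2.
  rewrite RintegralD//; [|exact: integrable_RposZ|exact: integrable_RposZ].
  by rewrite !RintegralZl// -/N1 -/N2 p2 q2 /d; field; rewrite gt_eqF.
- rewrite /moment (_ : \int[mu]_(x in Rpos) _ =
    \int[mu]_(x in Rpos) (p ^+ 2 * (ln x * t1 x ^+ 2) + q ^+ 2 * (ln x * t2 x ^+ 2))); last first.
    by apply: eq_Rintegral => x _; rewrite u2; ring.
  rewrite RintegralD//; [|exact: integrable_RposZ|exact: integrable_RposZ].
  rewrite !RintegralZl// -/(moment _ (fun x => t1 x ^+ 2)) -/(moment _ (fun x => t2 x ^+ 2)).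
  by rewrite -/m1 -/m2 p2 q2; field; rewrite gt_eqF.
Qed.

End nonempty.

(** * Existence of a minimizer *)

Theorem theorem4p1 (R : realType) :
  exists2 f0 : R -> R[i], DP f0 & forall f : R -> R[i], DP f -> LP f0 <= LP f.
Proof.
pose V : set R := [set LP f | f in DP].
have V0 : has_lbound V.
  exists 0 => _ [f fDP <-].
  by have [/andP[k0 kL] _ _ _ _] := LP_bounds fDP (lexx _); exact: le_trans kL.
have Vinf : has_inf V.
  have [f fDP] := @DP_nonempty R; split; last exact: V0.
  by exists (LP f); exists f.
have near_inf (n : nat) : exists f : R -> R[i], DP f /\ LP f <= inf V + n.+1%:R^-1.
  have n0 : 0 < n.+1%:R^-1 :> R by rewrite invr_gt0.
  by have [_ [f fDP <-] /ltW Lf] := inf_adherent n0 Vinf; exists f.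
have [f_ f_P] := choice near_inf.
have [n|n|f0 f0DP Lf0] := @minimizing_limit R f_ (inf V).
- by have [] := f_P n.
- by have [] := f_P n.
exists f0; first exact: f0DP.
move=> f fDP; apply: (le_trans Lf0); apply: (ge_inf V0).
by exists f.
Qed.
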